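(* Let $\mathcal T$ be a tree of root $\mathcal R$, and let $T(\mathcal R)$ and $T(\mathcal T)$ be the times defined in the context. Assume that the sequence $(\alpha_n)_{n\in\mathcal N_M}$ satisfies $$\alpha_n=k_n-2,\qquad n\in\mathcal N_M.$$ Pick any initial data $U_0=(u_i^0,u_i^1)_{i\in\mathcal I}\in\mathcal H$. (i) If $U_0\in\mathcal H_0$, then the solution $(u_i)_{i\in\mathcal I}$ of the network system with the Dirichlet condition $u_1(0,t)=0$ at the root satisfies $$u_i(\cdot,t)\equiv 0\qquad\forall t\ge 2T(\mathcal R),\ \forall i\in\mathcal I.$$ (ii) The solution $(u_i)_{i\in\mathcal I}$ of the network system with the Neumann condition $u_{1,x}(0,t)=0$ at the root satisfies, for some number $C\in\mathbb R$, $$u_i(\cdot,t)\equiv C\qquad\forall t\ge 2T(\mathcal R),\ \forall i\in\mathcal I.$$ (iii) The solution $(u_i)_{i\in\mathcal I}$ of the network system with the transparent condition $c_1u_{1,x}(0,t)=u_{1,t}(0,t)$ at the root satisfies, for some number $C\in\mathbb R$, $$u_i(\cdot,t)\equiv C\qquad\forall t\ge T(\mathcal T),\ \forall i\in\mathcal I.$$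
   Context: Network. $\mathcal T$ is a finite tree with nodes $n\in\mathcal N=\{0,\dots,N\}$ and edges $i\in\mathcal I=\{1,\dots,N\}$. The node $0$ is an external (simple, i.e. degree one) node called the root and denoted $\mathcal R$; edges are oriented away from the root. Each edge has length $1$ and is parametrized by $x\in[0,1]$, $x=0$ being its initial point and $x=1$ its final point. The numbering is such that edge $i$ has node $i$ as final point, and edge $1$ has the root as initial point. $\mathcal N_S$ and $\mathcal N_M$ denote the sets of simple (degree one, external) and multiple (internal) nodes. For $n\in\mathcal N_M$, $\mathcal I_n$ is the set of edges having node $n$ as initial point, and $k_n=\#\mathcal I_n+1\ge 2$ is the number of edges meeting at $n$ (degree-two internal nodes are allowed). Constants (wave speeds) $c_i>0$, $i\in\mathcal I$, are given. Network system. With real coefficients $(\alpha_n)_{n\in\mathcal N_M}$: $u_{i,tt}-c_i^2u_{i,xx}=0$ for $t>0$, $0<x<1$, $i\in\mathcal I$; $(u_i(\cdot,0),u_{i,t}(\cdot,0))=(u_i^0,u_i^1)$, $i\in\mathcal I$; $c_nu_{n,x}(1,t)=-u_{n,t}(1,t)$ for $n\in\mathcal N_S\setminus\{0\}$; $\sum_{i\in\mathcal I_n}c_iu_{i,x}(0,t)-c_nu_{n,x}(1,t)=-\alpha_nu_{n,t}(1,t)$ for $n\in\mathcal N_M$; $u_i(0,t)=u_n(1,t)$ for $n\in\mathcal N_M$, $i\in\mathcal I_n$; supplemented by one condition at the root (Dirichlet, Neumann or transparent). Spaces and solutions. $$\mathcal H=\Big\{(u_i,v_i)_{i\in\mathcal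 I}\in\prod_{i\in\mathcal I}[H^1(0,1)\times L^2(0,1)]:\ u_i(0)=u_n(1)\ \forall n\in\mathcal N_M,\ \forall i\in\mathcal I_n\Big\},$$ $$\mathcal H_0=\{(u_i,v_i)_{i\in\mathcal I}\in\mathcal H:\ u_1(0)=0\}.$$ Solutions are the (weak) solutions with $(u_i,u_{i,t})_{i\in\mathcal I}\in C([0,\infty);\mathcal H)$ (resp. $\mathcal H_0$ in the Dirichlet case), i.e. the trajectories of the strongly continuous semigroup generated by $(u_i,v_i)_i\mapsto(v_i,c_i^2u_{i,xx})_i$ on $\mathcal H$ (resp. $\mathcal H_0$), with domain the set of $(u_i,v_i)_i\in\prod_i[H^2(0,1)\times H^1(0,1)]$ satisfying the node and root conditions above (with $u_{i,t}$ replaced by $v_i$), $v_i(0)=v_n(1)$ for $n\in\mathcal N_M$, $i\in\mathcal I_n$, and, in the Dirichlet case, $v_1(0)=0$. Times. Define $(t_i)_{i\in\mathcal I}$ by $t_i=c_i^{-1}$ if $i\in\mathcal N_S\setminus\{0\}$, and $t_i=c_i^{-1}+\max_{j\in\mathcal I_i}t_j$ if $i\in\mathcal N_M$. Set $T(\mathcal R)=t_1$. (Equivalently $T(\mathcal R)$ is the maximum, over all external nodes other than $\mathcal R$, of the sum of $c_i^{-1}$ over the edges $i$ of the path from $\mathcal R$ to that node.) $T(\mathcal T)$ is the largest of the values $T(\mathcal R')$ when the root $\mathcal R'$ ranges over all external nodes of $\mathcal T$ (re-orienting and renumbering the tree accordingly, each edge keeping its speed). *)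

(* Defs.v *)
From HB Require Import structures.
From mathcomp Require Import all_boot all_order all_algebra.
From mathcomp Require Import all_classical all_reals all_analysis.

Set Implicit Arguments.
Unset Strict Implicit.
Unset Printing Implicit Defensive.

Import Order.TTheory GRing.Theory Num.Theory.
Import numFieldNormedType.Exports.

Local Open Scope classical_set_scope.
Local Open Scope ring_scope.

(* Simple graphs are symmetric irreflexive relations on a finite type. *)

Section Tree.
Context (V : finType) (e : rel V).

Definition is_tree : Prop :=
  [/\ symmetric e, irreflexive e, (forall x y, connect e x y) &
      forall s : seq V, (2 < size s)%N -> ~~ ucycleb e s].

Definition degree (n : V) : nat := #|[set m | e n m]|.

Definition simple_node (n : V) : bool := degree n == 1%N.

Definition multiple_node (n : V) : bool := (2 <= degree n)%N.

(* In the tree rooted at [r], the edge {n, i} is oriented from n to i (away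
   from [r]) when n can be reached from [r] without going through i. *)
Definition avoiding (i : V) : rel V := [rel a b | [&& e a b, a != i & b != i]].

Definition directed (r n i : V) : bool := e n i && connect (avoiding i) r n.

(* An edge is named after its final point, so the edges of the tree rooted at
   [r] are the i : V with i != r, and [out_edges r n] is I_n. *)
Definition out_edges (r n : V) : {set V} := [set i | directed r n i].

(* Initial point of the edge i (junk value r when i = r). *)
Definition parent (r i : V) : V := odflt r [pick n | directed r n i].

(* k_n *)
Definition edges_at (r n : V) : nat := #|out_edges r n|.+1.

End Tree.

(* Speeds are attached to unoriented edges {n, i}, so that they do not depend
   on the root. *)
Section Times.
Context (R : realType) (V : finType) (e : rel V) (c : {set V} -> R).

Definition speed (r i : V) : R := c [set parent e r i; i].

(* The times are positive and the maximum over the empty set is 0, so the case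
   of a simple node i needs no separate clause. The first argument bounds the
   recursion depth; #|V| is enough, as lemma [edge_timeE] shows. *)
Fixpoint edge_time_rec (m : nat) (r i : V) : R :=
  if m is m'.+1 then
    (speed r i)^-1 + \big[Num.max/0]_(j in out_edges e r i) edge_time_rec m' r j
  else 0.

Definition edge_time (r i : V) : R := edge_time_rec #|V| r i.

(* When r is a simple node, [out_edges e r r] is a singleton. *)
Definition root_time (r : V) : R :=
  \big[Num.max/0]_(j in out_edges e r r) edge_time r j.

Definition tree_time : R := \big[Num.max/0]_(r | simple_node e r) root_time r.

Section EdgeTimeE.
Context (treeT : is_tree e) (r : V).

Let below (i : V) : {set V} := [set y | ~~ connect (avoiding e i) r y].

Let avoiding_sym x a b :
  connect (avoiding e x) a b = connect (avoiding e x) b a.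
Proof.
case: treeT => esym _ _ _; apply: (@sym_connect_sym _ (avoiding e x)) => u v.
by rewrite /avoiding /= esym; congr (_ && _); rewrite andbC.
Qed.

Let no_bypass x y : e x y -> connect (avoiding e y) r x ->
  ~~ connect (avoiding e x) r y.
Proof.
case: treeT => esym eirr _ acyc exy rx; apply/negP => ry.
pose e' := [rel a b | e a b && ~~ ((a == x) && (b == y) || (a == y) && (b == x))].
have sub z : z \in [:: x; y] -> subrel (connect (avoiding e z)) (connect e').
  move=> zxy; apply: connect_sub => a b /and3P[ab az bz]; apply: connect1.
  rewrite /e' /= ab /=; move: az bz; move: zxy; rewrite !inE.
  by case/orP=> /eqP-> /negPf-> /negPf->; rewrite ?andbF.
have xy : connect e' x y.
  apply: (@connect_trans _ _ r).
    by apply: (sub y); rewrite ?inE ?eqxx ?orbT // avoiding_sym.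
  by apply: (sub x); rewrite ?inE ?eqxx.
case/connectP: xy => p pth lst; case/shortenP: pth lst => q qpth quniq _ lst.
have qe : path e x q by apply: sub_path qpth => a b /andP[].
have : ucycleb e (x :: q).
  by rewrite /ucycleb quniq andbT /= rcons_path qe /= -lst esym.
apply/negP/acyc; case: q qpth qe lst {quniq} => [|a [|b q]] //=.
  by move=> _ _ yx; move: exy; rewrite yx eirr.
by move=> /andP[/andP[_ +] _] _ yx; rewrite yx !eqxx.
Qed.

Let below_self i : i != r -> i \in below i.
Proof.
move=> ir; rewrite inE; apply/negP => /connectP[p]; case/lastP: p => [_ /= rE|p z].
  by rewrite rE eqxx in ir.
by rewrite rcons_path last_rcons => /andP[_ /and3P[_ _ +]] iz; rewrite iz eqxx.
Qed.

Let below_proper i j : i != r -> j \in out_edges e r i ->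
  below j \proper below i.
Proof.
move=> ir; rewrite inE => /andP[eij rij]; apply/properP; split; last first.
  by exists i; [exact: below_self|rewrite inE negbK].
apply/fintype.subsetP => z; rewrite !inE; apply: contra.
case/connectP => p pth ->; apply/connectP; exists p => //.
have jp : j \notin r :: p.
  apply: contra (no_bypass eij rij) => /splitPl jp.
  case: jp pth => p1 p2 lp1; rewrite cat_path => /andP[p1th _].
  by apply/connectP; exists p1.
elim: p (r) pth jp => //= b p IH a /andP[/and3P[ab _ _] bp].
rewrite !inE !negb_or => /and3P[ja jb jp].
rewrite /avoiding /= ab eq_sym ja eq_sym jb /=; apply: IH => //.
by rewrite inE negb_or jb.
Qed.

Let out_neq_root i j : j \in out_edges e r i -> j != r.
Proof.
case: treeT => _ eirr _ _; rewrite inE => /andP[eij /connectP[p]].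
case: p => [_ /= ir|a p /= /andP[/and3P[_ + _] _] _]; last by rewrite eq_sym.
by apply: contraTneq eij => ->; rewrite ir eirr.
Qed.

Let edge_time_rec_stable m n i : i != r -> (#|below i| <= m)%N ->
  (#|below i| <= n)%N -> edge_time_rec m r i = edge_time_rec n r i.
Proof.
elim: m n i => [|m IH] [|n] i ir; rewrite ?leqn0 ?cards_eq0 => im im'.
- by [].
- by move: (below_self ir); rewrite (eqP im) inE.
- by move: (below_self ir); rewrite (eqP im') inE.
rewrite /=; congr (_ + _); apply: eq_bigr => j ji.
have lt_ji := proper_card (below_proper ir ji).
by apply: IH (out_neq_root ji) _ _; rewrite -ltnS; apply: leq_trans lt_ji _.
Qed.

Lemma edge_timeE i : i != r ->
  edge_time r i =
  (speed r i)^-1 + \big[Num.max/0]_(j in out_edges e r i) edge_time r j.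
Proof.
move=> ir; rewrite {1}/edge_time.
rewrite (@edge_time_rec_stable _ #|V|.+1) ?max_card //.
by rewrite ltnW // ltnS max_card.
Qed.

End EdgeTimeE.
End Times.

Section Sobolev.
Context (R : realType).
Implicit Types u g phi : R -> R.

Local Notation mu := (@lebesgue_measure R).
Local Notation I01 := (`[0 : R, 1 : R]%classic : set R).

Definition L2 g : Prop :=
  measurable_fun I01 g /\ mu.-integrable I01 (EFin \o (fun x => g x ^+ 2)).

(* C^1 functions with compact support in (0,1) *)
Definition test_function phi : Prop :=
  [/\ forall x, derivable phi x 1, continuous (derive1 phi) &
      exists a b : R, [/\ 0 < a, b < 1 & forall x, x \notin `[a, b] -> phi x = 0]].

(* u is the continuous representative of an element of H^1(0,1) whose weak
   derivative is g. *)
Definition H1_deriv u g : Prop :=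
  [/\ {within I01, continuous u}, L2 g &
      forall phi, test_function phi ->
        \int[mu]_(x in I01) (u x * derive1 phi x) =
        - \int[mu]_(x in I01) (g x * phi x)].

Definition H1 u : Prop := exists g, H1_deriv u g.

Definition weak_deriv u : R -> R := xget (cst 0) [set g | H1_deriv u g].

End Sobolev.

(* Strongly continuous semigroups on a linear subspace H of E that is normed by
   the restriction of nrm once elements at distance 0 are identified. *)
Section Semigroup.
Context (R : realType) (E : lmodType R) (H : set E) (nrm : E -> R).

Definition C0_semigroup (S : R -> E -> E) : Prop :=
  [/\ forall t U, 0 <= t -> H U -> H (S t U),
      forall t a U W, 0 <= t -> H U -> H W ->
        nrm (S t (a *: U + W) - (a *: S t U + S t W)) = 0,
      forall t, 0 <= t -> exists M, forall U, H U -> nrm (S t U) <= M * nrm U,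
      forall U, H U -> nrm (S 0 U - U) = 0 /\
        forall s t, 0 <= s -> 0 <= t -> nrm (S (s + t) U - S s (S t U)) = 0 &
      forall U t0, H U -> 0 <= t0 ->
        nrm (S t U - S t0 U) @[t --> within [set t | 0 <= t] (nbhs t0)]
          --> (0 : R)].

(* The unbounded operator A is given by its graph. *)
Definition generated_by (S : R -> E -> E) (A : E -> E -> Prop) : Prop :=
  forall U W, H U -> H W ->
    (A U W <-> nrm (h^-1 *: (S h U - U) - W) @[h --> 0^'+] --> (0 : R)).

End Semigroup.

Variant root_condition := Dirichlet | Neumann | Transparent.

Section Network.
Context (R : realType) (V : finType) (e : rel V) (r : V).
Context (c : {set V} -> R) (alpha : V -> R).

Local Notation mu := (@lebesgue_measure R).
Local Notation I01 := (`[0 : R, 1 : R]%classic : set R).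
Local Notation I_ n := (out_edges e r n).
Local Notation c_ i := (speed e c r i).

(* U.1 i and U.2 i are u_i and v_i. Only the edges i != r and the values on
   [0,1] matter; v_i is determined up to a negligible set, whereas u_i is the
   continuous representative. *)
Definition state : lmodType R := ((V -> R -> R^o) * (V -> R -> R^o))%type.

Definition continuous_at_nodes (u : V -> R -> R) : Prop :=
  forall n i, multiple_node e n -> i \in I_ n -> u i 0 = u n 1.

Definition spaceH : set state := [set U |
  (forall i, i != r -> H1 (U.1 i) /\ L2 (U.2 i)) /\ continuous_at_nodes U.1].

Definition spaceH0 : set state := [set U |
  spaceH U /\ forall i, i \in I_ r -> U.1 i 0 = 0].

Definition normH (U : state) : R :=
  Num.sqrt (\sum_(i | i != r)
    (\int[mu]_(x in I01) (U.1 i x ^+ 2)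
     + \int[mu]_(x in I01) (weak_deriv (U.1 i) x ^+ 2)
     + \int[mu]_(x in I01) (U.2 i x ^+ 2))).

Definition phase_space (b : root_condition) : set state :=
  if b is Dirichlet then spaceH0 else spaceH.

(* For i \in I_ r, the only edge at the root. *)
Definition root_holds (b : root_condition) (u v ux : V -> R -> R) : Prop :=
  forall i, i \in I_ r ->
    match b with
    | Dirichlet => u i 0 = 0 /\ v i 0 = 0
    | Neumann => ux i 0 = 0
    | Transparent => c_ i * ux i 0 = v i 0
    end.

(* Graph of (u_i, v_i) |-> (v_i, c_i^2 u_{i,xx}) on its domain: v and ux are the
   continuous representatives of v_i and u_{i,x}, uxx represents u_{i,xx}. *)
Definition wave_operator (b : root_condition) (U W : state) : Prop :=
  exists v ux uxx : V -> R -> R,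
    [/\ forall i, i != r ->
          [/\ H1_deriv (U.1 i) (ux i), H1_deriv (ux i) (uxx i),
              H1 (v i) & ae_eq mu I01 (U.2 i) (v i)],
        continuous_at_nodes U.1 /\ continuous_at_nodes v,
        (forall n, simple_node e n -> n != r -> c_ n * ux n 1 = - v n 1) /\
        (forall n, multiple_node e n ->
           \sum_(i in I_ n) c_ i * ux i 0 - c_ n * ux n 1 = - (alpha n * v n 1)),
        root_holds b U.1 v ux &
        forall i, i != r ->
          {in `[0 : R, 1 : R], W.1 i =1 v i} /\
          ae_eq mu I01 (W.2 i) (fun x => c_ i ^+ 2 * uxx i x)].

Definition network_semigroup (b : root_condition) (S : R -> state -> state) :=
  C0_semigroup (phase_space b) normH S /\
  generated_by (phase_space b) normH S (wave_operator b).

End Network.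

(* Main.v *)
Require Import Defs.
From mathcomp Require Import all_boot all_order all_algebra.
From mathcomp Require Import all_classical all_reals all_analysis.
From mathcomp Require Import measurable_realfun ring lra.

(** On an edge [i], oriented away from the root, a solution splits into the two
    Riemann invariants [v_i + c_i u_i'], which travels towards the root, and
    [v_i - c_i u_i'], which travels away from it. With [alpha_n = k_n - 2] the
    conditions at an internal node say that the invariant leaving the node on
    one edge is the sum of those arriving on all the other edges; in other
    words, nothing is reflected ([node_transmission]). The conditions at the
    external nodes other than the root, and the transparent condition at the
    root, are the same rule with an empty sum.

    Hence the waves that run towards a given external node [r'] die out edge
    after edge, starting from the other external nodes; on the edge [i] of the
    tree rooted at [r'] this takes the time [t_i] ([drain]). If the root is
    transparent, then [r'] may be any external node. As every orientation of
    every edge points to some external node ([leaf_beyond]), all waves are gone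
    after T(T). If the root carries the Dirichlet or Neumann condition, then the
    waves towards it are gone after T(R); it reflects nothing from that time on,
    and the waves away from the root are gone after another T(R)
    ([reflected_drain]). Once all invariants vanish, [u] is constant in space
    and time ([extinct_constant]).

    The travel along one edge rests on an energy estimate instead of
    d'Alembert's formula. If [p] satisfies [p_t = c p_x] on [0, 1] and vanishes at
    [x = 1] after the time [tau], then the integral of [exp (lambda x) p^2] decays
    at the rate [c lambda], so that the integral of [p^2] at time [t] is at most
    [exp (lambda (1 - c (t - tau)))] times its value at time [tau]. Letting
    [lambda] tend to infinity gives [p = 0] for [t > tau + 1 / c]
    ([extinction]). This needs a right derivative in time only, for the energy
    norm, which the semigroup provides on the domain of its generator
    ([right_derivative]).

    Arbitrary data are reached by density: [u_i'] and [v_i] are approximated in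
    L^2 by H^1 functions that vanish at the ends of the edges, without changing
    the mean of [u_i'] ([domain_dense]). The traces and integrations by parts
    involved come from the fact that an H^1 function is the primitive of its weak
    derivative ([H1_primitive]). *)

Set Implicit Arguments.
Unset Strict Implicit.
Unset Printing Implicit Defensive.

Import Order.TTheory GRing.Theory Num.Theory.
Import numFieldNormedType.Exports.

Local Open Scope classical_set_scope.
Local Open Scope ring_scope.

(** * One-sided monotonicity criteria *)

Section Monotonicity.
Context (R : realType).
Implicit Types (f : R -> R) (a b : R).

(** The points where [f] is at most [f a] have a greatest element, by the left
    semicontinuity of [f]; right of any such point other than [b] there is
    another one. *)
Lemma right_nonincreasing f a b : a <= b ->
  (forall x, a < x <= b -> forall eps, 0 < eps -> exists2 d, 0 < d &
     forall y, a <= y < x -> x - d < y -> f x <= f y + eps) ->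
  (forall x, a <= x < b -> exists2 d, 0 < d &
     forall h, 0 < h < d -> f (x + h) <= f x) ->
  f b <= f a.
Proof.
move=> ab lcont rdec.
pose S := [set t | a <= t <= b /\ f t <= f a].
have Sa : S a by split; rewrite ?lexx.
have ubS : ubound S b by move=> t [/andP[]].
have hS : has_sup S by split; [exists a|exists b].
have aS : a <= sup S by apply: sup_upper_bound.
have Sb : sup S <= b by apply: ge_sup => //; exists a.
have SS : f (sup S) <= f a.
  move: aS; rewrite le_eqVlt => /orP[/eqP <- //|aS].
  apply/ler_addgt0Pr => eps eps0.
  have [|d d0 Hd] := lcont (sup S) _ eps eps0; first by rewrite aS.
  have [t [tab ft] ht] := sup_adherent d0 hS.
  have tS : t <= sup S by apply: sup_upper_bound.
  move: tS; rewrite le_eqVlt => /orP[/eqP <-|tS]; first by lra.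
  have := Hd t; rewrite tS ht; move: tab => /andP[-> _] => /(_ isT isT); lra.
move: Sb; rewrite le_eqVlt => /orP[/eqP <- //|Sb].
have [|d d0 Hd] := rdec (sup S); first by rewrite aS.
pose h := Num.min (d / 2) (b - sup S).
have h0 : 0 < h by rewrite lt_min divr_gt0 ?subr_gt0.
have hd : h < d by rewrite gt_min ltr_pdivrMr // ltr_pMr // ltr1n.
have hb : h <= b - sup S by rewrite ge_min lexx orbT.
have : S (sup S + h).
  split; first by apply/andP; split; lra.
  by apply: le_trans SS; apply: Hd; rewrite h0.
by move=> /(sup_upper_bound hS); lra.
Qed.

(** Apply [right_nonincreasing] to [x |-> f x - e * x] and let [e] tend to 0.
    Only right derivatives enter, since a semigroup that is merely bounded at
    each time is easily differentiated to the right, but not to the left. *)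
Lemma right_derivative_nonincreasing f a b : a <= b ->
  (forall x, a < x <= b -> forall eps, 0 < eps -> exists2 d, 0 < d &
     forall y, a <= y < x -> x - d < y -> f x <= f y + eps) ->
  (forall x, a <= x < b -> forall eps, 0 < eps -> exists2 d, 0 < d &
     forall h, 0 < h < d -> f (x + h) <= f x + eps * h) ->
  f b <= f a.
Proof.
move=> ab lcont rdec; apply/ler_addgt0Pr => eps eps0.
pose e := eps / (b - a + 1).
have ba1 : 0 < b - a + 1 by lra.
have e0 : 0 < e by rewrite divr_gt0.
have : f b - e * b <= f a - e * a.
  apply: (@right_nonincreasing (fun x => f x - e * x)) => // x xab.
    move=> eta eta0; have [d d0 Hd] := lcont x xab _ (divr_gt0 eta0 (ltr0Sn _ 1)).
    exists d => // y yx xy; apply: le_trans (_ : f y + eta / 2 - e * x <= _).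
      by rewrite lerD2r Hd.
    have : e * y <= e * x by rewrite ler_wpM2l // ltW //; case/andP: yx.
    lra.
  have [d d0 Hd] := rdec x xab e e0; exists d => // h hd.
  by have := Hd h hd; rewrite mulrDr; lra.
have -> : eps = e * (b - a + 1) by rewrite /e divfK // gt_eqF.
nra.
Qed.

End Monotonicity.

(** * Square integrable functions on the unit interval *)

Section SquareIntegrable.
Context (R : realType).
Implicit Types (f g w : R -> R) (k : R).

Local Notation mu := (@lebesgue_measure R).
Local Notation I01 := (`[0 : R, 1 : R]%classic : set R).
Local Notation integr f := (mu.-integrable I01 (EFin \o f)).
Local Notation int01 f := (Rintegral mu I01 f).

Lemma mI01 : measurable (I01 : set (measurableTypeR R)).
Proof. exact: measurable_itv. Qed.

Lemma muI01 : mu I01 = 1%E.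
Proof. by rewrite lebesgue_measure_itv /= lte_fin ltr01 oppr0 adde0. Qed.

Lemma integr_meas f : integr f -> measurable_fun I01 f.
Proof. by move/integrableP => [/measurable_EFinP]. Qed.

Lemma integr_eq f g : {in `[0, 1], f =1 g} -> integr f -> integr g.
Proof.
move=> fg; apply: eq_integrable; first exact: mI01.
by move=> x /set_mem xI /=; rewrite fg.
Qed.

Lemma integrD f g : integr f -> integr g -> integr (fun x => f x + g x).
Proof. by move=> hf hg; have := integrableD mI01 hf hg. Qed.

Lemma integrB f g : integr f -> integr g -> integr (fun x => f x - g x).
Proof. by move=> hf hg; have := integrableB mI01 hf hg. Qed.

Lemma integrZ k f : integr f -> integr (fun x => k * f x).
Proof. by move=> hf; have := integrableZl mI01 k hf. Qed.

Lemma integr_norm f : integr f -> integr (fun x => `|f x|).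
Proof. by move=> hf; have := integrable_norm hf. Qed.

Lemma integr_le f g : measurable_fun I01 f -> integr g ->
  (forall x, 0 <= x <= 1 -> `|f x| <= g x) -> integr f.
Proof.
move=> mf ig fg; apply: (le_integrable mI01 _ _ ig).
  exact/measurable_EFinP.
move=> x; rewrite /= in_itv /= => /fg h; rewrite lee_fin.
by rewrite (le_trans h) // ler_norm.
Qed.

Lemma integr_cont f : {within I01, continuous f} -> integr f.
Proof. move=> cf; apply: continuous_compact_integrable => //; exact: segment_compact. Qed.

Lemma integr_cst k : integr (fun=> k).
Proof. by apply: integr_cont; apply: continuous_subspaceT => x; exact: cvg_cst. Qed.

Lemma int01D f g : integr f -> integr g ->
  int01 (fun x => f x + g x) = int01 f + int01 g.
Proof. exact: (RintegralD mI01). Qed.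

Lemma int01B f g : integr f -> integr g ->
  int01 (fun x => f x - g x) = int01 f - int01 g.
Proof. exact: (RintegralB mI01). Qed.

Lemma int01Z k f : integr f -> int01 (fun x => k * f x) = k * int01 f.
Proof. by move=> hf; exact: (RintegralZl k mI01 hf). Qed.

Lemma int01_cst k : int01 (fun=> k) = k.
Proof.
rewrite (Rintegral_cst mu mI01) -[RHS]mulr1; congr (_ * _).
by rewrite -[RHS]/(fine 1%E); congr fine; exact: muI01.
Qed.

Lemma eq_int01 f g : {in `[0, 1], f =1 g} -> int01 f = int01 g.
Proof. by move=> fg; apply: eq_Rintegral => x /set_mem xI; rewrite fg. Qed.

Lemma le_int01 f g : integr f -> integr g ->
  (forall x, 0 <= x <= 1 -> f x <= g x) -> int01 f <= int01 g.
Proof.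
move=> hf hg fg; exact: (le_Rintegral mI01).
Qed.

Lemma int01_ge0 f : (forall x, 0 <= x <= 1 -> 0 <= f x) -> 0 <= int01 f.
Proof.
by move=> f0; apply: Rintegral_ge0 => x; rewrite /= in_itv /=; exact: f0.
Qed.

Lemma ae_int01 f g : integr f -> measurable_fun I01 g -> ae_eq mu I01 f g ->
  int01 f = int01 g.
Proof.
move=> hf mg fg; congr fine; apply: (@ae_eq_integral _ _ _ mu _ _ _ mI01).
- by apply/measurable_EFinP; exact: integr_meas.
- exact/measurable_EFinP.
- exact: (ae_eq_comp EFin fg).
Qed.

Lemma int01_eq0 f : integr f -> (forall x, 0 <= x <= 1 -> 0 <= f x) ->
  int01 f = 0 -> ae_eq mu I01 f (cst 0).
Proof.
move=> hf f0 i0.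
have h : (\int[mu]_(x in I01) `|(f x)%:E| = 0)%E.
  transitivity ((int01 f)%:E); last by rewrite i0.
  rewrite /Rintegral fineK.
    apply: eq_integral => x /set_mem; rewrite /= in_itv /= => /f0 fx.
    by rewrite ger0_norm.
  exact: (integrable_fin_num mI01).
have mf : measurable_fun I01 (EFin \o f) by apply/measurable_EFinP; exact: integr_meas.
have /(ae_eq_integral_abs mu mI01 mf).1 := h.
by apply: filterS => x h1 /h1 [].
Qed.

Lemma within01P f : {within I01, continuous f} <->
  forall x, 0 <= x <= 1 -> forall eps, 0 < eps -> exists2 d, 0 < d &
    forall y, 0 <= y <= 1 -> `|y - x| < d -> `|f y - f x| < eps.
Proof.
rewrite subspace_continuousP; split=> [cf x x01 eps eps0|cf x].
  have /cf /cvgrPdist_lt /(_ _ eps0) : I01 x by rewrite /= in_itv.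
  rewrite near_withinE => /nbhs_ballP[d /= d0 Hd]; exists d => // y y01 yx.
  by rewrite distrC; apply: Hd; rewrite /ball /= ?in_itv //= distrC.
rewrite /= in_itv /= => x01; apply/cvgrPdist_lt => eps eps0.
have [d d0 Hd] := cf x x01 eps eps0; rewrite near_withinE.
apply/nbhs_ballP; exists d => //= y; rewrite /ball /= in_itv /= => yx y01.
by rewrite distrC; apply: Hd => //; rewrite distrC.
Qed.

(** By continuity a nonzero value would persist on an interval of positive
    length. *)
Lemma cont_ae0 f : {within I01, continuous f} -> ae_eq mu I01 f (cst 0) ->
  forall x, 0 <= x <= 1 -> f x = 0.
Proof.
move=> /within01P cf [N [mN N0 sub]] x x01; apply/eqP/negPn/negP => fx0.
have [|d d0 Hd] := cf x x01 `|f x|; first by rewrite normr_gt0.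
pose a := Num.max 0 (x - d / 2); pose b := Num.min 1 (x + d / 2).
have d2 : 0 < d / 2 by rewrite divr_gt0.
have ab : a < b by rewrite /a /b lt_min !gt_max; lra.
have sN : `[a, b]%classic `<=` N.
  move=> y; rewrite /= in_itv /= /a /b ge_max le_min => /andP[/andP[y0 xy]].
  move=> /andP[y1 yx]; apply: sub => /= h.
  have y01 : 0 <= y <= 1 by rewrite y0 y1.
  have fy : f y = 0 by apply: h; rewrite in_itv /=.
  have : `|y - x| < d by rewrite ltr_norml; lra.
  by move=> /(Hd y y01); rewrite fy sub0r normrN ltxx.
have : (mu `[a, b] <= mu N)%E by apply: le_measure; rewrite ?inE.
by rewrite N0 lebesgue_measure_itv /= lte_fin ab -EFinB lee_fin subr_le0 leNgt ab.
Qed.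

Lemma cont_int01_eq0 f : {within I01, continuous f} ->
  (forall x, 0 <= x <= 1 -> 0 <= f x) -> int01 f = 0 ->
  forall x, 0 <= x <= 1 -> f x = 0.
Proof.
move=> cf f0 i0; apply: cont_ae0 => //.
by apply: int01_eq0 => //; exact: integr_cont.
Qed.

Lemma L2_meas f : L2 f -> measurable_fun I01 f. Proof. by case. Qed.

Lemma L2_sqr f : L2 f -> integr (fun x => f x ^+ 2). Proof. by case. Qed.

Lemma L2_mul f g : L2 f -> L2 g -> integr (fun x => f x * g x).
Proof.
move=> [mf f2] [mg g2]; apply: integr_le (integrD f2 g2) _.
  exact: measurable_funM.
move=> x _ /=; rewrite ler_norml; apply/andP; split; nra.
Qed.

Lemma L2_bounded f M : measurable_fun I01 f ->
  (forall x, 0 <= x <= 1 -> `|f x| <= M) -> L2 f.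
Proof.
move=> mf fM; split => //; apply: integr_le (integr_cst (M ^+ 2)) _.
  exact: measurable_funX.
move=> x /fM fx; rewrite normrX.
by rewrite ler_sqr ?nnegrE // (le_trans _ fx).
Qed.

Lemma L2_cont f : {within I01, continuous f} -> L2 f.
Proof.
move=> cf; split; first by apply: integr_meas; exact: integr_cont.
by apply: integr_cont => x; apply: cvgM; exact: cf.
Qed.

Lemma L2_cst k : L2 (fun=> k : R).
Proof. by apply: L2_cont; apply: continuous_subspaceT => x; exact: cvg_cst. Qed.

Lemma L2_integr f : L2 f -> integr f.
Proof.
move=> /L2_mul /(_ (L2_cst 1)); apply: integr_eq => x _; exact: mulr1.
Qed.

Lemma L2D f g : L2 f -> L2 g -> L2 (fun x => f x + g x).
Proof.
move=> hf hg; split.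
  by apply: measurable_funD; exact: L2_meas.
apply: integr_eq (integrD (integrD (L2_sqr hf) (L2_sqr hg))
  (integrZ 2 (L2_mul hf hg))) => x _; ring.
Qed.

Lemma L2Z k f : L2 f -> L2 (fun x => k * f x).
Proof.
move=> hf; split; first by apply: measurable_funM => //; exact: L2_meas.
apply: integr_eq (integrZ (k ^+ 2) (L2_sqr hf)) => x _; ring.
Qed.

Lemma L2_eq f g : {in `[0, 1], f =1 g} -> L2 f -> L2 g.
Proof.
move=> fg [mf f2]; split.
  by apply: eq_measurable_fun mf => x /set_mem xI; rewrite fg.
by apply: integr_eq f2 => x xI; rewrite fg.
Qed.

Lemma L2B f g : L2 f -> L2 g -> L2 (fun x => f x - g x).
Proof.
move=> hf hg; apply: L2_eq (L2D hf (L2Z (-1) hg)) => x _ /=.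
by rewrite mulN1r.
Qed.

Lemma L2_mulbounded f w M : L2 f -> measurable_fun I01 w ->
  (forall x, 0 <= x <= 1 -> `|w x| <= M) -> L2 (fun x => f x * w x).
Proof.
move=> [mf f2] mw wM; have mfw := measurable_funM mf mw; split => //.
apply: integr_le (integrZ (M ^+ 2) f2) _; first exact: measurable_funX.
move=> x /wM wx; rewrite normrX normrM exprMn mulrC [`|f x| ^+ 2]real_normK ?num_real //.
by rewrite ler_wpM2r ?sqr_ge0 // ler_sqr ?nnegrE // (le_trans _ wx).
Qed.

(** The variance of [f] is nonnegative. *)
Lemma sqr_int01_le f : L2 f -> int01 f ^+ 2 <= int01 (fun x => f x ^+ 2).
Proof.
move=> hf; set m := int01 f.
have : 0 <= int01 (fun x => (f x - m) ^+ 2) by apply: int01_ge0 => x _; exact: sqr_ge0.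
have -> : int01 (fun x => (f x - m) ^+ 2) =
    int01 (fun x => f x ^+ 2 + (m ^+ 2 + (- (2 * m)) * f x)).
  by apply: eq_int01 => x _; ring.
have i1 := L2_sqr hf; have i2 := integr_cst (m ^+ 2).
have i3 := integrZ (- (2 * m)) (L2_integr hf).
rewrite (int01D i1 (integrD i2 i3)) (int01D i2 i3) int01_cst.
by rewrite (int01Z _ (L2_integr hf)) -/m; nra.
Qed.

End SquareIntegrable.

(** * Primitives of integrable functions *)

Section Primitive.
Context (R : realType).
Implicit Types (f g w F G : R -> R) (k x y : R).

Local Notation mu := (@lebesgue_measure R).
Local Notation I01 := (`[0 : R, 1 : R]%classic : set R).
Local Notation integr f := (mu.-integrable I01 (EFin \o f)).
Local Notation int01 f := (Rintegral mu I01 f).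

Definition int0 f x : R := \int[mu]_(t in `[0, x]) f t.

Lemma int0_1 f : int0 f 1 = int01 f. Proof. by []. Qed.

Lemma int0_0 f : int0 f 0 = 0.
Proof. by rewrite /int0 set_itv1 Rintegral_set1. Qed.

Lemma sub_integr f x y : 0 <= x -> y <= 1 -> integr f ->
  mu.-integrable `]x, y] (EFin \o f).
Proof.
move=> x0 y1; apply: integrableS => //.
by move=> t; rewrite /= !in_itv /=; lra.
Qed.

Lemma int0_sub f x y : integr f -> 0 <= x -> x <= y -> y <= 1 ->
  int0 f y - int0 f x = \int[mu]_(t in `]x, y]) f t.
Proof.
move=> hf x0 xy y1; apply: Rintegral_itvB; rewrite ?bnd_simp //.
apply: integrableS hf => //.
by move=> t; rewrite /= !in_itv /=; lra.
Qed.

Lemma le_int0_sub f g x y : integr f -> integr g ->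
  0 <= x -> x <= y -> y <= 1 -> (forall t, x <= t <= y -> f t <= g t) ->
  int0 f y - int0 f x <= int0 g y - int0 g x.
Proof.
move=> hf hg x0 xy y1 fg; rewrite !int0_sub //.
apply: le_Rintegral.
- exact: measurable_itv.
- exact: sub_integr.
- exact: sub_integr.
- by move=> t; rewrite /= in_itv /= => txy; apply: fg; lra.
Qed.

Lemma int0D f g x : integr f -> integr g -> 0 <= x <= 1 ->
  int0 (fun t => f t + g t) x = int0 f x + int0 g x.
Proof.
move=> hf hg /andP[x0 x1]; apply: RintegralD => //.
- by apply: integrableS hf => // t; rewrite /= !in_itv /=; lra.
- by apply: integrableS hg => // t; rewrite /= !in_itv /=; lra.
Qed.

Lemma int0Z f k x : integr f -> 0 <= x <= 1 ->
  int0 (fun t => k * f t) x = k * int0 f x.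
Proof.
move=> hf /andP[x0 x1]; apply: RintegralZl => //.
by apply: integrableS hf => // t; rewrite /= !in_itv /=; lra.
Qed.

Lemma int0_ge0 f x : (forall t, 0 <= f t) -> 0 <= int0 f x.
Proof. by move=> f0; apply: Rintegral_ge0. Qed.

Lemma int0_cont f : integr f -> {within I01, continuous (int0 f)}.
Proof. by move=> hf; apply: parameterized_integral_continuous. Qed.

Lemma eq_int0 f g x : 0 <= x <= 1 -> {in `[0, 1], f =1 g} ->
  int0 f x = int0 g x.
Proof.
move=> x01 fg; apply: eq_Rintegral => t /set_mem.
by rewrite /= in_itv /= => tx; rewrite fg // in_itv /=; lra.
Qed.

(** The absolutely continuous functions on [0, 1], in integral form. *)
Definition primitive F f : Prop :=
  integr f /\ forall x, 0 <= x <= 1 -> F x = F 0 + int0 f x.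

Lemma primitive_cont F f : primitive F f -> {within I01, continuous F}.
Proof.
move=> [hf Ff]; apply/within01P => x x01 eps eps0.
have /within01P /(_ x x01 eps eps0)[d d0 Hd] := int0_cont hf.
exists d => // y y01 /(Hd y y01).
by rewrite (Ff x) // (Ff y) // opprD addrACA subrr add0r.
Qed.

Lemma primitive_int0 f : integr f -> primitive (int0 f) f.
Proof. by move=> hf; split => // x _; rewrite int0_0 add0r. Qed.

Lemma primitive_cst k : primitive (cst k) (cst 0).
Proof.
split=> [|x x01]; first exact: integr_cst.
by rewrite /int0 /Rintegral integral0 addr0.
Qed.

Lemma primitiveD F G f g : primitive F f -> primitive G g ->
  primitive (fun x => F x + G x) (fun x => f x + g x).
Proof.
move=> [hf Ff] [hg Gg]; split=> [|x x01]; first exact: integrD.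
by rewrite int0D // Ff // Gg // addrACA.
Qed.

Lemma primitiveZ F f k : primitive F f ->
  primitive (fun x => k * F x) (fun x => k * f x).
Proof.
move=> [hf Ff]; split=> [|x x01]; first exact: integrZ.
by rewrite int0Z // Ff // mulrDr.
Qed.

Lemma cont_bounded f : {within I01, continuous f} ->
  exists M, forall x, 0 <= x <= 1 -> `|f x| <= M.
Proof.
move=> cf; have := continuous_compact cf (@segment_compact _ 0 1).
move=> /compact_bounded[M [_ MP]]; exists (M + 1) => x x01.
by apply: (MP (M + 1)); [rewrite ltrDl | exists x; rewrite //= in_itv].
Qed.

Lemma integr_mulcont f w : {within I01, continuous w} -> integr f ->
  integr (fun x => w x * f x).
Proof.
move=> cw hf; have [M wM] := cont_bounded cw.
apply: integr_le (integrZ M (integr_norm hf)) _.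
  by apply: measurable_funM; apply: integr_meas => //; exact: integr_cont.
by move=> x x01; rewrite normrM ler_wpM2r // wM.
Qed.

(** The two sides are compared on short intervals [[x, y]], where [F] and [G]
    vary by at most [eps]: there their increments differ by at most [eps] times
    the integral of [|f| + |g|]. The monotonicity criterion adds these local
    bounds up, and [eps] is arbitrary. *)
Lemma primitive_mul_le F G f g b : primitive F f -> primitive G g ->
  0 <= b <= 1 ->
  F b * G b - F 0 * G 0 <= int0 (fun x => F x * g x + G x * f x) b.
Proof.
move=> pF pG /andP[b0 b1].
have [cF cG] := (primitive_cont pF, primitive_cont pG).
have [[hf Ff] [hg Gg]] := (pF, pG).
have hFg := integr_mulcont cF hg; have hGf := integr_mulcont cG hf.
set h := (fun x => _).
have hh : integr h by exact: integrD.
pose m t := `|g t| + `|f t|.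
have hm : integr m by apply: integrD; exact: integr_norm.
have m0 : 0 <= int0 m b by apply: int0_ge0 => t; rewrite addr_ge0.
rewrite lerBlDr addrC -lerBlDr; apply/ler_addgt0Pr => e e0.
pose eps := e / (int0 m b + 1).
have eps0 : 0 < eps by rewrite divr_gt0 // ltr_wpDl.
pose K x := F x * G x - int0 h x - eps * int0 m x.
have cK : {within I01, continuous K}.
  move=> x; apply: cvgB; last first.
    by apply: cvgM; [exact: cvg_cst | exact: int0_cont].
  by apply: cvgB; [apply: cvgM; [exact: cF|exact: cG] | exact: int0_cont].
have : K b <= K 0.
  apply: right_nonincreasing => // x /andP[x0 xb].
    move=> eta eta0; have x01 : 0 <= x <= 1 by apply/andP; split; lra.
    have [d d0 Hd] := (within01P K).1 cK x x01 eta eta0.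
    exists d => // y /andP[y0 yx] xy.
    have y01 : 0 <= y <= 1 by apply/andP; split; lra.
    have : `|y - x| < d by rewrite ltr_norml; lra.
    by move=> /(Hd y y01); rewrite ltr_norml; lra.
  have x01 : 0 <= x <= 1 by apply/andP; split; lra.
  have eps2 : 0 < eps / 2 by rewrite divr_gt0.
  have [d1 d10 H1] := (within01P F).1 cF x x01 _ eps2.
  have [d2 d20 H2] := (within01P G).1 cG x x01 _ eps2.
  exists (Num.min (b - x) (Num.min d1 d2)); first by rewrite !lt_min d10 d20; lra.
  move=> t; rewrite !lt_min => /and4P[t0 tb t1 t2]; set y := x + t.
  have y01 : 0 <= y <= 1 by apply/andP; rewrite /y; split; lra.
  have xy : x <= y by rewrite /y; lra.
  (* The increment of [F * G] over [[x, y]] is the integral of [l]. *)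
  pose l s := F y * g s + G x * f s.
  have hl : integr l by apply: integrD; exact: integrZ.
  have lE z : 0 <= z <= 1 -> int0 l z = F y * (G z - G 0) + G x * (F z - F 0).
    move=> z01; rewrite int0D ?int0Z //; try exact: integrZ.
    by rewrite (Ff z) // (Gg z) //; ring.
  have : int0 l y - int0 l x <=
         int0 (fun s => h s + eps * m s) y - int0 (fun s => h s + eps * m s) x.
    apply: le_int0_sub => //.
    - by apply: integrD => //; exact: integrZ.
    - by case/andP: y01.
    move=> s /andP[xs sy].
    have s01 : 0 <= s <= 1 by apply/andP; split; case/andP: y01; lra.
    have : `|F y - F s| <= eps.
      have : `|y - x| < d1 by rewrite /y ltr_norml; lra.
      have : `|s - x| < d1 by move: sy; rewrite /y ltr_norml; lra.
      move=> /(H1 s s01) + /(H1 y y01).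
      by rewrite !ltr_norml ler_norml; lra.
    have : `|G x - G s| <= eps.
      have : `|s - x| < d2 by move: sy; rewrite /y ltr_norml; lra.
      move=> /(H2 s s01).
      by rewrite !ltr_norml ler_norml; lra.
    rewrite /l /h /m => Ge Fe.
    have : (F y - F s) * g s <= eps * `|g s|.
      by rewrite (le_trans (ler_norm _)) // normrM ler_wpM2r.
    have : (G x - G s) * f s <= eps * `|f s|.
      by rewrite (le_trans (ler_norm _)) // normrM ler_wpM2r.
    lra.
  have hE z : 0 <= z <= 1 ->
      int0 (fun s => h s + eps * m s) z = int0 h z + eps * int0 m z.
    by move=> z01; rewrite (int0D hh (integrZ eps hm)) // (int0Z _ hm).
  rewrite !lE // !hE // (Ff x) // (Ff y) // (Gg x) // (Gg y) // /K.
  by rewrite -(Ff x) // -(Gg x) // -/y (Ff y) // (Gg y) //; lra.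
rewrite /K !int0_0 mulr0 !subr0 => Kb.
have : eps * int0 m b <= e.
  rewrite /eps mulrAC ler_pdivrMr ?ltr_wpDl // ler_wpM2l ?lerDl //; lra.
lra.
Qed.

Lemma primitive_eq F G f g : primitive F f -> {in `[0, 1], F =1 G} ->
  {in `[0, 1], f =1 g} -> primitive G g.
Proof.
move=> [hf Ff] FG fg; split=> [|x x01]; first exact: integr_eq hf.
by rewrite -!FG ?in_itv /= ?lexx ?ler01 // -(eq_int0 x01 fg) Ff.
Qed.

(** Integration by parts: the bound of [primitive_mul_le] for [F] and [- F]. *)
Lemma primitiveM F G f g : primitive F f -> primitive G g ->
  primitive (fun x => F x * G x) (fun x => F x * g x + G x * f x).
Proof.
move=> pF pG; have [cF cG] := (primitive_cont pF, primitive_cont pG).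
have ih : integr (fun x => F x * g x + G x * f x).
  by apply: integrD; apply: integr_mulcont => //; [case: pG|case: pF].
split=> // x x01; apply/eqP; rewrite -subr_eq addrC -subr_eq0 eq_le.
have := primitive_mul_le pF pG x01.
have := primitive_mul_le (primitiveZ (-1) pF) pG x01.
rewrite (@eq_int0 _ (fun x => (-1) * (F x * g x + G x * f x)) x x01).
  rewrite int0Z //; lra.
by move=> t _; ring.
Qed.

Lemma primitive_C1 F f : (forall x, 0 <= x <= 1 -> is_derive x 1 F (f x)) ->
  {within I01, continuous f} -> primitive F f.
Proof.
move=> dF cf; have hf : integr f by exact: integr_cont.
split=> // x /andP[]; rewrite le_eqVlt => /orP[/eqP <- _|x0 x1].
  by rewrite int0_0 addr0.
have cF y : 0 <= y <= 1 -> {for y, continuous F}.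
  by move=> /dF dFy; apply/differentiable_continuous/derivable1_diffP/ex_derive.
rewrite /int0 /Rintegral (@continuous_FTC2 _ f F 0 x x0).
- by rewrite -EFinB /= addrC subrK.
- apply: continuous_subspaceW cf => y; rewrite /= !in_itv /= => /andP[-> /le_trans].
  exact.
- split.
  + move=> y; rewrite in_itv /= => y0x; have /dF dFy : 0 <= y <= 1 by lra.
    exact: ex_derive.
  + by apply: cvg_at_right_filter; apply: cF; rewrite lexx ler01.
  + by apply: cvg_at_left_filter; apply: cF; rewrite x1 ltW.
- move=> y; rewrite in_itv /= => y0x; have /dF dFy : 0 <= y <= 1 by lra.
  by rewrite derive1E; apply: derive_val.
Qed.

End Primitive.

(** * Weak derivatives *)

Section WeakDerivative.
Context (R : realType).
Implicit Types (f g w u phi : R -> R) (k x y : R).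

Local Notation mu := (@lebesgue_measure R).
Local Notation I01 := (`[0 : R, 1 : R]%classic : set R).
Local Notation integr f := (mu.-integrable I01 (EFin \o f)).
Local Notation int01 f := (Rintegral mu I01 f).

Lemma test_function_primitive phi : test_function phi ->
  [/\ primitive phi (derive1 phi), phi 0 = 0 & phi 1 = 0].
Proof.
move=> [dphi cphi [a [b [a0 b1 supp]]]]; split.
- apply: primitive_C1 => [x _|]; last exact: continuous_subspaceT.
  by split; [exact: dphi | rewrite derive1E].
- by apply: supp; rewrite in_itv /= negb_and -ltNge a0.
- by apply: supp; rewrite in_itv /= negb_and -!ltNge b1 orbT.
Qed.

(** Integration by parts against a test function, which vanishes at both ends. *)
Lemma primitive_H1 u g : L2 g -> primitive u g -> H1_deriv u g.
Proof.
move=> g2 pu; split=> //; first exact: primitive_cont pu.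
move=> phi /test_function_primitive[pphi phi0 phi1].
have cu := primitive_cont pu; have cphi := primitive_cont pphi.
have [_ /(_ 1)] := primitiveM pu pphi.
rewrite lexx ler01 phi0 phi1 !mulr0 add0r int0_1 => /(_ isT) /esym.
have i1 : integr (fun x => u x * derive1 phi x).
  by apply: integr_mulcont => //; case: pphi.
have i2 : integr (fun x => phi x * g x).
  by apply: integr_mulcont => //; exact: L2_integr.
rewrite (int01D i1 i2) => /eqP; rewrite addr_eq0 => /eqP ->; congr (- _).
by apply: eq_int01 => x _; rewrite mulrC.
Qed.

(** A continuous function with zero mean and compact support in ]0, 1[ is the
    derivative of a test function. *)
Section TestPrimitive.
Context (psi : R -> R) (a b : R).
Hypotheses (a0 : 0 < a) (b1 : b < 1) (cpsi : continuous psi).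
Hypothesis (supp : forall x, x \notin `[a, b] -> psi x = 0).
Hypothesis (psi0 : int01 psi = 0).

Let int0_left x : x < a -> int0 psi x = 0.
Proof.
move=> xa; rewrite /int0 /Rintegral integral0_eq // => y.
by rewrite /= in_itv /= => yx; rewrite supp // in_itv /= negb_and -ltNge; lra.
Qed.

Let int0_right x : b < x -> int0 psi x = 0.
Proof.
move=> bx; rewrite -psi0 /int0 Rintegral_mkcond [RHS]Rintegral_mkcond.
congr Rintegral; apply/funext => y; rewrite !patchE.
have [|/supp ->] := boolP (y \in `[a, b]); last by rewrite !if_same.
by rewrite in_itv /= => yab; rewrite !mem_set //= in_itv /=; move: yab bx a0 b1; lra.
Qed.

Let derive_int0 x : is_derive x 1 (int0 psi) (psi x).
Proof.
have [xa|ax] := ltP x a.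
  rewrite supp; last by rewrite in_itv /= negb_and -ltNge xa.
  apply: (@near_eq_is_derive _ _ _ (cst 0)) => //.
  have := @open_nbhs_nbhs _ x [set y | y < a].
  move=> /(_ (conj (@open_lt _ a) xa)); apply: filterS => y /=.
  by move=> ya; rewrite int0_left.
have x0 : 0 < x by exact: lt_le_trans ax.
have hi : mu.-integrable `[0, x + 1] (EFin \o psi).
  apply: continuous_compact_integrable; first exact: segment_compact.
  exact: continuous_subspaceT.
have x1 : x < x + 1 by rewrite ltrDl.
have [dx Dx] := continuous_FTC1_closed x1 hi x0 (@cpsi x).
split; first exact: dx.
by rewrite -derive1E Dx.
Qed.

Lemma int0_test_function : test_function (int0 psi).
Proof.
have dE : derive1 (int0 psi) = psi.
  by apply/funext => x; rewrite derive1E; apply: derive_val.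
split; first by move=> x; apply: ex_derive.
  by rewrite dE.
exists a, b; split=> // x; rewrite in_itv /= negb_and -!ltNge => /orP[].
  exact: int0_left.
exact: int0_right.
Qed.

Lemma derive_int0_test : derive1 (int0 psi) = psi.
Proof. by apply/funext => x; rewrite derive1E; apply: derive_val. Qed.

End TestPrimitive.

Let clamp x := Num.max 0 (Num.min 1 x).

Let clamp01 x : 0 <= clamp x <= 1.
Proof. by rewrite /clamp le_max lexx ge_max ge_min lexx ler01. Qed.

Let clamp_id x : 0 <= x <= 1 -> clamp x = x.
Proof. by move=> /andP[x0 x1]; rewrite /clamp min_r // max_r. Qed.

Let clamp_cont w : {within I01, continuous w} -> continuous (w \o clamp).
Proof.
move=> /within01P cw x; apply/cvgrPdist_lt => eps eps0.
have [d d0 Hd] := cw _ (clamp01 x) _ eps0.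
apply/nbhs_ballP; exists d => //= y; rewrite /ball /= => xy.
rewrite distrC; apply: Hd => //; apply: le_lt_trans xy.
rewrite distrC /clamp /Num.min /Num.max; do !case: ifPn; rewrite -?leNgt;
  rewrite ler_norml; case: (ler0P (x - y)); lra.
Qed.

(** Let [k] be a bump on [[a, b]] and [m] the mean of [w] for the weight [k].
    Then [(w - m) * k] has zero mean, hence is the derivative of a test
    function; testing [w] against it shows that the integral of
    [(w - m) ^+ 2 * k] is 0, so that [w] is equal to [m] between [a] and [b]. *)
Lemma zero_weak_deriv_cst w : {within I01, continuous w} ->
  (forall phi, test_function phi -> int01 (fun x => w x * derive1 phi x) = 0) ->
  forall x, 0 <= x <= 1 -> w x = w (2^-1).
Proof.
move=> cw hw.
suff key a b : 0 < a -> a < b -> b < 1 -> exists m, forall x, a < x < b -> w x = m.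
  have key2 x : 0 < x < 1 -> w x = w 2^-1.
    move=> /andP[x0 x1].
    have [|||m Hm] := key (Num.min x 2^-1 / 2) ((Num.max x 2^-1 + 1) / 2).
    - by rewrite /Num.min; case: ifPn; lra.
    - by rewrite /Num.min /Num.max; case: ifPn; lra.
    - by rewrite /Num.max; case: ifPn; lra.
    by rewrite !Hm // /Num.min /Num.max; case: ifPn; rewrite -?leNgt; lra.
  move=> x x01; apply/eqP/negPn/negP => wx; rewrite -subr_eq0 -normr_gt0 in wx.
  have [d d0 Hd] := (within01P w).1 cw x x01 _ wx.
  pose t := Num.min 1 d; have t0 : 0 < t by rewrite lt_min ltr01.
  have t1 : t <= 1 by rewrite ge_min lexx.
  have td : t <= d by rewrite ge_min lexx orbT.
  pose y := x + t * (2^-1 - x).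
  have y01 : 0 < y < 1 by rewrite /y; apply/andP; split; nra.
  have : `|y - x| < d by rewrite /y ltr_norml; apply/andP; split; nra.
  have yI : 0 <= y <= 1 by case/andP: y01 => *; apply/andP; split; exact: ltW.
  by move=> /(Hd y yI); rewrite (key2 y y01) distrC ltxx.
move=> a0 ab b1.
pose k x := Num.max 0 ((x - a) * (b - x)).
have ck : continuous k.
  move=> x; apply: (@continuous_max _ _ (cst 0) (fun x => (x - a) * (b - x))).
    exact: cvg_cst.
  by apply: cvgM; apply: cvgB => //; exact: cvg_cst.
have k0 x : 0 <= k x by rewrite le_max lexx.
have kpos x : a < x < b -> 0 < k x by move=> xab; rewrite lt_max; nra.
have ksupp x : x \notin `[a, b] -> k x = 0.
  by rewrite in_itv /= negb_and -!ltNge => xab; rewrite /k max_l //; nra.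
have ckI : {within I01, continuous k} by exact: continuous_subspaceT.
have ik := integr_cont ckI.
have ik0 : int01 k != 0.
  apply/eqP => kz; have h : a < (a + b) / 2 < b by lra.
  have h01 : 0 <= (a + b) / 2 <= 1 by lra.
  have := kpos _ h.
  by rewrite (cont_int01_eq0 ckI (fun x _ => k0 x) kz h01) ltxx.
pose m := int01 (fun x => w x * k x) / int01 k.
pose psi x := (w (clamp x) - m) * k x.
have iwk : integr (fun x => w x * k x) by exact: integr_mulcont.
have cpsi : continuous psi.
  move=> x; apply: cvgM; last exact: ck.
  by apply: cvgB; [exact: clamp_cont | exact: cvg_cst].
have psiE : {in `[0, 1], psi =1 fun x => w x * k x - m * k x}.
  by move=> x; rewrite in_itv /= => x01; rewrite /psi clamp_id // mulrBl.
have psi0 : int01 psi = 0.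
  rewrite (eq_int01 psiE) (int01B iwk (integrZ m ik)) (int01Z _ ik).
  by rewrite /m divfK // subrr.
have psisupp x : x \notin `[a, b] -> psi x = 0.
  by move=> /ksupp; rewrite /psi => ->; rewrite mulr0.
have tf := int0_test_function a0 b1 cpsi psisupp psi0.
have := hw _ tf; rewrite (derive_int0_test a0 cpsi psisupp) => wpsi.
have ipsi : integr psi by apply: integr_cont; exact: continuous_subspaceT.
have iwpsi : integr (fun x => w x * psi x) by exact: integr_mulcont.
pose s x := w x * psi x - m * psi x.
have s0 : int01 s = 0.
  by rewrite (int01B iwpsi (integrZ m ipsi)) wpsi (int01Z _ ipsi) psi0 mulr0 subrr.
have sE x : 0 <= x <= 1 -> s x = (w x - m) ^+ 2 * k x.
  by move=> x01; rewrite /s /psi clamp_id //; ring.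
have cs : {within I01, continuous s}.
  have cpsiI : {within I01, continuous psi} by exact: continuous_subspaceT.
  move=> x; apply: cvgB; apply: cvgM; [exact: cw|exact: cpsiI| |exact: cpsiI].
  exact: cvg_cst.
have sge0 x : 0 <= x <= 1 -> 0 <= s x.
  by move=> x01; rewrite sE // mulr_ge0 ?sqr_ge0.
exists m => x xab; have x01 : 0 <= x <= 1 by lra.
have := cont_int01_eq0 cs sge0 s0 x01; rewrite sE // => /eqP.
by rewrite mulf_eq0 (gt_eqF (kpos x xab)) orbF sqrf_eq0 subr_eq0 => /eqP.
Qed.

(** [u] minus the primitive of [g] has zero weak derivative. *)
Lemma H1_primitive u g : H1_deriv u g -> primitive u g.
Proof.
move=> [cu g2 hu]; have ig := L2_integr g2.
have pg := primitive_int0 ig.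
have [_ _ hg] := primitive_H1 g2 pg.
have cg := primitive_cont pg.
split=> // x x01.
have cw : {within I01, continuous (fun x => u x - int0 g x)}.
  by move=> y; apply: cvgB; [exact: cu|exact: cg].
have W := zero_weak_deriv_cst cw.
have {}W : forall x, 0 <= x <= 1 -> u x - int0 g x = u 2^-1 - int0 g 2^-1.
  apply: W => phi tphi; have [pphi _ _] := test_function_primitive tphi.
  have idphi : integr (derive1 phi) by case: pphi.
  rewrite (@eq_int01 _ _ (fun x => u x * derive1 phi x - int0 g x * derive1 phi x)).
    rewrite int01B; [|exact: integr_mulcont|exact: integr_mulcont].
    by rewrite hu // hg // subrr.
  by move=> y _; rewrite mulrBl.
have := W 0; rewrite lexx ler01 int0_0 subr0 => /(_ isT).
by rewrite -(W x x01) => ->; rewrite subrK.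
Qed.

(** Lebesgue's differentiation theorem, for [g] extended by 0. *)
Lemma int0_eq0_ae g : integr g -> (forall x, 0 <= x <= 1 -> int0 g x = 0) ->
  ae_eq mu I01 g (cst 0).
Proof.
move=> ig g0; pose f := g \_ I01.
have if_ : mu.-integrable setT (EFin \o f).
  have := (@integrable_mkcond _ _ _ mu _ (EFin \o g) (@mI01 R)).1 ig.
  by rewrite restrict_EFin.
have lf : locally_integrable setT f by apply: integrable_locally; first exact: mI01.
have F0 x : \int[mu]_(t in `]-oo, x]) f t = 0.
  have [x0|x0] := ltP x 0.
    rewrite /Rintegral integral0_eq // => y; rewrite /= in_itv /= => yx.
    rewrite /f patchE ifF //; apply/negP => /set_mem; rewrite /= in_itv /=.
    by move=> /andP[/le_lt_trans/(_ (le_lt_trans yx x0))]; rewrite ltxx.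
  have [x1|x1] := leP x 1.
    transitivity (int0 g x); last by rewrite g0 // x0.
    rewrite /int0 Rintegral_mkcond [RHS]Rintegral_mkcond; congr Rintegral.
    apply/funext => y; rewrite /f !patchE; case: ifPn => [yx|yx].
      move/set_mem: yx; rewrite /= in_itv /= => yx.
      have [y0|y0] := boolP (0 <= y).
        by rewrite !mem_set //= in_itv /= ?y0 ?yx ?(le_trans yx x1).
      by rewrite !ifF //; apply/negP => /set_mem; rewrite /= in_itv /= (negbTE y0).
    by rewrite ifF //; apply: contraNF yx => /set_mem yx; apply: mem_set;
      move: yx; rewrite /= !in_itv /= => /andP[].
  transitivity (int01 g); last by rewrite -int0_1 g0 // lexx ler01.
  rewrite Rintegral_mkcond [RHS]Rintegral_mkcond; congr Rintegral.
  apply/funext => y; rewrite /f !patchE; have [yI|yI] := boolP (y \in I01).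
    rewrite mem_set //; move/set_mem: yI; rewrite /= !in_itv /= => /andP[y0 y1].
    exact: le_trans y1 (ltW x1).
  by rewrite if_same.
have hi y : mu.-integrable `]-oo, y] (EFin \o f) by apply: integrableS if_.
have := FTC1Ny hi lf; apply: filterS; first exact: (ae_filter_ringOfSetsType mu).
move=> x /= [_]; rewrite in_itv /= => + x01.
rewrite (_ : (fun y => _) = cst 0); last by apply/funext => y; exact: F0.
by rewrite derive1_cst /f patchE mem_set //= in_itv.
Qed.

Lemma H1_deriv_unique u g g' : H1_deriv u g -> H1_deriv u g' ->
  ae_eq mu I01 g g'.
Proof.
move=> /[dup] [[_ l2 _]] /H1_primitive[ig ug].
move=> /[dup] [[_ l2' _]] /H1_primitive[ig' ug'].
have : ae_eq mu I01 (fun x => g x - g' x) (cst 0).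
  apply: int0_eq0_ae => [|x x01]; first exact: integrB.
  rewrite (@eq_int0 _ _ (fun x => g x + (-1) * g' x)) //; last first.
    by move=> t _; rewrite mulN1r.
  rewrite (int0D ig (integrZ (-1) ig')) // (int0Z _ ig') // mulN1r.
  by have := ug x x01; rewrite (ug' x x01) => /addrI ->; rewrite subrr.
by apply: filterS => x h /h /= /eqP; rewrite subr_eq0 => /eqP.
Qed.

Lemma H1_deriv_cst k : H1_deriv (cst k) (cst 0).
Proof. by apply: primitive_H1; [exact: L2_cst|exact: primitive_cst]. Qed.

Lemma H1_derivD u g v h : H1_deriv u g -> H1_deriv v h ->
  H1_deriv (fun x => u x + v x) (fun x => g x + h x).
Proof.
move=> hu hv; apply: primitive_H1.
  by apply: L2D; [case: hu | case: hv].
by apply: primitiveD; exact: H1_primitive.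
Qed.

Lemma H1_derivZ u g k : H1_deriv u g -> H1_deriv (fun x => k * u x) (fun x => k * g x).
Proof.
move=> hu; apply: primitive_H1; first by apply: L2Z; case: hu.
by apply: primitiveZ; exact: H1_primitive.
Qed.

Lemma weak_derivP u : H1 u -> H1_deriv u (weak_deriv u).
Proof. by move=> [g ug]; apply: (@xgetPex _ (cst 0) [set g | H1_deriv u g]); exists g. Qed.

Lemma weak_derivE u g : H1_deriv u g -> ae_eq mu I01 (weak_deriv u) g.
Proof. by move=> ug; exact: (H1_deriv_unique (weak_derivP (ex_intro _ g ug)) ug). Qed.

Lemma H1_deriv_eq u v g : {in `[0, 1], u =1 v} -> H1_deriv u g -> H1_deriv v g.
Proof.
move=> uv hu; apply: primitive_H1; first by case: hu.
by apply: primitive_eq (H1_primitive hu) uv _.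
Qed.

End WeakDerivative.

(** * Density in L^2 of the H^1 functions that vanish at both ends *)

Section Density.
Context (R : realType).
Implicit Types (f g h k u : R -> R).

Local Notation mu := (@lebesgue_measure R).
Local Notation I01 := (`[0 : R, 1 : R]%classic : set R).
Local Notation integr f := (mu.-integrable I01 (EFin \o f)).
Local Notation int01 f := (Rintegral mu I01 f).

Lemma int01_sqrD_le f g : L2 f -> L2 g ->
  int01 (fun x => (f x + g x) ^+ 2) <=
  2 * int01 (fun x => f x ^+ 2) + 2 * int01 (fun x => g x ^+ 2).
Proof.
move=> hf hg; have [hf2 hg2] := (L2_sqr hf, L2_sqr hg).
rewrite -(int01Z _ hf2) -(int01Z _ hg2) -int01D; [|exact: integrZ|exact: integrZ].
apply: le_int01.
- exact: L2_sqr (L2D hf hg).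
- by apply: integrD; exact: integrZ.
- move=> x _; have := sqr_ge0 (f x - g x); nra.
Qed.

Lemma int01_sqrB_le f g h : L2 f -> L2 g -> L2 h ->
  int01 (fun x => (f x - h x) ^+ 2) <=
  2 * int01 (fun x => (f x - g x) ^+ 2) + 2 * int01 (fun x => (g x - h x) ^+ 2).
Proof.
move=> hf hg hh; apply: le_trans (int01_sqrD_le (L2B hf hg) (L2B hg hh)).
by rewrite (@eq_int01 _ _ (fun x => (f x - g x + (g x - h x)) ^+ 2)) // => x _;
  rewrite addrA subrK.
Qed.

Lemma ae_I01_oo (P : R -> Prop) : (forall x, 0 < x < 1 -> P x) ->
  {ae mu, forall x, I01 x -> P x}.
Proof.
move=> HP; exists [set 0; 1]; split.
- by apply: measurableU; exact: measurable_set1.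
- by apply: countable_lebesgue_measure0; apply: finite_set_countable; exact: finite_set2.
move=> x /= /not_implyP[]; rewrite in_itv /= => /andP[x0 x1] nP.
have [->|xn0] := eqVneq x 0; first by left.
have [->|xn1] := eqVneq x 1; first by right.
by exfalso; apply/nP/HP; rewrite !lt_neqAle eq_sym xn0 x0 xn1 x1.
Qed.

(** The end points may be ignored in the pointwise limit, which suits the
    cutoffs near them. *)
Lemma L2_dominated (f_ : nat -> R -> R) f h : L2 f -> L2 h ->
  (forall n, measurable_fun I01 (f_ n)) ->
  (forall n x, 0 <= x <= 1 -> `|f_ n x - f x| <= h x) ->
  (forall x, 0 < x < 1 -> f_ ^~ x @ \oo --> f x) ->
  forall eps, 0 < eps -> exists n, int01 (fun x => (f x - f_ n x) ^+ 2) < eps.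
Proof.
move=> hf hh mf_ dom cv eps eps0.
have [|||||_ _] := @dominated_convergence _ _ _ mu I01 (@mI01 R)
  (fun n x => ((f x - f_ n x) ^+ 2)%:E) (cst 0%E) (fun x => (h x ^+ 2)%:E).
- move=> n; apply/measurable_EFinP; apply: measurable_funX.
  by apply: measurable_funB; [exact: L2_meas hf|exact: mf_].
- exact: measurable_cst.
- apply: ae_I01_oo => x x01; apply: cvg_EFin; first exact: nearW.
  have : (f x - f_ n x) * (f x - f_ n x) @[n --> \oo] --> (f x - f x) * (f x - f x).
    by apply: cvgM; apply: cvgB; [exact: cvg_cst|exact: cv|exact: cvg_cst|exact: cv].
  by rewrite subrr mulr0.
- exact: L2_sqr hh.
- apply: aeW => x n; rewrite /= in_itv /= => x01.
  have := dom n x x01; rewrite distrC => fh; have h0 := le_trans (normr_ge0 _) fh.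
  by rewrite lee_fin normrX ler_sqr ?nnegrE.
rewrite integral0 => /fine_cvg /cvgrPdist_lt /(_ eps eps0) [n _ /(_ n (leqnn n))].
rewrite /= sub0r normrN => Hn; exists n; apply: le_lt_trans Hn.
exact: ler_norm.
Qed.

Lemma H1_L2 u : H1 u -> L2 u.
Proof. by case=> g [cu _ _]; exact: L2_cont. Qed.

Lemma H1_cont u : H1 u -> {within I01, continuous u}.
Proof. by case=> g []. Qed.

Lemma H1D u v : H1 u -> H1 v -> H1 (fun x => u x + v x).
Proof. by move=> [g hg] [h hh]; eexists; exact: H1_derivD hg hh. Qed.

Lemma H1Z a u : H1 u -> H1 (fun x => a * u x).
Proof. by move=> [g hg]; eexists; exact: H1_derivZ hg. Qed.

Lemma H1_cst a : H1 (fun=> a : R).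
Proof. by eexists; exact: H1_deriv_cst. Qed.

Lemma L2_contM u g : {within I01, continuous u} -> L2 g -> L2 (fun x => u x * g x).
Proof.
move=> cu hg; have [M HM] := cont_bounded cu.
apply: L2_eq (_ : L2 (fun x => g x * u x)); first by move=> x _; rewrite mulrC.
by apply: L2_mulbounded HM => //; apply: integr_meas; exact: integr_cont.
Qed.

Lemma H1M u v : H1 u -> H1 v -> H1 (fun x => u x * v x).
Proof.
move=> [g hu] [h hv]; have [[cu lg _] [cv lh _]] := (hu, hv).
exists (fun x => u x * h x + v x * g x); apply: primitive_H1.
  by apply: L2D; exact: L2_contM.
by apply: primitiveM; exact: H1_primitive.
Qed.

Lemma H1X u n : H1 u -> H1 (fun x => u x ^+ n).
Proof.
move=> hu; elim: n => [|n IH]; first exact: H1_cst.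
rewrite (_ : (fun x => _) = (fun x => u x * u x ^+ n)); first exact: H1M.
by apply/funext => x; rewrite exprS.
Qed.

Lemma H1_id : H1 (id : R -> R).
Proof.
exists (cst 1); apply: primitive_H1; first exact: L2_cst.
by apply: primitive_C1 => // x; apply: continuous_subspaceT => ?; exact: cvg_cst.
Qed.

Definition H10_approx f : Prop := forall eps, 0 < eps -> exists k,
  [/\ H1 k, k 0 = 0, k 1 = 0 & int01 (fun x => (f x - k x) ^+ 2) < eps].

Lemma H10_approx_closed f : L2 f ->
  (forall eps, 0 < eps -> exists g, [/\ L2 g, H10_approx g &
     int01 (fun x => (f x - g x) ^+ 2) < eps]) ->
  H10_approx f.
Proof.
move=> hf H eps eps0; have e4 : 0 < eps / 4 by rewrite divr_gt0.
have [g [hg /(_ _ e4)[k [hk k0 k1 gk]] fg]] := H _ e4.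
exists k; split=> //.
have := int01_sqrB_le hf hg (H1_L2 hk); lra.
Qed.

(** Multiply by the cutoffs [1 - (2 x - 1) ^ (2 n)], polynomials that vanish at
    both ends and tend to 1 inside. *)
Lemma H10_approx_H1 u : H1 u -> H10_approx u.
Proof.
move=> hu eps eps0; have L2u := H1_L2 hu.
pose chi (n : nat) (x : R) : R := 1 + (-1) * ((2 * x + (-1)) ^+ 2) ^+ n.+1.
have chi01 n x : 0 <= x <= 1 -> 0 <= chi n x <= 1.
  move=> /andP[x0 x1]; have : 0 <= x * (1 - x) by rewrite mulr_ge0 ?subr_ge0.
  move=> xx; have s1 : 0 <= (2 * x + (-1)) ^+ 2 <= 1 by rewrite sqr_ge0 /=; lra.
  have : 0 <= ((2 * x + (-1)) ^+ 2) ^+ n.+1 <= 1.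
    by case/andP: s1 => s0 s1; rewrite exprn_ge0 //= exprn_ile1.
  rewrite /chi; lra.
have Hk n : H1 (fun x => u x * chi n x).
  apply: H1M => //; apply: H1D; first exact: H1_cst.
  apply: H1Z; do 2! apply: H1X; apply: H1D; last exact: H1_cst.
  by apply: H1Z; exact: H1_id.
have [||||n Hn] := @L2_dominated (fun n x => u x * chi n x) u (fun x => `|u x|)
  L2u _ _ _ _ eps eps0.
- apply: L2_cont => x; apply: cvg_norm; exact: (H1_cont hu).
- by move=> n; apply: integr_meas; apply: integr_cont; exact: H1_cont (Hk n).
- move=> n x /(chi01 n) c01; rewrite (_ : _ - _ = u x * (chi n x - 1)); last by ring.
  by rewrite normrM ler_piMr // ler_norml; lra.
- move=> x x01; rewrite -[X in _ --> X]mulr1; apply: cvgM; first exact: cvg_cst.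
  rewrite -[X in _ --> X](addr0 1) -(mulr0 (-1)); apply: cvgD; first exact: cvg_cst.
  apply: cvgM; first exact: cvg_cst.
  rewrite (cvg_shiftS (fun n => ((2 * x + (-1)) ^+ 2) ^+ n)).
  apply: cvg_expr; rewrite ger0_norm ?sqr_ge0 //.
  have : 0 < x * (1 - x) by apply: mulr_gt0; lra.
  lra.
exists (fun x => u x * chi n x); split=> //; rewrite /chi.
- by rewrite mulr0 add0r sqrrN !expr1n mulr1 subrr mulr0.
- by rewrite (_ : 2 * 1 + -1 = 1) ?expr1n ?mulr1 ?subrr ?mulr0 //; lra.
Qed.

(** The difference quotients of a primitive of [g] are continuously
    differentiable; by the mean value theorem they are values of [g] at nearby
    points. *)
Lemma H10_approx_cont g : continuous g -> H10_approx g.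
Proof.
move=> cg; have L2g : L2 g by apply: L2_cont; exact: continuous_subspaceT.
pose G (x : R) : R := \int[mu]_(t in `[-1, x]) g t.
have dG (x : R) : -1 < x -> is_derive x 1 G (g x).
  move=> x1; have hi : mu.-integrable `[-1, x + 1] (EFin \o g).
    apply: continuous_compact_integrable; first exact: segment_compact.
    exact: continuous_subspaceT.
  have xx : x < x + 1 by rewrite ltrDl.
  have [dx Dx] := continuous_FTC1_closed xx hi x1 (@cg x).
  by split; [exact: dx | rewrite -derive1E Dx].
pose h n : R := n.+1%:R^-1.
have h0 n : 0 < h n by rewrite invr_gt0 ltr0Sn.
have h1 n : h n <= 1 by rewrite invf_le1 ?ler1n ?ltr0Sn.
pose k n (x : R) : R := n.+1%:R * (G (x + h n) - G x).
have kE n x : 0 <= x <= 1 -> exists2 c, x < c < x + h n & k n x = g c.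
  move=> x01; have xh : x < x + h n by rewrite ltrDl.
  have [|y yx|c cx] := @MVT _ G g x (x + h n) xh.
  - by move=> y; rewrite in_itv /= => yx; apply: dG; have := h0 n; lra.
  - apply: continuous_in_subspaceT => z /set_mem; rewrite /= in_itv /= => zx.
    have /dG dz : -1 < z by have := h0 n; lra.
    by apply/differentiable_continuous/derivable1_diffP/ex_derive.
  - rewrite /k => ->; exists c; first by rewrite in_itv in cx.
    by rewrite [x + _]addrC addrK mulrCA /h divff ?mulr1 // pnatr_eq0.
have Hk n : H1 (k n).
  exists (fun x => n.+1%:R * (g (x + h n) - g x)).
  have cd : {within I01, continuous (fun x => n.+1%:R * (g (x + h n) - g x))}.
    apply: continuous_subspaceT => x; apply: cvgM; first exact: cvg_cst.
    apply: cvgB; last exact: cg.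
    apply: (@continuous_comp _ _ _ (fun x => x + h n) g); last exact: cg.
    by apply: cvgD; [exact: cvg_id|exact: cvg_cst].
  apply: primitive_H1; first exact: L2_cont.
  apply: primitive_C1 => // x x01.
  have d1 : is_derive (x + h n) 1 G (g (x + h n)).
    by apply: dG; have := h0 n; lra.
  have d2 : is_derive x 1 G (g x) by apply: dG; lra.
  have d3 : is_derive x 1 (G \o (fun x => x + h n)) (g (x + h n) * 1).
    apply: is_derive1_comp.
    have -> : (fun x : R => x + h n) = id + cst (h n) by [].
    by apply: is_derive_eq; rewrite addr0.
  have -> : k n = n.+1%:R \*: ((G \o (fun x => x + h n)) - G) by [].
  by apply: is_derive_eq; rewrite mulr1.
have [M HM] : exists M, forall x, 0 <= x <= 2 -> `|g x| <= M.
  have cg2 : {within `[0 : R, 2]%classic, continuous g} by exact: continuous_subspaceT.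
  have /compact_bounded[M [_ MP]] := continuous_compact cg2 (@segment_compact _ 0 2).
  exists (M + 1) => x x01.
  by apply: (MP (M + 1)); [rewrite ltrDl | exists x; rewrite //= in_itv].
apply: H10_approx_closed => // eps eps0.
have [|||n Hn] := @L2_dominated k g (fun=> M + M) L2g (L2_cst _) _ _ _ eps eps0.
- by move=> n; apply: integr_meas; apply: integr_cont; exact: H1_cont.
- move=> n x x01; have [c cx ->] := kE n x x01; have := h1 n => hn1.
  have Hc : `|g c| <= M by apply: HM; lra.
  have Hx : `|g x| <= M by apply: HM; lra.
  by rewrite (le_trans (ler_normB _ _)) // lerD.
- move=> x x01; apply/cvgrPdist_lt => e e0.
  have /cvgrPdist_lt /(_ e e0) /nbhs_ballP[d /= d0 Hd] := @cg x.
  have := near_infty_natSinv_lt (PosNum d0); apply: filterS => n /= nd.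
  have x01' : 0 <= x <= 1 by lra.
  have [c cx ->] := kE n x x01'; apply: Hd; rewrite /ball /=.
  rewrite distrC gtr0_norm ?subr_gt0; last by case/andP: cx.
  by apply: lt_trans nd; rewrite ltrBlDl; case/andP: cx.
by exists (k n); split=> //; [exact: H1_L2|exact: H10_approx_H1].
Qed.

Definition truncate M x : R := Num.max (- M) (Num.min M x).

Lemma truncate_le M x : 0 <= M -> `|truncate M x| <= M.
Proof.
by move=> M0; rewrite ler_norml /truncate le_max ge_max ge_min lexx /= andbT; lra.
Qed.

Lemma truncate_id M x : `|x| <= M -> truncate M x = x.
Proof. by rewrite ler_norml => /andP[x1 x2]; rewrite /truncate min_r // max_r. Qed.

Lemma truncate_dist M x y : `|x| <= M -> `|x - truncate M y| <= `|x - y|.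
Proof.
rewrite ler_norml /truncate => xM.
rewrite /Num.max /Num.min; do !case: ifPn; rewrite -?leNgt;
  rewrite ler_norml; case: (ler0P (x - y)); lra.
Qed.

Lemma truncate_dist0 M x : 0 <= M -> `|truncate M x - x| <= `|x|.
Proof.
move=> M0; rewrite /truncate /Num.max /Num.min; do !case: ifPn; rewrite -?leNgt;
  rewrite ler_norml; case: (ler0P x); lra.
Qed.

Lemma truncate_cont M : continuous (truncate M).
Proof.
move=> x; apply: (@continuous_max _ _ (cst (- M)) (fun x => Num.min M x)).
  exact: cvg_cst.
by apply: (@continuous_min _ _ (cst M) id); [exact: cvg_cst|exact: cvg_id].
Qed.

(** Continuous functions are dense in L^1, and for functions bounded by [M] the
    inequality [(f - g) ^+ 2 <= 2 * M * `|f - g|] turns this into density in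
    L^2. *)
Lemma H10_approx_bounded f M : measurable_fun I01 f -> 0 < M ->
  (forall x, 0 <= x <= 1 -> `|f x| <= M) -> H10_approx f.
Proof.
move=> mf M0 fM; have L2f := L2_bounded mf fM.
apply: H10_approx_closed => // eps eps0.
have mI : (mu I01 < +oo)%E by rewrite (muI01 R) ltry.
have [g_ [cg ig]] := @approximation_continuous_integrable R I01 f (@mI01 R) mI (L2_integr L2f).
have e1 : 0 < eps / (2 * M) by rewrite divr_gt0 // mulr_gt0.
move=> /fine_cvg /cvgrPdist_lt /(_ _ e1) [n _ /(_ n (leqnn n))] /=.
rewrite sub0r normrN => Hn.
pose c x := truncate M (g_ n x).
have cc : continuous c.
  by move=> x; apply: (@continuous_comp _ _ _ (g_ n) (truncate M));
    [exact: cg|exact: truncate_cont].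
have L2c : L2 c by apply: L2_cont; exact: continuous_subspaceT.
exists c; split=> //; first exact: H10_approx_cont.
have ifg : integr (fun x => f x - g_ n x) by apply: integrB => //; exact: L2_integr.
apply: (@le_lt_trans _ _ (int01 (fun x => (2 * M) * `|f x - g_ n x|))).
  apply: le_int01.
  - exact: L2_sqr (L2B L2f L2c).
  - by apply: integrZ; exact: integr_norm.
  move=> x x01; rewrite -real_normK ?num_real // expr2 ler_pM //.
    rewrite (le_trans (ler_normB _ _)) // mulrDl mul1r lerD ?fM //.
    by apply: truncate_le; exact: ltW.
  by apply: truncate_dist; exact: fM.
rewrite int01Z; last exact: integr_norm.
rewrite mulrC -ltr_pdivlMr ?mulr_gt0 //; apply: le_lt_trans Hn.
exact: ler_norm.
Qed.

(** Truncation reduces to bounded functions. *)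
Theorem H10_dense f : L2 f -> H10_approx f.
Proof.
move=> hf; apply: H10_approx_closed => // eps eps0.
pose f_ (n : nat) x := truncate n.+1%:R (f x).
have mf_ n : measurable_fun I01 (f_ n).
  apply: (@measurableT_comp _ _ _ _ _ _ (truncate n.+1%:R) _ f); last exact: L2_meas.
  by apply: continuous_measurable_fun; exact: truncate_cont.
have [|||n Hn] := @L2_dominated f_ f (fun x => `|f x|) hf _ mf_ _ _ eps eps0.
- case: hf => mf f2; split; first exact: measurableT_comp.
  by apply: integr_eq f2 => x _; rewrite real_normK ?num_real.
- by move=> n x _; apply: truncate_dist0.
- move=> x _; apply: cvg_near_cst.
  exists (Num.truncn `|f x|).+1 => // n /= fn; rewrite /f_ truncate_id //.
  apply: ltW; apply: lt_le_trans (truncnS_gt _) _.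
  by rewrite ler_nat ltnW.
have bf x : 0 <= x <= 1 -> `|f_ n x| <= n.+1%:R by move=> _; apply: truncate_le.
exists (f_ n); split=> //; first exact: L2_bounded (bf).
exact: H10_approx_bounded (bf).
Qed.

End Density.

(** * Energy estimates for transport along an edge *)

Section Energy.
Context (R : realType).
Implicit Types (f g w u : R -> R).

Local Notation mu := (@lebesgue_measure R).
Local Notation I01 := (`[0 : R, 1 : R]%classic : set R).
Local Notation integr f := (mu.-integrable I01 (EFin \o f)).
Local Notation int01 f := (Rintegral mu I01 f).

(** Gronwall's inequality for a weighted energy [E] of an L^2-valued function
    [p] of time with right derivative [p'], when [E' <= - lambda * E]. *)
Section Decay.
Context (p p' : R -> R -> R) (w : R -> R) (lambda tau M : R).
Hypotheses (lambda0 : 0 <= lambda).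
Hypothesis (w_cont : {within I01, continuous w}).
Hypothesis (w_bound : forall x, 0 <= x <= 1 -> 0 <= w x <= M).
Hypothesis (p_L2 : forall t, tau <= t -> L2 (p t) /\ L2 (p' t)).
Hypothesis p_cont : forall t, tau <= t -> forall eps, 0 < eps ->
  exists2 d, 0 < d & forall s, tau <= s -> `|s - t| < d ->
    int01 (fun x => (p s x - p t x) ^+ 2) < eps.
Hypothesis p_deriv : forall t, tau <= t -> forall eps, 0 < eps ->
  exists2 d, 0 < d & forall h, 0 < h < d ->
    int01 (fun x => (h^-1 * (p (t + h) x - p t x) - p' t x) ^+ 2) < eps.
Hypothesis dissipation : forall t, tau <= t ->
  2 * int01 (fun x => w x * (p t x * p' t x)) <=
  - (lambda * int01 (fun x => w x * p t x ^+ 2)).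

Let E t := int01 (fun x => w x * p t x ^+ 2).

Let iw f : integr f -> integr (fun x => w x * f x).
Proof. exact: integr_mulcont. Qed.

Let le_wint f g : integr f -> integr g -> (forall x, 0 <= x <= 1 -> f x <= g x) ->
  int01 (fun x => w x * f x) <= int01 (fun x => w x * g x).
Proof.
move=> hf hg fg; apply: le_int01; [exact: iw|exact: iw|move=> x x01].
by rewrite ler_wpM2l ?fg //; case/andP: (w_bound x01).
Qed.

Let wint_le f : integr f -> (forall x, 0 <= x <= 1 -> 0 <= f x) ->
  int01 (fun x => w x * f x) <= M * int01 f.
Proof.
move=> hf f0; rewrite -int01Z //; apply: le_int01; [exact: iw|exact: integrZ|].
by move=> x x01; rewrite ler_wpM2r ?f0 //; case/andP: (w_bound x01).
Qed.

Let M0 : 0 <= M.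
Proof.
have x0 : 0 <= (0 : R) <= 1 by apply/andP.
by have /andP[w0] := w_bound x0; exact: le_trans.
Qed.

Let E_ge0 t : 0 <= E t.
Proof.
apply: int01_ge0 => x x01; rewrite mulr_ge0 ?sqr_ge0 //.
by case/andP: (w_bound x01).
Qed.

(** Young's inequality for [p t = p s - (p s - p t)]. *)
Let E_step s t eta : tau <= s -> tau <= t -> 0 < eta ->
  E t <= (1 + eta) * E s +
         (1 + eta^-1) * (M * int01 (fun x => (p s x - p t x) ^+ 2)).
Proof.
move=> ts tt eta0; have [[ls _] [lt _]] := (p_L2 ts, p_L2 tt).
have ld := L2B ls lt; have [[is2 it2] id2] := (L2_sqr ls, L2_sqr lt, L2_sqr ld).
apply: (@le_trans _ _ (int01 (fun x => w x *
   ((1 + eta) * p s x ^+ 2 + (1 + eta^-1) * (p s x - p t x) ^+ 2)))).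
  apply: le_wint => //; first by apply: integrD; exact: integrZ.
  move=> x _; set a := p s x; set b := p t x.
  have : 0 <= eta^-1 * (eta * a + (a - b)) ^+ 2.
    by rewrite mulr_ge0 ?sqr_ge0 // invr_ge0 ltW.
  have -> : eta^-1 * (eta * a + (a - b)) ^+ 2 =
      eta * a ^+ 2 + 2 * a * (a - b) + eta^-1 * (a - b) ^+ 2.
    by field; rewrite gt_eqF.
  lra.
rewrite (@eq_int01 _ _ (fun x => (1 + eta) * (w x * p s x ^+ 2) +
   (1 + eta^-1) * (w x * (p s x - p t x) ^+ 2))); last by move=> x _; ring.
rewrite (int01D (integrZ _ (iw is2)) (integrZ _ (iw id2))).
rewrite (int01Z _ (iw is2)) (int01Z _ (iw id2)) lerD // ler_wpM2l //.
  by rewrite addr_ge0 // invr_ge0 ltW.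
by apply: wint_le => // x _; exact: sqr_ge0.
Qed.

Let E_left t : tau <= t -> forall eps, 0 < eps -> exists2 d, 0 < d &
  forall s, tau <= s -> `|s - t| < d -> E t <= E s + eps.
Proof.
move=> tt eps eps0.
pose eta := eps / (4 * (E t + 1)).
have Et1 : 0 < 4 * (E t + 1) by have := E_ge0 t; lra.
have eta0 : 0 < eta by rewrite divr_gt0.
pose Q := (1 + eta^-1) * (M + 1).
have i0 : 0 < eta^-1 by rewrite invr_gt0.
have Q0 : 0 < Q by have := M0 => M0'; rewrite mulr_gt0 //; lra.
have [d d0 Hd] := p_cont tt (divr_gt0 eps0 (mulr_gt0 (ltr0Sn R 3) Q0)).
exists d => // s ts /(Hd s ts) Hs.
have [Es|Es] := leP (E t) (E s); first by rewrite ler_wpDr // ltW.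
set D := int01 _ in Hs.
have D0 : 0 <= D by apply: int01_ge0 => x _; exact: sqr_ge0.
have h1 : (1 + eta^-1) * (M * D) <= Q * D.
  rewrite /Q -mulrA ler_wpM2l //; first by rewrite addr_ge0 // invr_ge0 ltW.
  by rewrite ler_wpM2r // lerDl.
have h2 : Q * D <= eps / 4.
  rewrite mulrC -ler_pdivlMr //; apply: le_trans (ltW Hs) _.
  by rewrite invfM mulrA.
have h3 : eta * E s <= eps / 4.
  apply: (@le_trans _ _ (eta * (E t + 1))); first by rewrite ler_wpM2l ?(ltW eta0) //; lra.
  have e1 : E t + 1 != 0 by have := E_ge0 t; rewrite gt_eqF //; lra.
  by rewrite le_eqVlt; apply/orP; left; apply/eqP; rewrite /eta; field.
have := E_step ts tt eta0; rewrite -/D; lra.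
Qed.

Let E_right t : tau <= t -> forall eps, 0 < eps -> exists2 d, 0 < d &
  forall h, 0 < h < d -> E (t + h) <= (1 - lambda * h) * E t + eps * h.
Proof.
move=> tt eps eps0; have [lp lp'] := p_L2 tt.
have [[ip2 ip'2] ipp'] := (L2_sqr lp, L2_sqr lp', L2_mul lp lp').
pose eta := eps / (4 * (E t + 1)).
have Et1 : 0 < 4 * (E t + 1) by have := E_ge0 t; lra.
have eta0 : 0 < eta by rewrite divr_gt0.
pose Q := (eta^-1 + 2) * (M + 1).
have i0 : 0 < eta^-1 by rewrite invr_gt0.
have Q0 : 0 < Q by have := M0 => M0'; rewrite mulr_gt0 //; lra.
have [d1 d10 Hd1] := p_deriv tt (divr_gt0 eps0 (mulr_gt0 (ltr0Sn R 3) Q0)).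
pose A := int01 (fun x => w x * p' t x ^+ 2).
have A0 : 0 <= A.
  by apply: int01_ge0 => x x01; rewrite mulr_ge0 ?sqr_ge0 //; case/andP: (w_bound x01).
pose d2 := eps / (8 * (A + 1)).
have A1 : 0 < 8 * (A + 1) by lra.
have d20 : 0 < d2 by rewrite divr_gt0.
exists (Num.min 1 (Num.min d1 d2)); first by rewrite !lt_min ltr01 d10.
move=> h; rewrite !lt_min => /and4P[h0 h1 hd1 hd2].
have tth : tau <= t + h by lra.
have [lph _] := p_L2 tth.
pose dl x := h^-1 * (p (t + h) x - p t x) - p' t x.
have ldl : L2 dl by apply: L2B => //; apply: L2Z; exact: L2B.
have idl2 := L2_sqr ldl.
have Hdl : int01 (fun x => dl x ^+ 2) < eps / (4 * Q) by apply: Hd1; rewrite h0.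
set D := int01 (fun x => dl x ^+ 2) in Hdl.
have D0 : 0 <= D by apply: int01_ge0 => x _; exact: sqr_ge0.
have main : E (t + h) <= int01 (fun x => w x * ((1 + h * eta) * p t x ^+ 2 +
   (2 * h * (p t x * p' t x) + ((h * (eta^-1 + 2)) * dl x ^+ 2 +
     (2 * h ^+ 2) * p' t x ^+ 2)))).
  apply: le_wint => //; first exact: L2_sqr.
    by do ![apply: integrD|exact: integrZ].
  (* First order expansion; [dl] is the error of the difference quotient. *)
  move=> x _; have -> : p (t + h) x = p t x + h * (p' t x + dl x).
    by rewrite /dl; field; rewrite gt_eqF.
  set a := p t x; set b := p' t x; set z := dl x.
  have k1 : 0 <= h * eta^-1 * (eta * a - z) ^+ 2.
    by apply: mulr_ge0; [apply: mulr_ge0; exact: ltW | exact: sqr_ge0].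
  have k1E : h * eta^-1 * (eta * a - z) ^+ 2 =
      h * eta * a ^+ 2 - 2 * h * (a * z) + h * eta^-1 * z ^+ 2.
    by field; rewrite gt_eqF.
  have k2 : 0 <= h ^+ 2 * (b - z) ^+ 2 by rewrite mulr_ge0 ?sqr_ge0.
  have k3 : 0 <= (h - h ^+ 2) * z ^+ 2.
    by rewrite mulr_ge0 ?sqr_ge0 // subr_ge0 expr2 ler_piMr // ltW.
  move: k1; rewrite k1E => k1; lra.
apply: (le_trans main).
rewrite (@eq_int01 _ _ (fun x => (1 + h * eta) * (w x * p t x ^+ 2) +
   (2 * h * (w x * (p t x * p' t x)) + ((h * (eta^-1 + 2)) * (w x * dl x ^+ 2) +
     (2 * h ^+ 2) * (w x * p' t x ^+ 2))))); last by move=> x _; ring.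
have [[j1 j2] [j3 j4]] := (iw ip2, iw ipp', (iw idl2, iw ip'2)).
rewrite (int01D (integrZ _ j1) (integrD (integrZ _ j2) (integrD (integrZ _ j3) (integrZ _ j4)))).
rewrite (int01D (integrZ _ j2) (integrD (integrZ _ j3) (integrZ _ j4))).
rewrite (int01D (integrZ _ j3) (integrZ _ j4)).
rewrite (int01Z _ j1) (int01Z _ j2) (int01Z _ j3) (int01Z _ j4) -/A -/(E t).
have s1 : eta * E t <= eps / 4.
  apply: (@le_trans _ _ (eta * (E t + 1))); first by rewrite ler_wpM2l ?(ltW eta0) //; lra.
  have e1 : E t + 1 != 0 by have := E_ge0 t; rewrite gt_eqF //; lra.
  by rewrite le_eqVlt; apply/orP; left; apply/eqP; rewrite /eta; field.
have s2 : (eta^-1 + 2) * int01 (fun x => w x * dl x ^+ 2) <= eps / 4.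
  apply: (@le_trans _ _ (Q * D)).
    rewrite /Q -mulrA ler_wpM2l //; first by rewrite addr_ge0 // invr_ge0 ltW.
    apply: le_trans (wint_le idl2 _) _; first by move=> x _; exact: sqr_ge0.
    by rewrite ler_wpM2r // lerDl.
  rewrite mulrC -ler_pdivlMr //; apply: le_trans (ltW Hdl) _.
  by rewrite invfM mulrA.
have s3 : 2 * h * A <= eps / 4.
  apply: (@le_trans _ _ (2 * d2 * (A + 1))).
    by apply: ler_pM => //; lra.
  have e1 : A + 1 != 0 by rewrite gt_eqF //; lra.
  by rewrite le_eqVlt; apply/orP; left; apply/eqP; rewrite /d2; field.
have := dissipation tt; rewrite -/(E t) => dis.
set X := int01 _ in dis *; set Y := int01 _ in s2 *.
have t1 : h * (eta * E t) <= h * (eps / 4) by rewrite ler_wpM2l // ltW.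
have t2 : h * ((eta^-1 + 2) * Y) <= h * (eps / 4) by rewrite ler_wpM2l // ltW.
have t3 : h * (2 * h * A) <= h * (eps / 4) by rewrite ler_wpM2l // ltW.
have t4 : h * (2 * X) <= h * - (lambda * E t) by rewrite ler_wpM2l // ltW.
have t5 : 0 <= h * eps by rewrite mulr_ge0 // ltW.
lra.
Qed.

Lemma energy_decay t : tau <= t ->
  int01 (fun x => w x * p t x ^+ 2) <=
  expR (- (lambda * (t - tau))) * int01 (fun x => w x * p tau x ^+ 2).
Proof.
move=> tt; rewrite -/(E t) -/(E tau).
pose F (s : R) := expR (lambda * (s - tau)) * E s.
suff : F t <= F tau.
  rewrite /F subrr mulr0 expR0 mul1r => Ft.
  by rewrite expRN mulrC ler_pdivlMr ?expR_gt0 // mulrC.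
have grow (s v : R) : s <= v -> expR (lambda * (s - tau)) <= expR (lambda * (v - tau)).
  by move=> su; rewrite ler_expR ler_wpM2l // lerD2r.
apply: right_derivative_nonincreasing => // x /andP[].
  move=> tx xt eps eps0; have tx' := ltW tx.
  pose K := expR (lambda * (x - tau)); have K0 : 0 < K by exact: expR_gt0.
  have e2 : 0 < eps / (2 * K) by rewrite divr_gt0 // mulr_gt0.
  have [d1 d10 H1] := E_left tx' e2.
  pose B := E x + 1; have B0 : 0 < B by rewrite ltr_wpDl.
  have ce : {for x, continuous (fun s => expR (lambda * (s - tau)))}.
    apply: (@continuous_comp _ _ _ (fun s => lambda * (s - tau)) expR).
      by apply: cvgM; [exact: cvg_cst|apply: cvgB; [exact: cvg_id|exact: cvg_cst]].
    exact: continuous_expR.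
  have e3 : 0 < eps / (2 * B) by rewrite divr_gt0 // mulr_gt0.
  have /cvgrPdist_lt /(_ _ e3) /nbhs_ballP[d2 /= d20 H2] := ce.
  exists (Num.min d1 d2); first by rewrite lt_min d10.
  move=> y /andP[ty yx] xy; have dy : `|y - x| < Num.min d1 d2.
    by rewrite ltr_norml; move: xy; rewrite !lt_min; lra.
  move: dy; rewrite lt_min => /andP[dy1 dy2].
  have E1 := H1 y ty dy1.
  have := H2 y; rewrite /ball /= distrC => /(_ dy2); rewrite ltr_norml => /andP[_ E2].
  rewrite /F; set Ky := expR (lambda * (y - tau)) in E2 *; rewrite -/K in E2 *.
  have Ky0 : 0 < Ky by exact: expR_gt0.
  have KyK : Ky <= K by apply: grow; exact: ltW.
  have a1 : (K - Ky) * E x <= eps / 2.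
    apply: (@le_trans _ _ (eps / (2 * B) * B)).
      by apply: ler_pM => //; rewrite ?subr_ge0 //; [exact: ltW|rewrite lerDl].
    have e4 : B != 0 by rewrite gt_eqF.
    by rewrite le_eqVlt; apply/orP; left; apply/eqP; field.
  have a2 : Ky * E x <= Ky * (E y + eps / (2 * K)) by rewrite ler_wpM2l // ltW.
  have a3 : Ky * (eps / (2 * K)) <= eps / 2.
    apply: (@le_trans _ _ (K * (eps / (2 * K)))); first by rewrite ler_wpM2r // ltW.
    have e4 : K != 0 by rewrite gt_eqF.
    by rewrite le_eqVlt; apply/orP; left; apply/eqP; field.
  rewrite mulrBl in a1; rewrite mulrDr in a2; lra.
move=> tx xt eps eps0.
pose K := expR (lambda * (t + 1 - tau)); have K0 : 0 < K by exact: expR_gt0.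
have [d d0 Hd] := E_right tx (divr_gt0 eps0 K0).
exists (Num.min d 1); first by rewrite lt_min d0 ltr01.
move=> h; rewrite lt_min => /and3P[h0 hd h1].
have hh : 0 < h < d by rewrite h0.
have := Hd h hh => E1; rewrite /F.
have eh : lambda * (x + h - tau) = lambda * (x - tau) + lambda * h by ring.
set Kh := expR (lambda * (x + h - tau)).
have Kh0 : 0 < Kh by exact: expR_gt0.
have KhK : Kh <= K by apply: grow; lra.
have a1 : Kh * (1 - lambda * h) <= expR (lambda * (x - tau)).
  rewrite /Kh eh expRD -mulrA ler_piMr ?expR_ge0 //.
  have := expR_ge1Dx (- (lambda * h)); rewrite expRN => e1.
  by rewrite mulrC -ler_pdivlMr ?expR_gt0 // div1r.
have a2 : Kh * E (x + h) <= Kh * ((1 - lambda * h) * E x + eps / K * h).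
  by rewrite ler_wpM2l // ltW.
have a3 : Kh * (1 - lambda * h) * E x <= expR (lambda * (x - tau)) * E x.
  by rewrite ler_wpM2r.
have a4 : Kh * (eps / K * h) <= eps * h.
  rewrite mulrA ler_wpM2r ?(ltW h0) //.
  by rewrite mulrCA ler_piMr ?(ltW eps0) // ler_pdivrMr // mul1r.
rewrite mulrDr mulrA in a2; lra.
Qed.

End Decay.
(** [true] stands for waves that travel towards the end 0 of an edge and
    [false] for those that travel towards the end 1; thus waves of kind [b]
    enter the edge at [b%:R]. *)
Definition sgn (b : bool) : R := if b then 1 else -1.

(** Integrate the derivative of [P ^+ 2 * w]: the boundary term vanishes at the
    end [b%:R], where waves enter, and has the right sign at the other one. *)
Lemma boundary_dissipation (b : bool) lambda P Px w :
  H1_deriv P Px -> primitive w (fun x => sgn b * lambda * w x) ->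
  (forall x, 0 <= w x) -> P b%:R = 0 ->
  2 * (sgn b * int01 (fun x => w x * (P x * Px x))) <=
  - (lambda * int01 (fun x => w x * P x ^+ 2)).
Proof.
move=> hP pw w0 Pb; have pP := H1_primitive hP.
have [_ LPx _] := hP; have cP := primitive_cont pP; have cw := primitive_cont pw.
have LP : L2 P by exact: L2_cont.
have [iPPx iP2] := (L2_mul LP LPx, L2_sqr LP).
have i1 : integr (fun x => w x * (P x * Px x)) by exact: integr_mulcont.
have i2 : integr (fun x => w x * P x ^+ 2) by exact: integr_mulcont.
have [_ /(_ 1)] := primitiveM (primitiveM pP pP) pw.
rewrite lexx ler01 int0_1 => /(_ isT).
rewrite (@eq_int01 _ _ (fun x => (sgn b * lambda) * (w x * P x ^+ 2) +
  2 * (w x * (P x * Px x)))); last by move=> x _; ring.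
rewrite (int01D (integrZ _ i2) (integrZ _ i1)) (int01Z _ i2) (int01Z _ i1).
set X := int01 _; set Y := int01 _.
case: b Pb {pw} => /= ->; rewrite /sgn.
- have : 0 <= P 0 * P 0 * w 0 by rewrite mulr_ge0 // -expr2 sqr_ge0.
  lra.
- have : 0 <= P 1 * P 1 * w 1 by rewrite mulr_ge0 // -expr2 sqr_ge0.
  lra.
Qed.

Lemma primitive_expR a : primitive (fun x : R => expR (a * x)) (fun x => a * expR (a * x)).
Proof.
have d (x : R) : is_derive x 1 (fun x : R => expR (a * x)) (a * expR (a * x)).
  have -> : (fun x : R => expR (a * x)) = expR \o (a \*: (id : R -> R)) by [].
  rewrite mulrC; apply: is_derive1_comp.
  by apply: is_derive_eq; rewrite /GRing.scale /= mulr1.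
apply: primitive_C1 => // x; apply: cvgM; first exact: cvg_cst.
apply: continuous_subspaceT => {}x.
by apply/differentiable_continuous/derivable1_diffP; apply: ex_derive.
Qed.

(** [p] solves the transport equation [p' = sgn b * c * P'] with nothing entering
    the edge after the time [tau]. *)
Section Extinction.
Context (b : bool) (c tau : R) (p p' : R -> R -> R).
Hypotheses (c0 : 0 < c).
Hypothesis (p_L2 : forall t, tau <= t -> L2 (p t) /\ L2 (p' t)).
Hypothesis p_cont : forall t, tau <= t -> forall eps, 0 < eps ->
  exists2 d, 0 < d & forall s, tau <= s -> `|s - t| < d ->
    int01 (fun x => (p s x - p t x) ^+ 2) < eps.
Hypothesis p_deriv : forall t, tau <= t -> forall eps, 0 < eps ->
  exists2 d, 0 < d & forall h, 0 < h < d ->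
    int01 (fun x => (h^-1 * (p (t + h) x - p t x) - p' t x) ^+ 2) < eps.
Hypothesis transport : forall t, tau <= t -> exists P Px,
  [/\ H1_deriv P Px, ae_eq mu I01 (p t) P,
      ae_eq mu I01 (p' t) (fun x => sgn b * c * Px x) & P b%:R = 0].

(** The weighted energy decays at the rate [c * lambda], while the weight
    [expR (sgn b * lambda * x)] compares with its minimum up to the factor
    [expR lambda]. *)
Lemma extinction_bound lambda t : 0 <= lambda -> tau <= t ->
  int01 (fun x => p t x ^+ 2) <=
  expR (lambda * (1 - c * (t - tau))) * int01 (fun x => p tau x ^+ 2).
Proof.
move=> l0 tt; pose w x := expR (sgn b * lambda * x).
have pw : primitive w (fun x => sgn b * lambda * w x) by exact: primitive_expR.
have cw := primitive_cont pw.
pose m : R := if b then 1 else expR (- lambda).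
pose M : R := if b then expR lambda else 1.
have wmM x : 0 <= x <= 1 -> m <= w x <= M.
  move=> /andP[x0 x1]; rewrite /m /M /w /sgn.
  have lx : 0 <= lambda * x <= lambda by rewrite mulr_ge0 //= ler_piMr.
  by case: b; rewrite ?mul1r ?mulN1r ?mulNr -expR0 !ler_expR; lra.
have m0 : 0 < m by rewrite /m; case: b; rewrite ?expR_gt0.
have Mm : M = expR lambda * m.
  by rewrite /M /m; case: b; rewrite ?mulr1 // -expRD subrr expR0.
have w_bound x : 0 <= x <= 1 -> 0 <= w x <= M.
  by move=> /wmM /andP[mw ->]; rewrite expR_ge0.
have cl0 : 0 <= c * lambda by rewrite mulr_ge0 // ltW.
have dis s : tau <= s -> 2 * int01 (fun x => w x * (p s x * p' s x)) <=
    - (c * lambda * int01 (fun x => w x * p s x ^+ 2)).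
  move=> ts; have [P [Px [hP pP p'P Pb]]] := transport ts.
  have [lp lp'] := p_L2 ts; have LP : L2 P by apply: H1_L2; exists Px.
  have LPx : L2 Px by case: hP.
  have := boundary_dissipation (lambda := lambda) hP pw (fun x => expR_ge0 _) Pb.
  have iPPx : integr (fun x => w x * (P x * Px x)).
    by apply: integr_mulcont => //; exact: L2_mul.
  have -> : int01 (fun x => w x * (p s x * p' s x)) =
      sgn b * c * int01 (fun x => w x * (P x * Px x)).
    rewrite -(int01Z _ iPPx); apply: ae_int01.
    - by apply: integr_mulcont => //; exact: L2_mul.
    - by apply: integr_meas; exact: integrZ.
    - by apply: filterS2 pP p'P => x h1 h2 Ix; rewrite h1 // h2 //; ring.
  have -> : int01 (fun x => w x * p s x ^+ 2) = int01 (fun x => w x * P x ^+ 2).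
    apply: ae_int01.
    - by apply: integr_mulcont => //; exact: L2_sqr.
    - by apply: integr_meas; apply: integr_mulcont => //; exact: L2_sqr.
    - by apply: filterS pP => x h1 Ix; rewrite h1.
  move=> /(ler_wpM2l (ltW c0)); lra.
have := @energy_decay p p' w (c * lambda) tau M cl0 cw w_bound p_L2 p_cont p_deriv dis t tt.
have wle s : tau <= s -> m * int01 (fun x => p s x ^+ 2) <=
    int01 (fun x => w x * p s x ^+ 2) <= M * int01 (fun x => p s x ^+ 2).
  move=> ts; have [/L2_sqr ip _] := p_L2 ts; have iwp := integr_mulcont cw ip.
  rewrite -!int01Z //; apply/andP; split; apply: le_int01 => //; try exact: integrZ.
    by move=> x /wmM /andP[h _]; rewrite ler_wpM2r ?sqr_ge0.
  by move=> x /wmM /andP[_ h]; rewrite ler_wpM2r ?sqr_ge0.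
have /andP[lo _] := wle t tt; have /andP[_ hi] := wle tau (lexx _).
move=> dec; rewrite -(ler_pM2l m0); apply: le_trans lo (le_trans dec _).
apply: le_trans (ler_wpM2l (expR_ge0 _) hi) _.
rewrite Mm le_eqVlt; apply/orP; left; apply/eqP.
have -> : lambda * (1 - c * (t - tau)) = - (c * lambda * (t - tau)) + lambda by ring.
by rewrite expRD; ring.
Qed.

(** For [t > tau + c^-1] the exponent in [extinction_bound] is negative, so the
    bound tends to 0 when [lambda] tends to infinity. *)
Lemma extinction t : tau + c^-1 < t -> ae_eq mu I01 (p t) (cst 0).
Proof.
move=> tt; have ic : 0 < c^-1 by rewrite invr_gt0.
have ttau : tau <= t by lra.
pose y := c * (t - tau) - 1.
have y0 : 0 < y.
  by rewrite subr_gt0 mulrC -ltr_pdivrMr // div1r; lra.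
set K := int01 (fun x => p tau x ^+ 2).
have K0 : 0 <= K by apply: int01_ge0 => x _; exact: sqr_ge0.
have E0 : int01 (fun x => p t x ^+ 2) = 0.
  set E := int01 _; have Ege : 0 <= E by apply: int01_ge0 => x _; exact: sqr_ge0.
  apply/eqP/negPn/negP => En0; have Epos : 0 < E by rewrite lt_neqAle eq_sym En0.
  (* This rate makes the bound smaller than [E], as [expR] is at least [1 + x]. *)
  pose l := K / (E * y).
  have l0 : 0 <= l by rewrite divr_ge0 // mulr_ge0 // ltW.
  have := extinction_bound l0 ttau; rewrite -/E -/K.
  have -> : l * (1 - c * (t - tau)) = - (l * y) by rewrite /y; ring.
  rewrite expRN mulrC ler_pdivlMr ?expR_gt0 // => h.
  have := ler_wpM2l Ege (expR_ge1Dx (l * y)).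
  have ly : E * (l * y) = K by rewrite /l; field; rewrite !gt_eqF.
  rewrite mulrDr ly; lra.
have [/L2_sqr ip _] := p_L2 ttau.
have := int01_eq0 ip (fun x _ => sqr_ge0 _) E0.
by apply: filterS => x h /h /eqP; rewrite sqrf_eq0 => /eqP.
Qed.

End Extinction.
End Energy.

(** * Semigroups for a seminorm *)

(** Vectors at distance 0 may differ, so the semigroup laws hold up to null
    vectors. Everything is expressed with squares, for which the triangle
    inequality becomes [sqnorm_lin]. *)

Section AbstractSemigroup.
Context (R : realType) (E : lmodType R) (H : set E) (nrm : E -> R).
Context (S : R -> E -> E) (A : E -> E -> Prop).
Implicit Types (U W Z : E) (a h t : R).

Local Notation nrm_sqr U := (nrm U ^+ 2).

Hypothesis nrm_ge0 : forall U, 0 <= nrm U.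
Hypothesis phase_lin : forall a U W, H U -> H W -> H (a *: U + W).
Hypothesis sqnorm_lin : forall a U W, H U -> H W ->
  nrm_sqr (a *: U + W) <= 2 * a ^+ 2 * nrm_sqr U + 2 * nrm_sqr W.
Hypothesis S_semigroup : C0_semigroup H nrm S.
Hypothesis S_generated : generated_by H nrm S A.

Lemma oppr_lin (x : E) : - x = (- 2) *: x + x.
Proof.
rewrite -[X in _ = _ + X]scale1r -scalerDl -scaleN1r; congr (_ *: _); lra.
Qed.

(** The hypotheses speak of vectors [a *: U + W]; this brings a difference
    quotient into that form. *)
Lemma quotient_lin (k : R) (x y z : E) :
  k *: (x - y) - z = (-1) *: z + ((k - 1) *: ((-1) *: y + x) + ((-1) *: y + x)).
Proof.
rewrite !scaleN1r [- y + x]addrC [RHS]addrC; congr (_ - _).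
by rewrite -[X in _ = _ + X]scale1r -scalerDl subrK.
Qed.

Lemma phaseB U W : H U -> H W -> H (U - W).
Proof. by move=> hU hW; rewrite addrC -scaleN1r; exact: phase_lin. Qed.

Lemma phaseN U : H U -> H (- U).
Proof.
by move=> hU; rewrite oppr_lin; exact: phase_lin.
Qed.

Lemma sqnorm_triangle U W Z : H U -> H W -> H Z ->
  nrm_sqr (U - Z) <= 2 * nrm_sqr (U - W) + 2 * nrm_sqr (W - Z).
Proof.
move=> hU hW hZ; have := sqnorm_lin 1 (phaseB hU hW) (phaseB hW hZ).
by rewrite scale1r addrA subrK expr1n mulr1.
Qed.

Definition null U : Prop := nrm_sqr U = 0.

Lemma null_le U x : nrm_sqr U <= x -> x = 0 -> null U.
Proof. by move=> Ux x0; apply/eqP; rewrite eq_le sqr_ge0 andbT -x0. Qed.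

Lemma null_trans U W Z : H U -> H W -> H Z ->
  null (U - W) -> null (W - Z) -> null (U - Z).
Proof.
move=> hU hW hZ UW WZ; apply: null_le (sqnorm_triangle hU hW hZ) _.
by rewrite UW WZ !mulr0 addr0.
Qed.

Lemma null_lin a U U' W W' : H U -> H U' -> H W -> H W' ->
  null (U - U') -> null (W - W') -> null (a *: U + W - (a *: U' + W')).
Proof.
move=> hU hU' hW hW' UU WW.
have -> : a *: U + W - (a *: U' + W') = a *: (U - U') + (W - W').
  by rewrite scalerBr opprD addrACA.
apply: null_le (sqnorm_lin _ (phaseB hU hU') (phaseB hW hW')) _.
by rewrite UU WW !mulr0 addr0.
Qed.

Lemma null_sym U W : H U -> H W -> null (U - W) -> null (W - U).
Proof.
move=> hU hW UW; have hUW := phaseB hU hW.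
rewrite -opprB oppr_lin.
by apply: null_le (sqnorm_lin _ hUW hUW) _; rewrite UW !mulr0 addr0.
Qed.

Lemma nrm0_null U : nrm U = 0 -> null U.
Proof. by move=> U0; rewrite /null U0 expr0n. Qed.

Lemma S_phase t U : 0 <= t -> H U -> H (S t U).
Proof. by case: S_semigroup => [+ _ _ _ _]; exact. Qed.

Lemma S_lin t a U W : 0 <= t -> H U -> H W ->
  null (S t (a *: U + W) - (a *: S t U + S t W)).
Proof.
by case: S_semigroup => [_ + _ _ _] t0 hU hW => /(_ t a U W t0 hU hW) /nrm0_null.
Qed.

Lemma S_bounded t : 0 <= t -> exists M, forall U, H U -> nrm_sqr (S t U) <= M ^+ 2 * nrm_sqr U.
Proof.
case: S_semigroup => [_ _ + _ _] t0 => /(_ t t0)[M HM]; exists M => U hU.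
by rewrite -exprMn lerXn2r ?nnegrE ?HM ?nrm_ge0 //
  (le_trans (nrm_ge0 _) (HM U hU)).
Qed.

Lemma S_add s t U : 0 <= s -> 0 <= t -> H U -> null (S (s + t) U - S s (S t U)).
Proof.
case: S_semigroup => [_ _ _ + _] s0 t0 hU => /(_ U hU)[_ /(_ s t s0 t0)].
exact: nrm0_null.
Qed.

Lemma S_cont t0 U : 0 <= t0 -> H U -> forall eps, 0 < eps -> exists2 d, 0 < d &
  forall t, 0 <= t -> `|t - t0| < d -> nrm_sqr (S t U - S t0 U) < eps.
Proof.
case: S_semigroup => [_ _ _ _ +] t00 hU => /(_ U t0 hU t00).
move=> /cvgrPdist_lt H1 eps eps0; have se : 0 < Num.sqrt eps by rewrite sqrtr_gt0.
have := H1 _ se; rewrite near_withinE => /nbhs_ballP[d /= d0 Hd].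
exists d => // t tge td; have := Hd t; rewrite /ball /= distrC => /(_ td tge).
rewrite sub0r normrN ger0_norm ?nrm_ge0 // => lts.
by rewrite -[ltRHS](sqr_sqrtr (ltW eps0)) ltr_pXn2r ?nnegrE ?sqrtr_ge0 ?nrm_ge0.
Qed.

Lemma generatorP U W : H U -> H W -> A U W <->
  forall eps, 0 < eps -> exists2 d, 0 < d & forall h, 0 < h < d ->
    nrm_sqr (h^-1 *: (S h U - U) - W) < eps.
Proof.
move=> hU hW; rewrite (S_generated hU hW); split=> [/cvgrPdist_lt cv|cv].
  move=> eps eps0; have se : 0 < Num.sqrt eps by rewrite sqrtr_gt0.
  have := cv _ se; rewrite near_withinE => /nbhs_ballP[d /= d0 Hd].
  exists d => // h /andP[h0 hd]; have := Hd h; rewrite /ball /= sub0r normrN gtr0_norm //.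
  move=> /(_ hd h0); rewrite sub0r normrN ger0_norm ?nrm_ge0 // => lts.
  by rewrite -[ltRHS](sqr_sqrtr (ltW eps0)) ltr_pXn2r ?nnegrE ?sqrtr_ge0 ?nrm_ge0.
apply/cvgrPdist_lt => eps eps0; have [d d0 Hd] := cv _ (exprn_gt0 2 eps0).
rewrite near_withinE; apply/nbhs_ballP; exists d => //= h; rewrite /ball /= sub0r normrN.
move=> hd h0; rewrite sub0r normrN ger0_norm ?nrm_ge0 //.
rewrite -(@ltr_pXn2r _ 2) ?nnegrE ?nrm_ge0 ?(ltW eps0) //.
by apply: Hd; rewrite h0 /= (le_lt_trans (ler_norm _) hd).
Qed.

(** [S t] maps the difference quotient of [S h U] at [h = 0] to that of
    [S h (S t U)], up to a null vector, and it is bounded. *)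
Lemma domain_invariant t U W : 0 <= t -> H U -> H W -> A U W -> A (S t U) (S t W).
Proof.
move=> t0 hU hW /(generatorP hU hW) dU.
have [hSU hSW] := (S_phase t0 hU, S_phase t0 hW).
apply/(generatorP hSU hSW) => eps eps0.
have [M HM] := S_bounded t0.
have M0 : 0 < 2 * (M ^+ 2 + 1) by rewrite mulr_gt0 // ltr_wpDl // sqr_ge0.
have [d d0 Hd] := dU _ (divr_gt0 eps0 M0); exists d => // h /[dup] /andP[h0 _] hd.
have h0' := ltW h0.
pose Z := (-1) *: U + S h U; pose Z' := (-1) *: S t U + S h (S t U).
have hShU := S_phase h0' hU; have hSS := S_phase t0 hShU; have hSS' := S_phase h0' hSU.
have hZ : H Z by exact: phase_lin.
have hZ' : H Z' by exact: phase_lin.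
have hQ : H ((h^-1 - 1) *: Z + Z) by exact: phase_lin.
have hQ' : H ((h^-1 - 1) *: Z' + Z') by exact: phase_lin.
have hD : H ((-1) *: W + ((h^-1 - 1) *: Z + Z)) by exact: phase_lin.
have hD' : H ((-1) *: S t W + ((h^-1 - 1) *: Z' + Z')) by exact: phase_lin.
have th : 0 <= t + h by rewrite addr_ge0.
have n1 : null (S t (S h U) - S h (S t U)).
  apply: (@null_trans _ (S (t + h) U)) => //; first exact: S_phase.
    by apply: null_sym => //; [exact: S_phase|exact: S_add].
  by rewrite [t + h]addrC; exact: S_add.
have nref X : H X -> null (X - X).
  move=> hX; apply: (@null_trans _ (S 0 X)) => //; first exact: S_phase.
    by apply: null_sym => //; [exact: S_phase|];
      case: S_semigroup => [_ _ _ /(_ X hX)[/nrm0_null ? _] _].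
  by case: S_semigroup => [_ _ _ /(_ X hX)[/nrm0_null ? _] _].
have n2 : null (S t Z - Z').
  apply: (@null_trans _ ((-1) *: S t U + S t (S h U))) => //; first exact: S_phase.
  - exact: phase_lin.
  - exact: S_lin.
  - by apply: null_lin => //; exact: nref.
have hSZ := S_phase t0 hZ.
have n3 : null (S t ((h^-1 - 1) *: Z + Z) - ((h^-1 - 1) *: Z' + Z')).
  apply: (@null_trans _ ((h^-1 - 1) *: S t Z + S t Z)) => //; first exact: S_phase.
  - exact: phase_lin.
  - exact: S_lin.
  - exact: null_lin.
have n4 : null (S t ((-1) *: W + ((h^-1 - 1) *: Z + Z)) -
                ((-1) *: S t W + ((h^-1 - 1) *: Z' + Z'))).
  apply: (@null_trans _ ((-1) *: S t W + S t ((h^-1 - 1) *: Z + Z))) => //.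
  - exact: S_phase.
  - by apply: phase_lin => //; exact: S_phase.
  - exact: S_lin.
  - by apply: null_lin => //; [exact: S_phase|exact: nref].
have hSD := S_phase t0 hD.
have := sqnorm_lin (-1) (phaseB hSD hD') hSD.
have cancelB (x y : E) : (-1) *: (x - y) + x = y by rewrite scaleN1r opprB subrK.
rewrite cancelB n4 mulr0 add0r -quotient_lin => le1.
have := HM _ hD => le2.
have := Hd h hd; rewrite quotient_lin -/Z => lt3; apply: le_lt_trans le1 _.
rewrite ltr_pdivlMr // in lt3.
have := sqr_ge0 (nrm ((-1) *: W + ((h^-1 - 1) *: Z + Z))); set q := nrm_sqr _ in le2 lt3 *.
move=> q0; lra.
Qed.

Lemma right_derivative t U W : 0 <= t -> H U -> H W -> A U W ->
  forall eps, 0 < eps -> exists2 d, 0 < d & forall h, 0 < h < d ->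
    nrm_sqr (h^-1 *: (S (t + h) U - S t U) - S t W) < eps.
Proof.
move=> t0 hU hW AUW eps eps0; have [hSU hSW] := (S_phase t0 hU, S_phase t0 hW).
have e2 : 0 < eps / 2 by rewrite divr_gt0.
have [d d0 Hd] := (generatorP hSU hSW).1 (domain_invariant t0 hU hW AUW) _ e2.
exists d => // h /[dup] /andP[/ltW h0 _] /Hd lt1.
have th : 0 <= t + h by rewrite addr_ge0.
have hth := S_phase th hU; have hht := S_phase h0 hSU.
have n : null (S (t + h) U - S h (S t U)) by rewrite [t + h]addrC; exact: S_add.
have hX : H (h^-1 *: (S h (S t U) - S t U) - S t W).
  by apply: phase_lin; [exact: phaseB|exact: phaseN].
have := sqnorm_lin h^-1 (phaseB hth hht) hX; rewrite n mulr0 add0r addrA -scalerDr addrA subrK.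
by lra.
Qed.

End AbstractSemigroup.

(** * Uniform bounds and approximation on one edge *)

Section Approximation.
Context (R : realType).
Implicit Types (f g u v w : R -> R).

Local Notation mu := (@lebesgue_measure R).
Local Notation I01 := (`[0 : R, 1 : R]%classic : set R).
Local Notation integr f := (mu.-integrable I01 (EFin \o f)).
Local Notation int01 f := (Rintegral mu I01 f).

Lemma sqr_int0_le f (x : R) : L2 f -> 0 <= x <= 1 ->
  int0 f x ^+ 2 <= int01 (fun t => f t ^+ 2).
Proof.
move=> hf /[dup] x01 /andP[x0 x1]; have ihf := L2_integr hf.
have inf := integr_norm ihf; have iz := integr_cst (0 : R).
have h1 := le_int0_sub ihf inf (lexx 0) x0 x1 (fun t _ => ler_norm (f t)).
have h2 := le_int0_sub (integrZ (-1) ihf) inf (lexx 0) x0 x1.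
have {}h2 : int0 (fun t => -1 * f t) x - int0 (fun t => -1 * f t) 0 <=
    int0 (fun t => `|f t|) x - int0 (fun t => `|f t|) 0.
  by apply: h2 => t _; rewrite mulN1r -normrN ler_norm.
have h3 := le_int0_sub iz inf x0 x1 (lexx 1) (fun t _ => normr_ge0 (f t)).
have z0 (y : R) : int0 (fun=> 0 : R) y = 0 by rewrite /int0 /Rintegral integral0.
rewrite !int0_0 !subr0 in h1 h2; rewrite (int0Z _ ihf) // mulN1r in h2.
rewrite !z0 subr0 int0_1 in h3.
set n := int01 _ in h3.
have fn : `|int0 f x| <= n by rewrite ler_norml; lra.
have lnf : L2 (fun t => `|f t|).
  case: hf => mf f2; split; first exact: measurableT_comp.
  by apply: integr_eq f2 => t _; rewrite real_normK ?num_real.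
have := sqr_int01_le lnf.
rewrite (@eq_int01 _ (fun t => `|f t| ^+ 2) (fun t => f t ^+ 2)); last first.
  by move=> t _; rewrite real_normK ?num_real.
apply: le_trans; rewrite -(real_normK (num_real (int0 f x))).
by rewrite lerXn2r ?nnegrE //; apply: le_trans fn.
Qed.

(** [u] is its mean plus the deviation of a primitive of [g] from its own
    mean. *)
Lemma H1_sup_le u g (x : R) : H1_deriv u g -> 0 <= x <= 1 ->
  u x ^+ 2 <= 6 * (int01 (fun t => u t ^+ 2) + int01 (fun t => g t ^+ 2)).
Proof.
move=> hu x01; have [ig pu] := H1_primitive hu.
have [_ lg _] := hu; have lu : L2 u by apply: H1_L2; exists g.
have cg := int0_cont ig; have lG := L2_cont cg.
have mE : int01 u = u 0 + int01 (int0 g).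
  rewrite (@eq_int01 _ _ (fun t => u 0 + int0 g t)).
    by rewrite (int01D (integr_cst _) (L2_integr lG)) int01_cst.
  by move=> t; rewrite in_itv /=; exact: pu.
have s1 := sqr_int01_le lu; have s2 := sqr_int01_le lG.
have s3 : int01 (fun t => int0 g t ^+ 2) <= int01 (fun t => g t ^+ 2).
  rewrite -[leRHS]int01_cst; apply: le_int01; [exact: L2_sqr|exact: integr_cst|].
  by move=> t t01; exact: sqr_int0_le.
have s4 := sqr_int0_le lg x01.
rewrite (pu x x01) (_ : u 0 = int01 u - int01 (int0 g)); last by rewrite mE addrK.
set a := int01 u in s1 *; set d := int01 (int0 g) in s2 *; set z := int0 g x in s4 *.
have k1 := sqr_ge0 (a + d); have k2 := sqr_ge0 (a - z); have k3 := sqr_ge0 (d + z).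
have : (a - d + z) ^+ 2 <= 3 * (a ^+ 2 + d ^+ 2 + z ^+ 2).
  suff -> : (a - d + z) ^+ 2 = 3 * (a ^+ 2 + d ^+ 2 + z ^+ 2)
    - (a + d) ^+ 2 - (a - z) ^+ 2 - (d + z) ^+ 2 by lra.
  by ring.
have := sqr_ge0 a; lra.
Qed.

(** The mean is corrected with a multiple of [x * (1 - x)], which is small since
    the means of close functions are close. *)
Lemma H10_dense_mean g : L2 g -> forall eps, 0 < eps -> exists k k',
  [/\ H1_deriv k k', k 0 = 0, k 1 = 0, int01 k = int01 g &
      int01 (fun x => (g x - k x) ^+ 2) < eps].
Proof.
move=> hg eps eps0.
pose bump (x : R) := x * (1 + (-1) * x).
have H1b : H1 bump.
  by apply: H1M; [exact: H1_id|apply: H1D; [exact: H1_cst|apply: H1Z; exact: H1_id]].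
have lb := H1_L2 H1b; have ib := L2_integr lb.
pose J := int01 bump.
have J0 : J != 0.
  apply/eqP => /(cont_int01_eq0 (H1_cont H1b)) Jz.
  have : bump 2^-1 = 0.
    by apply: Jz => [x x01|]; [rewrite /bump; case/andP: x01 => *; rewrite mulr_ge0 //|]; lra.
  by rewrite /bump; lra.
pose B := int01 (fun x => bump x ^+ 2).
have B0 : 0 <= B by apply: int01_ge0 => x _; exact: sqr_ge0.
pose K := 2 + 2 * (B / J ^+ 2).
have K0 : 0 < K by rewrite ltr_wpDr // mulr_ge0 // divr_ge0 // sqr_ge0.
have [k [hk k0 k1 gk]] := H10_dense hg (divr_gt0 eps0 K0).
have lk := H1_L2 hk; have lgk := L2B hg lk.
pose dlt := int01 (fun x => g x - k x).
have dE : dlt = int01 g - int01 k by rewrite /dlt int01B //; exact: L2_integr.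
have d2 := sqr_int01_le lgk.
pose k2 x := k x + (dlt / J) * bump x.
have [k2' hk2] : H1 k2 by apply: H1D => //; exact: H1Z.
exists k2, k2'; split => //.
- by rewrite /k2 /bump k0 mul0r mulr0 addr0.
- by rewrite /k2 /bump k1 mulN1r subrr !mulr0 addr0.
- rewrite /k2 (int01D (L2_integr lk) (integrZ _ ib)) (int01Z _ ib) -/J divfK //.
  by rewrite dE addrC subrK.
have := int01_sqrD_le lgk (L2Z (- (dlt / J)) lb).
rewrite (@eq_int01 _ _ (fun x => (g x - k2 x) ^+ 2)); last by move=> x _; rewrite /k2; ring.
move=> h; apply: le_lt_trans h _.
rewrite (@eq_int01 _ (fun x => (_ * _) ^+ 2) (fun x => (dlt / J) ^+ 2 * bump x ^+ 2));
  last by move=> x _; ring.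
rewrite (int01Z _ (L2_sqr lb)) -/B.
set Q := int01 _ in gk d2 *.
have -> : (dlt / J) ^+ 2 * B = B / J ^+ 2 * dlt ^+ 2 by field.
rewrite ltr_pdivlMr // in gk.
have : B / J ^+ 2 * dlt ^+ 2 <= B / J ^+ 2 * Q.
  by rewrite ler_wpM2l // divr_ge0 // sqr_ge0.
rewrite /K in gk; lra.
Qed.

(** Replace the derivative of [u] by an H^1 function that vanishes at both ends
    and has the same mean: its primitive keeps both end values of [u]. *)
Lemma edge_dense u v : H1 u -> L2 v -> forall eps, 0 < eps ->
  exists uu : (R -> R) * (R -> R) * (R -> R) * (R -> R),
  let: (u', g', g'', v') := uu in
  [/\ [/\ H1_deriv u' g', H1_deriv g' g'' & H1 v'],
      u' 0 = u 0 /\ u' 1 = u 1, g' 0 = 0 /\ g' 1 = 0, v' 0 = 0 /\ v' 1 = 0 &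
      int01 (fun x => (u x - u' x) ^+ 2) +
      int01 (fun x => (weak_deriv u x - g' x) ^+ 2) +
      int01 (fun x => (v x - v' x) ^+ 2) < eps].
Proof.
move=> hu hv eps eps0; have e3 : 0 < eps / 3 by rewrite divr_gt0.
have hu' := weak_derivP hu; have [_ lg _] := hu'; have [ig pu] := H1_primitive hu'.
have [g' [g'' [hg' g'0 g'1 gE gg']]] := H10_dense_mean lg e3.
have [v' [hv' v'0 v'1 vv']] := H10_dense hv e3.
have lg' : L2 g' by apply: H1_L2; exists g''.
have ig' := L2_integr lg'.
pose u' x := u 0 + int0 g' x.
have pu' : primitive u' g'.
  by split=> // x x01; rewrite /u' int0_0 addr0.
have hu'1 := primitive_H1 lg' pu'.
have x1 : 0 <= (1 : R) <= 1 by rewrite ler01 lexx.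
exists (u', g', g'', v'); split=> //.
  by split; [rewrite /u' int0_0 addr0|rewrite (pu 1 x1) /u' !int0_1 gE].
have : int01 (fun x => (u x - u' x) ^+ 2) <=
       int01 (fun x => (weak_deriv u x - g' x) ^+ 2).
  rewrite -[leRHS]int01_cst; apply: le_int01.
  - by apply: L2_sqr; apply: L2B; apply: H1_L2 => //; exists g'.
  - exact: integr_cst.
  move=> x x01; apply: le_trans (sqr_int0_le (L2B lg lg') x01).
  rewrite (pu x x01) /u' (@eq_int0 _ (fun t => weak_deriv u t - g' t)
    (fun t => weak_deriv u t + -1 * g' t)) //; last first.
    by move=> t _; rewrite mulN1r.
  by rewrite (int0D ig (integrZ _ ig')) // (int0Z _ ig') // opprD addrACA subrr add0r mulN1r.
lra.
Qed.

End Approximation.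

(** * States of the network *)

Section States.
Context (R : realType) (V : finType) (e : rel V) (r : V).
Context (c : {set V} -> R).
Implicit Types (U W Z : state R V) (i n : V) (a h t : R) (u f g : R -> R).

Local Notation mu := (@lebesgue_measure R).
Local Notation I01 := (`[0 : R, 1 : R]%classic : set R).
Local Notation integr f := (mu.-integrable I01 (EFin \o f)).
Local Notation int01 f := (Rintegral mu I01 f).
Local Notation I_ n := (out_edges e r n).
Local Notation c_ i := (speed e c r i).
Local Notation nrm := (normH r).

Definition regular i U : Prop := H1 (U.1 i) /\ L2 (U.2 i).

Definition edge_norm i U : R :=
  int01 (fun x => U.1 i x ^+ 2) + int01 (fun x => weak_deriv (U.1 i) x ^+ 2) +
  int01 (fun x => U.2 i x ^+ 2).

Definition sqnorm U : R := \sum_(i | i != r) edge_norm i U.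

Lemma edge_norm_ge0 i U : 0 <= edge_norm i U.
Proof. by rewrite !addr_ge0 //; apply: int01_ge0 => x _; exact: sqr_ge0. Qed.

Lemma sqnorm_ge0 U : 0 <= sqnorm U.
Proof. by apply: sumr_ge0 => i _; exact: edge_norm_ge0. Qed.

Lemma normHE U : nrm U = Num.sqrt (sqnorm U). Proof. by []. Qed.

Lemma sqr_normH U : nrm U ^+ 2 = sqnorm U.
Proof. by rewrite normHE sqr_sqrtr // sqnorm_ge0. Qed.

Lemma edge_norm_le i U : i != r -> edge_norm i U <= sqnorm U.
Proof.
move=> ir; rewrite /sqnorm (bigD1 i) //= lerDl.
by apply: sumr_ge0 => j _; exact: edge_norm_ge0.
Qed.

Lemma state_lin1 a U W i :
  (a *: U + W).1 i = (fun x : R => a * (U.1 i x : R) + (W.1 i x : R)).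
Proof. by case: U => U1 U2; case: W => W1 W2; cbn [fst snd]; apply/funext. Qed.

Lemma state_lin2 a U W i :
  (a *: U + W).2 i = (fun x : R => a * (U.2 i x : R) + (W.2 i x : R)).
Proof. by case: U => U1 U2; case: W => W1 W2; cbn [fst snd]; apply/funext. Qed.

Lemma regular_lin i a U W : regular i U -> regular i W -> regular i (a *: U + W).
Proof.
move=> [U1 U2] [W1 W2]; rewrite /regular state_lin1 state_lin2; split.
  exact: H1D (H1Z a U1) W1.
exact: L2D (L2Z a U2) W2.
Qed.

Lemma weak_deriv_lin i a U W : regular i U -> regular i W ->
  ae_eq mu I01 (weak_deriv ((a *: U + W).1 i))
    (fun x => a * weak_deriv (U.1 i) x + weak_deriv (W.1 i) x).
Proof.
move=> [U1 _] [W1 _]; rewrite state_lin1.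
exact: weak_derivE (H1_derivD (H1_derivZ a (weak_derivP U1)) (weak_derivP W1)).
Qed.

Lemma L2_weak_deriv u : H1 u -> L2 (weak_deriv u).
Proof. by move=> /weak_derivP[]. Qed.

Lemma int01_sqr_lin a f g : L2 f -> L2 g ->
  int01 (fun x => (a * f x + g x) ^+ 2) <=
  2 * a ^+ 2 * int01 (fun x => f x ^+ 2) + 2 * int01 (fun x => g x ^+ 2).
Proof.
move=> hf hg; apply: le_trans (int01_sqrD_le (L2Z a hf) hg) _.
rewrite lerD2r -mulrA ler_wpM2l // -int01Z; last exact: L2_sqr.
by rewrite (@eq_int01 _ _ (fun x => a ^+ 2 * f x ^+ 2)) // => x _; ring.
Qed.

Lemma ae_int01_sqr f g : L2 f -> L2 g -> ae_eq mu I01 f g ->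
  int01 (fun x => f x ^+ 2) = int01 (fun x => g x ^+ 2).
Proof.
move=> hf hg fg; apply: ae_int01.
- exact: L2_sqr.
- by apply: integr_meas; exact: L2_sqr.
- by apply: filterS fg => x h Ix; rewrite h.
Qed.

Lemma edge_norm_lin i a U W : regular i U -> regular i W ->
  edge_norm i (a *: U + W) <= 2 * a ^+ 2 * edge_norm i U + 2 * edge_norm i W.
Proof.
move=> hU hW; have [[U1 U2] [W1 W2]] := (hU, hW).
have [LU LW] := (H1_L2 U1, H1_L2 W1).
have [dU dW] := (L2_weak_deriv U1, L2_weak_deriv W1).
have sum3 (k x1 x2 x3 y1 y2 y3 z1 z2 z3 : R) : x1 <= k * y1 + 2 * z1 ->
    x2 <= k * y2 + 2 * z2 -> x3 <= k * y3 + 2 * z3 ->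
    x1 + x2 + x3 <= k * (y1 + y2 + y3) + 2 * (z1 + z2 + z3) by lra.
have wE : int01 (fun x => weak_deriv ((a *: U + W).1 i) x ^+ 2) =
    int01 (fun x => (a * weak_deriv (U.1 i) x + weak_deriv (W.1 i) x) ^+ 2).
  apply: ae_int01_sqr; last exact: weak_deriv_lin.
  - by apply: L2_weak_deriv; case: (regular_lin a hU hW).
  - by apply: L2D => //; exact: L2Z.
rewrite /edge_norm wE state_lin1 state_lin2.
apply: sum3; exact: int01_sqr_lin.
Qed.

(** The Riemann invariants of the edge [i]: for [s = true] the one that travels
    towards the root, for [s = false] the one that travels away from it. *)
Definition riemann (s : bool) i U (x : R) : R :=
  U.2 i x + sgn R s * c_ i * weak_deriv (U.1 i) x.

Lemma riemann_L2 s i U : regular i U -> L2 (riemann s i U).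
Proof. by move=> [U1 U2]; apply: L2D => //; apply: L2Z; exact: L2_weak_deriv. Qed.

Lemma riemann_lin s i a U W : regular i U -> regular i W ->
  ae_eq mu I01 (riemann s i (a *: U + W))
    (fun x => a * riemann s i U x + riemann s i W x).
Proof.
move=> hU hW; have := weak_deriv_lin a hU hW.
by apply: filterS => x h Ix; rewrite /riemann h // state_lin2; ring.
Qed.

Lemma riemann_le s i U : regular i U ->
  int01 (fun x => riemann s i U x ^+ 2) <= 2 * (1 + c_ i ^+ 2) * edge_norm i U.
Proof.
move=> [U1 U2]; have dU := L2_weak_deriv U1.
rewrite (@eq_int01 _ _ (fun x => (sgn R s * c_ i * weak_deriv (U.1 i) x + U.2 i x) ^+ 2));
  last by move=> x _; rewrite addrC.
apply: le_trans (int01_sqr_lin _ dU U2) _.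
have -> : (sgn R s * c_ i) ^+ 2 = c_ i ^+ 2.
  by rewrite exprMn /sgn; case: s; rewrite ?sqrrN expr1n mul1r.
rewrite /edge_norm; set A := int01 _; set B := int01 _; set C := int01 _.
have A0 : 0 <= A by apply: int01_ge0 => x _; exact: sqr_ge0.
have B0 : 0 <= B by apply: int01_ge0 => x _; exact: sqr_ge0.
have C0 : 0 <= C by apply: int01_ge0 => x _; exact: sqr_ge0.
have := sqr_ge0 (c_ i); set k := c_ i ^+ 2 => k0.
have := mulr_ge0 k0 B0; have := mulr_ge0 k0 C0; have := mulr_ge0 k0 A0; lra.
Qed.

End States.

Section Dynamics.
Context (R : realType) (V : finType) (e : rel V) (r : V).
Context (c : {set V} -> R) (alpha : V -> R) (b : root_condition).
Context (S : R -> state R V -> state R V).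
Hypothesis S_semigroup : network_semigroup e r c alpha b S.
Implicit Types (U W Z : state R V) (i n : V) (a h t : R) (u f g : R -> R).

Local Notation mu := (@lebesgue_measure R).
Local Notation I01 := (`[0 : R, 1 : R]%classic : set R).
Local Notation int01 f := (Rintegral mu I01 f).
Local Notation I_ n := (out_edges e r n).
Local Notation c_ i := (speed e c r i).
Local Notation H := (phase_space e r b).
Local Notation A := (wave_operator e r c alpha b).
Local Notation sqn := (sqnorm r).

Lemma phase_spaceH U : H U -> spaceH e r U.
Proof. by case: b => //= -[]. Qed.

Lemma phase_regular i U : H U -> i != r -> regular i U.
Proof. by move=> /phase_spaceH[reg _] /reg. Qed.

Lemma phase_lin a U W : H U -> H W -> H (a *: U + W).
Proof.
have lin U' W' : spaceH e r U' -> spaceH e r W' -> spaceH e r (a *: U' + W').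
  move=> [rU cU] [rW cW]; split=> [i ir|n i ni ii].
    by apply: regular_lin; [exact: rU|exact: rW].
  by rewrite !state_lin1 (cU n i) // (cW n i).
case: b => /=; [|exact: lin|exact: lin].
move=> [hU U0] [hW W0]; split=> [|i ii]; first exact: lin.
by rewrite state_lin1 U0 // W0 // mulr0 addr0.
Qed.

Lemma sqnorm_lin a U W : H U -> H W ->
  sqn (a *: U + W) <= 2 * a ^+ 2 * sqn U + 2 * sqn W.
Proof.
move=> hU hW; rewrite /sqnorm !mulr_sumr -big_split /=.
by apply: ler_sum => i ir; apply: edge_norm_lin; exact: phase_regular.
Qed.

End Dynamics.

(** * Rooted trees *)

Section RootedTree.
Local Close Scope classical_set_scope.
Context (V : finType) (e : rel V).
Hypothesis treeT : is_tree e.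
Implicit Types (r n i j x y : V).

Let e_sym x y : e x y = e y x. Proof. by case: treeT => h _ _ _; exact: h. Qed.

Let e_irr x : e x x = false. Proof. by case: treeT => _ h _ _; exact: h. Qed.

Definition without_edge x y : rel V :=
  [rel a b | e a b && ~~ ((a == x) && (b == y) || (a == y) && (b == x))].

(** A simple path between [x] and [y] that does not use the edge would close up
    to a cycle with it. *)
Lemma tree_bridge x y : e x y -> ~~ connect (without_edge x y) x y.
Proof.
case: treeT => _ _ _ acyclic exy; apply/negP => /connectP[p0 pth lst].
case/shortenP: pth lst => p pth uniq_p _ lst.
have pe : path e x p by apply: sub_path pth => a b /andP[].
have : ucycleb e (x :: p) by rewrite /ucycleb uniq_p andbT /= rcons_path pe /= -lst e_sym.
apply/negP/acyclic; case: p pth pe lst {uniq_p} => [|a [|b p]] //=.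
  by move=> _ _ yx; move: exy; rewrite yx e_irr.
by move=> /andP[/andP[_ +] _] _ yx; rewrite yx !eqxx.
Qed.

Lemma avoiding_sym i x y : connect (avoiding e i) x y = connect (avoiding e i) y x.
Proof.
apply: (@sym_connect_sym _ (avoiding e i)) => a b; rewrite /avoiding /=.
by rewrite e_sym; congr (_ && _); rewrite andbC.
Qed.

Lemma avoiding_without_edge i n : subrel (connect (avoiding e i)) (connect (without_edge n i)).
Proof.
apply: connect_sub => a b /and3P[ab ai bi]; apply: connect1.
by rewrite /without_edge /= ab /= (negbTE ai) (negbTE bi) andbF.
Qed.

Lemma without_edge_sym x y : connect_sym (without_edge x y).
Proof.
by apply: sym_connect_sym => a b; rewrite /without_edge /= e_sym; congr (_ && ~~ _); rewrite orbC
  [(a == x) && _]andbC [(a == y) && _]andbC.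
Qed.

Lemma directed_neq_root r n i : directed e r n i -> i != r.
Proof.
move=> /andP[eni /connectP[[_ /= rn|a p /= /andP[/and3P[_ ri _] _] _]]].
  by apply: contraTneq eni => ->; rewrite rn e_irr.
by rewrite eq_sym.
Qed.

Lemma avoiding_path i x p : path e x p -> i \notin x :: p ->
  connect (avoiding e i) x (last x p).
Proof.
move=> pth ip; apply/connectP; exists p => //; elim: p x pth ip => //= a p IH x.
move=> /andP[xa pth]; rewrite !inE !negb_or => /and3P[ix ia ip].
rewrite /avoiding /= xa eq_sym ix eq_sym ia /=.
by apply: IH => //; rewrite inE negb_or ia.
Qed.

(** Follow a simple path from [r] to [x]: if it meets [y], its part up to [y]
    does not meet [x]. *)
Lemma directed_total r x y : e x y -> directed e r x y \/ directed e r y x.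
Proof.
move=> exy; case: treeT => _ _ conn _.
have /connectP[p0 pth lst] := conn r x.
case/shortenP: pth lst => p pth uniq_p _ lst.
have [yp|yp] := boolP (y \in r :: p); last first.
  by left; rewrite /directed exy lst; exact: avoiding_path.
right; rewrite /directed e_sym exy /=.
have xp : x \in r :: p by rewrite lst mem_last.
case/splitPl: yp pth uniq_p lst xp => p1 p2 ly.
rewrite cat_path last_cat -cat_cons cat_uniq => /andP[pth _] /and3P[_ disj _] lst _.
have xp1 : x \notin r :: p1.
  case: p2 lst disj => [/= xy _|a p2 lst disj]; first by move: exy; rewrite xy ly e_irr.
  apply: contra disj => xp1; apply/hasP; exists x => //; rewrite lst /=; exact: mem_last.
by rewrite -ly; exact: avoiding_path.
Qed.

(** Otherwise [n] and [i] would be connected through [r] and [m], without the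
    edge between them. *)
Lemma directed_unique r n m i : directed e r n i -> directed e r m i -> n = m.
Proof.
move=> /andP[eni rn] /andP[emi rm]; apply/eqP/negPn/negP => nm.
apply: (negP (tree_bridge eni)).
apply: (@connect_trans _ _ m).
  by apply: avoiding_without_edge; apply: connect_trans rm; rewrite avoiding_sym.
apply: connect1; rewrite /without_edge /= emi /= [m == n]eq_sym (negbTE nm) /=.
by apply: contraTN emi => /andP[/eqP -> _]; rewrite e_irr.
Qed.

Lemma directed_asym r x y : directed e r x y -> ~~ directed e r y x.
Proof.
move=> /andP[exy rx]; apply/negP => /andP[eyx ry].
apply: (negP (tree_bridge exy)); apply: (@connect_trans _ _ r).
  by rewrite without_edge_sym; exact: avoiding_without_edge.
have := avoiding_without_edge y ry; apply: connect_sub => a b /= h.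
by apply: connect1; move: h; rewrite /without_edge /= orbC.
Qed.

Lemma directed_exists r i : i != r -> exists n, directed e r n i.
Proof.
case: treeT => _ _ conn _ ir; have /connectP[p0 pth lst] := conn r i.
case/shortenP: pth lst => p; case/lastP: p => [_ _ _ /= ri|p j]; first by rewrite ri eqxx in ir.
rewrite rcons_path last_rcons -rcons_cons rcons_uniq => /andP[pth ej] /andP[jp _] _ ij.
by subst j; exists (last r p); rewrite /directed ej avoiding_path.
Qed.

Lemma parentE r n i : directed e r n i -> parent e r i = n.
Proof.
move=> ni; rewrite /parent; case: pickP => [m mi|/(_ n)]; last by rewrite ni.
exact: directed_unique mi ni.
Qed.

Lemma directed_parent r i : i != r -> directed e r (parent e r i) i.
Proof. by move=> /(directed_exists (r := r))[n ni]; rewrite (parentE ni). Qed.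

Lemma degreeE n : degree e n = #|[set m | e n m]|.
Proof.
by apply: eq_card => m; rewrite [RHS]inE; apply/idP/idP => [/set_mem|/mem_set].
Qed.

Lemma directed_root r j : e r j -> directed e r r j.
Proof. by move=> erj; rewrite /directed erj connect0. Qed.

Lemma two_neighbours n x y : e n x -> e n y -> x != y -> multiple_node e n.
Proof.
move=> nx ny xy; rewrite /multiple_node degreeE.
have <- : #|[set x; y]| = 2%N by rewrite cards2 xy.
apply: subset_leq_card; apply/fintype.subsetP => z.
by rewrite !inE => /orP[] /eqP ->.
Qed.

Lemma simple_not_multiple n : simple_node e n -> ~~ multiple_node e n.
Proof. by rewrite /simple_node /multiple_node => /eqP ->. Qed.

Lemma directed_edge r n i : directed e r n i -> e n i. Proof. by case/andP. Qed.

Lemma inner_multiple r n i : n != r -> directed e r n i -> multiple_node e n.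
Proof.
move=> /directed_parent pn ni; apply: (two_neighbours (directed_edge ni)).
  by rewrite e_sym; exact: directed_edge pn.
by apply: contraNneq (directed_asym ni) => ->.
Qed.

Lemma childless_simple r n : n != r -> (forall i, ~~ directed e r n i) -> simple_node e n.
Proof.
move=> /directed_parent pn nochild; rewrite /simple_node degreeE.
rewrite -(cards1 (parent e r n)); apply/eqP/eq_card => m.
rewrite !inE; apply/idP/eqP => [enm|->]; last by rewrite e_sym; exact: directed_edge pn.
case: (directed_total r enm) => [nm|mn]; first by have := nochild m; rewrite nm.
by rewrite (parentE mn).
Qed.

Lemma root_child_exists r : simple_node e r -> exists j, directed e r r j.
Proof.
rewrite /simple_node degreeE => /cards1P[j Ej]; exists j; apply: directed_root.
by have := set11 j; rewrite -Ej inE.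
Qed.

Lemma root_child_unique r i j : simple_node e r -> directed e r r i ->
  directed e r r j -> i = j.
Proof.
move=> rs /directed_edge ri /directed_edge rj; apply/eqP/negPn/negP => ij.
by have := simple_not_multiple rs; rewrite (two_neighbours ri rj ij).
Qed.

Section Times.
Context (R : realType) (c : {set V} -> R).
Hypothesis c_gt0 : forall x y, e x y -> 0 < c [set x; y]%SET.

Lemma speedE r n i : directed e r n i -> speed e c r i = c [set n; i]%SET.
Proof. by move=> ni; rewrite /speed (parentE ni). Qed.

Lemma speed_gt0 r i : i != r -> 0 < speed e c r i.
Proof. by move=> /directed_parent/directed_edge; exact: c_gt0. Qed.

Lemma speed_inv_gt0 r i : i != r -> 0 < (speed e c r i)^-1.
Proof. by move=> /speed_gt0; rewrite invr_gt0. Qed.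

Lemma child_time_le r n i : n != r -> directed e r n i ->
  (speed e c r n)^-1 + edge_time e c r i <= edge_time e c r n.
Proof.
move=> nr ni; rewrite (edge_timeE c treeT nr) lerD2l.
by apply: (@le_bigmax_cond _ _ _ _ i) => //; rewrite inE.
Qed.

Lemma edge_time_ge r i : i != r -> (speed e c r i)^-1 <= edge_time e c r i.
Proof. by move=> ir; rewrite (edge_timeE c treeT ir) lerDl bigmax_ge_id. Qed.

Lemma edge_time_gt0 r i : i != r -> 0 < edge_time e c r i.
Proof. by move=> ir; apply: lt_le_trans (speed_inv_gt0 ir) (edge_time_ge ir). Qed.

Lemma child_time_lt r n i : n != r -> directed e r n i ->
  edge_time e c r i < edge_time e c r n.
Proof.
by move=> nr ni; apply: lt_le_trans (child_time_le nr ni); rewrite ltrDr speed_inv_gt0.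
Qed.

(** The times strictly decrease from an edge to the following ones, hence serve
    as a rank for inductions in both directions. *)
Lemma leaves_to_root_ind r (P : V -> Prop) :
  (forall n, n != r -> (forall i, directed e r n i -> P i) -> P n) ->
  forall n, n != r -> P n.
Proof.
move=> step n; have [m] := ubnP #|[set k | edge_time e c r k < edge_time e c r n]|.
elim: m n => // m IH n; rewrite ltnS => nm nr; apply: step => // i ni.
apply: IH (directed_neq_root ni); apply: leq_trans nm; apply: proper_card.
have lt_in := child_time_lt nr ni; apply/properP; split.
  by apply/fintype.subsetP => k; rewrite !inE => /lt_trans; apply.
by exists i; rewrite inE // ltxx.
Qed.

Lemma root_to_leaves_ind r (P : V -> Prop) :
  (forall i, directed e r r i -> P i) ->
  (forall n i, n != r -> directed e r n i -> P n -> P i) ->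
  forall i, i != r -> P i.
Proof.
move=> root step i; have [m] := ubnP #|[set k | edge_time e c r i < edge_time e c r k]|.
elim: m i => // m IH i; rewrite ltnS => im ir.
have pari := directed_parent ir; have [nr|nr] := eqVneq (parent e r i) r.
  by apply: root; move: pari; rewrite nr.
have lt_ip := child_time_lt nr pari; apply: (step _ _ nr pari); apply: (IH _ _ nr).
apply: leq_trans im; apply: proper_card; apply/properP; split.
  by apply/fintype.subsetP => k; rewrite !inE => h; apply: lt_trans h.
by exists (parent e r i); rewrite inE // ltxx.
Qed.

Lemma edge_time_le_root_time r i : i != r -> edge_time e c r i <= root_time e c r.
Proof.
move: i; apply: root_to_leaves_ind => [i ri|n i nr ni]; last first.
  by apply: le_trans; apply: ltW; exact: child_time_lt.
by apply: (@le_bigmax_cond _ _ _ _ i) => //; rewrite inE.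
Qed.

Lemma root_time_le_tree_time r : simple_node e r -> root_time e c r <= tree_time e c.
Proof. by move=> rs; apply: (@le_bigmax_cond _ _ _ _ r). Qed.

Lemma root_timeE r j : simple_node e r -> directed e r r j ->
  root_time e c r = edge_time e c r j.
Proof.
move=> rs rj; apply/eqP; rewrite eq_le edge_time_le_root_time ?(directed_neq_root rj) // andbT.
apply: bigmax_le => [|i]; first by rewrite ltW // edge_time_gt0 ?(directed_neq_root rj).
by rewrite inE => ri; rewrite (root_child_unique rs ri rj).
Qed.

(** Take [y] as root: among the nodes on the side of [x], one of least time has no
    following edge, hence is external. *)
Lemma leaf_beyond x y : e x y -> exists r, simple_node e r /\ directed e r x y.
Proof.
move=> exy; have xy : x != y by apply: contraTneq exy => ->; rewrite e_irr.
pose D := [pred z | connect (avoiding e y) x z & z != y].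
have Dx : D x by rewrite /= connect0.
have [z /andP[xz zy] zmin] := arg_minP (edge_time e c y) Dx.
exists z; split; last by rewrite /directed exy avoiding_sym.
apply: (childless_simple zy) => i; apply/negP => zi.
have iy := directed_neq_root zi.
have : D i.
  rewrite /= iy andbT; apply: connect_trans xz (connect1 _).
  by rewrite /avoiding /= (directed_edge zi) zy iy.
by move=> /zmin; rewrite leNgt (child_time_lt zy zi).
Qed.

End Times.
End RootedTree.

(** * Solutions with data in the domain of the generator *)

Section Waves.
Context (R : realType) (V : finType) (e : rel V) (r : V).
Context (c : {set V} -> R) (alpha : V -> R) (b : root_condition).
Context (S : R -> state R V -> state R V).
Hypothesis S_semigroup : network_semigroup e r c alpha b S.
Implicit Types (U W Z : state R V) (i n : V) (a h t : R) (u f g : R -> R).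

Local Notation mu := (@lebesgue_measure R).
Local Notation I01 := (`[0 : R, 1 : R]%classic : set R).
Local Notation int01 f := (Rintegral mu I01 f).
Local Notation I_ n := (out_edges e r n).
Local Notation c_ i := (speed e c r i).
Local Notation H := (phase_space e r b).
Local Notation A := (wave_operator e r c alpha b).
Local Notation nrm := (normH r).

Let S_C0 : C0_semigroup H nrm S. Proof. by case: S_semigroup. Qed.

Let S_gen : generated_by H nrm S A. Proof. by case: S_semigroup. Qed.

Lemma normH_ge0 U : 0 <= nrm U. Proof. exact: sqrtr_ge0. Qed.

Lemma normH_lin a U W : H U -> H W ->
  nrm (a *: U + W) ^+ 2 <= 2 * a ^+ 2 * nrm U ^+ 2 + 2 * nrm W ^+ 2.
Proof. by move=> hU hW; rewrite !sqr_normH; exact: (@sqnorm_lin _ _ e _ b). Qed.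

Lemma wave_phase t U : 0 <= t -> H U -> H (S t U).
Proof. exact: (@S_phase R (state R V) H nrm S S_C0). Qed.

Lemma wave_domain_invariant t U W : 0 <= t -> H U -> H W -> A U W -> A (S t U) (S t W).
Proof.
exact: (@domain_invariant R (state R V) H nrm S A normH_ge0
  (@phase_lin _ _ _ _ _) normH_lin S_C0 S_gen).
Qed.

Lemma wave_cont t0 U : 0 <= t0 -> H U -> forall eps, 0 < eps -> exists2 d, 0 < d &
  forall t, 0 <= t -> `|t - t0| < d -> nrm (S t U - S t0 U) ^+ 2 < eps.
Proof. exact: (@S_cont R (state R V) H nrm S normH_ge0 S_C0). Qed.

Lemma wave_right_derivative t U W : 0 <= t -> H U -> H W -> A U W ->
  forall eps, 0 < eps -> exists2 d, 0 < d & forall h, 0 < h < d ->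
    nrm (h^-1 *: (S (t + h) U - S t U) - S t W) ^+ 2 < eps.
Proof.
exact: (@right_derivative R (state R V) H nrm S A normH_ge0
  (@phase_lin _ _ _ _ _) normH_lin S_C0 S_gen).
Qed.

Lemma wave_bounded t : 0 <= t -> exists M, forall U, H U ->
  nrm (S t U) ^+ 2 <= M ^+ 2 * nrm U ^+ 2.
Proof. exact: (@S_bounded R (state R V) H nrm S normH_ge0 S_C0). Qed.

(** Functions on [0, 1] that depend linearly and continuously on the state, such
    as [u_i] and the Riemann invariants, inherit the regularity in time. *)
Section Observable.
Context (L : state R V -> R -> R) (K : R).
Hypothesis K_gt0 : 0 < K.
Hypothesis L_L2 : forall U, H U -> L2 (L U).
Hypothesis L_lin : forall a U W, H U -> H W ->
  ae_eq mu I01 (L (a *: U + W)) (fun x => a * L U x + L W x).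
Hypothesis L_le : forall U, H U -> int01 (fun x => L U x ^+ 2) <= K * nrm U ^+ 2.

Lemma observable_cont t U : 0 <= t -> H U -> forall eps, 0 < eps ->
  exists2 d, 0 < d & forall s, 0 <= s -> `|s - t| < d ->
    int01 (fun x => (L (S s U) x - L (S t U) x) ^+ 2) < eps.
Proof.
move=> t0 hU eps eps0; have [d d0 Hd] := wave_cont t0 hU (divr_gt0 eps0 K_gt0).
exists d => // s s0 /(Hd s s0); rewrite ltr_pdivlMr // mulrC => lt1.
have [hs ht] := (wave_phase s0 hU, wave_phase t0 hU).
have hD : H ((-1) *: S t U + S s U) by exact: phase_lin.
apply: le_lt_trans lt1; rewrite -[S s U - S t U]addrC -scaleN1r.
apply: le_trans (L_le hD); rewrite le_eqVlt; apply/orP; left; apply/eqP.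
apply: ae_int01_sqr; [|exact: L_L2|]; first by apply: L2B; exact: L_L2.
have := L_lin (-1) ht hs; apply: filterS => x E Ix.
by rewrite E // mulN1r addrC.
Qed.

Lemma observable_deriv t U W : 0 <= t -> H U -> H W -> A U W ->
  forall eps, 0 < eps -> exists2 d, 0 < d & forall h, 0 < h < d ->
    int01 (fun x => (h^-1 * (L (S (t + h) U) x - L (S t U) x) - L (S t W) x) ^+ 2) < eps.
Proof.
move=> t0 hU hW AUW eps eps0.
have [d d0 Hd] := wave_right_derivative t0 hU hW AUW (divr_gt0 eps0 K_gt0).
exists d => // h /[dup] /andP[h0 _] /Hd; rewrite ltr_pdivlMr // mulrC quotient_lin => lt1.
have th : 0 <= t + h by rewrite addr_ge0 // ltW.
have [[hX hY] hZ] := (wave_phase th hU, wave_phase t0 hU, wave_phase t0 hW).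
have hD : H ((-1) *: S t U + S (t + h) U) by exact: phase_lin.
have hQ := phase_lin (h^-1 - 1) hD hD; have hF := phase_lin (-1) hZ hQ.
apply: le_lt_trans lt1; apply: le_trans (L_le hF).
rewrite le_eqVlt; apply/orP; left; apply/eqP.
apply: ae_int01_sqr; [|exact: L_L2|].
  by apply: L2B; [apply: L2Z; apply: L2B|]; exact: L_L2.
have E1 := L_lin (-1) hY hX; have E2 := L_lin (h^-1 - 1) hD hD.
have E3 := L_lin (-1) hZ hQ.
apply: filterS3 E1 E2 E3 => x E1 E2 E3 Ix.
by rewrite E3 // E2 // E1 //; ring.
Qed.

End Observable.

Lemma riemann_normH s i U : i != r -> H U ->
  int01 (fun x => riemann e r c s i U x ^+ 2) <= 2 * (1 + c_ i ^+ 2) * nrm U ^+ 2.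
Proof.
move=> ir hU; apply: le_trans (riemann_le e r c s (phase_regular hU ir)) _.
by rewrite sqr_normH ler_wpM2l ?edge_norm_le // mulr_ge0 // addr_ge0 // sqr_ge0.
Qed.

Lemma position_normH i U : i != r ->
  int01 (fun x => U.1 i x ^+ 2) <= 1 * nrm U ^+ 2.
Proof.
move=> ir; rewrite mul1r sqr_normH; apply: le_trans (edge_norm_le U ir).
rewrite /edge_norm -addrA lerDl addr_ge0 //; apply: int01_ge0 => x _; exact: sqr_ge0.
Qed.

Lemma position_L2 i U : i != r -> H U -> L2 (U.1 i).
Proof. by move=> ir hU; apply: H1_L2; case: (phase_regular hU ir). Qed.

Lemma riemann_extinction s i U W tau : i != r -> 0 < c_ i -> 0 <= tau ->
  H U -> H W -> A U W ->
  (forall t, tau <= t -> exists P Px,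
    [/\ H1_deriv P Px, ae_eq mu I01 (riemann e r c s i (S t U)) P,
        ae_eq mu I01 (riemann e r c s i (S t W)) (fun x => sgn R s * c_ i * Px x) &
        P s%:R = 0]) ->
  forall t, tau + (c_ i)^-1 < t -> ae_eq mu I01 (riemann e r c s i (S t U)) (cst 0).
Proof.
move=> ir ci tau0 hU hW AUW prof t tt.
have K0 : 0 < 2 * (1 + c_ i ^+ 2) by rewrite mulr_gt0 // ltr_wpDr // sqr_ge0.
have LL2 X : H X -> L2 (riemann e r c s i X).
  by move=> hX; apply: riemann_L2; exact: phase_regular hX ir.
have Llin a X Y : H X -> H Y -> ae_eq mu I01 (riemann e r c s i (a *: X + Y))
    (fun x => a * riemann e r c s i X x + riemann e r c s i Y x).
  by move=> hX hY; exact: (riemann_lin _ _ _ _ _ (phase_regular hX ir) (phase_regular hY ir)).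
have Lle X : H X -> int01 (fun x => riemann e r c s i X x ^+ 2) <=
    2 * (1 + c_ i ^+ 2) * nrm X ^+ 2 by exact: riemann_normH.
apply: (@extinction R s (c_ i) tau (fun t => riemann e r c s i (S t U))
  (fun t => riemann e r c s i (S t W))) => //.
- move=> u tu; have u0 := le_trans tau0 tu.
  by split; apply: LL2; exact: wave_phase.
- move=> u tu eps eps0; have u0 := le_trans tau0 tu.
  have [d d0 Hd] := observable_cont K0 LL2 Llin Lle u0 hU eps0.
  by exists d => // v tv; apply: Hd; exact: le_trans tv.
- move=> u tu eps eps0; have u0 := le_trans tau0 tu.
  exact: (observable_deriv K0 LL2 Llin Lle u0 hU hW AUW eps0).
Qed.

(** Zero decay rate: the energy of [u_i - u_i(tau)] does not increase. *)
Lemma position_stationary i U W tau : i != r -> 0 <= tau ->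
  H U -> H W -> A U W ->
  (forall t, tau <= t -> {in `[0, 1], (S t W).1 i =1 cst 0}) ->
  forall t, tau <= t -> {in `[0, 1], (S t U).1 i =1 (S tau U).1 i}.
Proof.
move=> ir tau0 hU hW AUW Wz t tt.
have LL2 (X : state R V) : H X -> L2 (X.1 i : R -> R) by move=> hX; exact: (position_L2 ir hX).
have Llin a (X Y : state R V) : H X -> H Y -> ae_eq mu I01 ((a *: X + Y).1 i : R -> R)
    (fun x => a * (X.1 i x : R) + (Y.1 i x : R)).
  by move=> hX hY; rewrite state_lin1; apply: aeW => x _.
have Lle (X : state R V) : H X -> int01 (fun x => (X.1 i x : R) ^+ 2) <= 1 * nrm X ^+ 2.
  by move=> _; exact: position_normH.
pose p (u x : R) : R := ((S u U).1 i x : R) - ((S tau U).1 i x : R).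
have hst (u : R) : tau <= u -> H (S u U) by move=> tu; apply: wave_phase => //; exact: le_trans tu.
pose q (u x : R) : R := (S u W).1 i x.
pose one (x : R) : R := 1.
have sub3 (x y z : R) : x - z - (y - z) = x - y by ring.
have c1 : {within I01, continuous one} by apply: continuous_subspaceT => x; exact: cvg_cst.
have : int01 (fun x => one x * p t x ^+ 2) <=
    expR (- (0 * (t - tau))) * int01 (fun x => one x * p tau x ^+ 2).
  apply: (@energy_decay R p q one 0 tau 1) => //.
  - by move=> x _; rewrite /one ler01 lexx.
  - move=> u tu; split; first by apply: L2B; apply: LL2; exact: hst.
    by apply: LL2; apply: wave_phase => //; exact: le_trans tu.
  - move=> u tu eps eps0; have u0 := le_trans tau0 tu.
    have [d d0 Hd] := observable_cont ltr01 LL2 Llin Lle u0 hU eps0.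
    exists d => // v tv vu; have := Hd v (le_trans tau0 tv) vu.
    by congr (_ < _); apply: eq_int01 => x _; rewrite /p sub3.
  - move=> u tu eps eps0; have u0 := le_trans tau0 tu.
    have [d d0 Hd] := observable_deriv ltr01 LL2 Llin Lle u0 hU hW AUW eps0.
    by exists d => // h /Hd; congr (_ < _); apply: eq_int01 => x _; rewrite /p /q sub3.
  - move=> u tu; rewrite (@eq_int01 _ _ (fun=> 0)); last first.
      by move=> x xI; rewrite /q (Wz u tu x xI) /= !mulr0.
    by rewrite int01_cst mul0r mulr0 oppr0.
rewrite (@eq_int01 _ (fun x => one x * p tau x ^+ 2) (fun=> 0)); last first.
  by move=> x _; rewrite /p subrr expr0n mulr0.
rewrite int01_cst mulr0 => Ele0.
have cp : {within I01, continuous (p t)}.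
  have [h1 _] := phase_regular (hst t tt) ir; have [h2 _] := phase_regular (hst tau (lexx _)) ir.
  by move=> x; apply: cvgB; [exact: (H1_cont h1)|exact: (H1_cont h2)].
have cp2 : {within I01, continuous (fun x => one x * p t x ^+ 2)}.
  by move=> x; apply: cvgM; [exact: cvg_cst|apply: cvgM; exact: cp].
move=> x; rewrite in_itv /= => x01.
have pos y : 0 <= y <= 1 -> 0 <= one y * p t y ^+ 2 by rewrite mul1r sqr_ge0.
have E0 : int01 (fun x => one x * p t x ^+ 2) = 0.
  by apply/eqP; rewrite eq_le Ele0 int01_ge0.
have := cont_int01_eq0 cp2 pos E0 x01; rewrite mul1r => /eqP.
by rewrite sqrf_eq0 subr_eq0 => /eqP.
Qed.

End Waves.

(** * Transmission at the nodes and extinction *)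

Section Network.
Context (R : realType) (V : finType) (e : rel V) (r : V).
Context (c : {set V} -> R) (alpha : V -> R) (b : root_condition).
Context (S : R -> state R V -> state R V).
Hypothesis S_semigroup : network_semigroup e r c alpha b S.
Hypotheses (e_tree : is_tree e) (r_simple : simple_node e r).
Hypothesis c_gt0 : forall x y, e x y -> 0 < c [set x; y]%SET.
Hypothesis alphaE : forall n, multiple_node e n -> alpha n = (edges_at e r n)%:R - 2.
Implicit Types (U W Z : state R V) (i j n a : V) (t : R) (v ux : V -> R -> R).

Local Notation mu := (@lebesgue_measure R).
Local Notation I01 := (`[0 : R, 1 : R]%classic : set R).
Local Notation int01 f := (Rintegral mu I01 f).
Local Notation c_ i := (speed e c r i).
Local Notation H := (phase_space e r b).
Local Notation A := (wave_operator e r c alpha b).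
Local Notation nrm := (normH r).
Local Notation riemann := (riemann e r c).
Local Notation T := (edge_time e c).

Lemma in_out_edges n i : (i \in out_edges e r n) = directed e r n i.
Proof. by rewrite inE. Qed.

(** The continuous representative of a Riemann invariant, for [v] and [ux] as in
    [wave_operator]. *)
Definition profile s i v ux x : R := v i x + sgn R s * c_ i * ux i x.

Definition vertex_conditions v ux : Prop :=
  [/\ continuous_at_nodes e r v,
      forall n, simple_node e n -> n != r -> c_ n * ux n 1 = - v n 1,
      forall n, multiple_node e n ->
        \sum_(i in out_edges e r n) c_ i * ux i 0 - c_ n * ux n 1 = - (alpha n * v n 1) &
      b = Transparent -> forall i, directed e r r i -> c_ i * ux i 0 = v i 0].

(** The generator acts on the Riemann invariants as a transport operator. *)
Lemma domain_profile U W : A U W -> exists v ux,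
  [/\ vertex_conditions v ux, root_holds e r c b U.1 v ux,
      forall i, i != r -> H1_deriv (U.1 i) (ux i) /\ {in `[0, 1], W.1 i =1 v i} &
      forall s i, i != r -> exists Px, [/\ H1_deriv (profile s i v ux) Px,
        ae_eq mu I01 (riemann s i U) (profile s i v ux) &
        ae_eq mu I01 (riemann s i W) (fun x => sgn R s * c_ i * Px x)]].
Proof.
move=> [v [ux [uxx [edges [_ vcont] [leaf node] root WE]]]].
exists v, ux; split=> //.
- split=> // bT i ri; move: root; rewrite bT => /(_ i) /=; apply.
  by rewrite inE.
- by move=> i ir; have [hU _ _ _] := edges i ir; have [W1 _] := WE i ir.
move=> s i ir; have [hU hux hv U2] := edges i ir; have [W1 W2] := WE i ir.
have hdv := weak_derivP hv.
exists (fun x => weak_deriv (v i) x + sgn R s * c_ i * uxx i x); split.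
- exact: H1_derivD hdv (H1_derivZ (sgn R s * c_ i) hux).
- have := weak_derivE hU; apply: filterS2 U2 => x U2 Ux Ix.
  by rewrite /riemann /profile U2 // Ux.
- have vW : {in `[0, 1], v i =1 (W.1 i : R -> R)} by move=> x xI; rewrite W1.
  have := weak_derivE (H1_deriv_eq vW hdv); apply: filterS2 W2 => x W2 Wx Ix.
  rewrite /riemann W2 // Wx //.
  have : sgn R s * sgn R s = 1 by rewrite /sgn; case: (s); rewrite ?mulrNN mulr1.
  set sg := sgn R s => sg1; rewrite mulrDr addrC; congr (_ + _).
  by rewrite [RHS]mulrA mulrACA sg1 mul1r expr2.
Qed.

(** There is no wave from [a] to [n] on their common edge. The orientation of
    that edge in the tree rooted at [r] only tells which invariant is meant, so
    the notion can be used with another root in mind. *)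
Definition vanish n a U : Prop :=
  if directed e r n a then ae_eq mu I01 (riemann true a U) (cst 0)
  else ae_eq mu I01 (riemann false n U) (cst 0).

Lemma profile_vanish s i v ux U Px : H1_deriv (profile s i v ux) Px ->
  ae_eq mu I01 (riemann s i U) (profile s i v ux) ->
  ae_eq mu I01 (riemann s i U) (cst 0) ->
  forall x, 0 <= x <= 1 -> profile s i v ux x = 0.
Proof.
move=> [cP _ _] E0 E1; apply: (cont_ae0 cP).
by apply: filterS2 E0 E1 => x h1 h2 Ix; rewrite -h1 // h2.
Qed.

Section NodeTransmission.
Context (v ux : V -> R -> R) (vc : vertex_conditions v ux).
Context (n a : V) (ena : e n a).
Hypothesis incoming : forall j, e n j -> j != a ->
  if directed e r n j then profile true j v ux 0 = 0 else profile false n v ux 1 = 0.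

(** As [alpha n = k_n - 2], the wave that leaves [n] on an edge is the sum of those
    that arrive on the other edges: no wave is reflected. At an external node
    with a transparent condition this is an empty sum. *)
Lemma node_transmission : n != r \/ b = Transparent ->
  if directed e r a n then profile true n v ux 1 = 0 else profile false a v ux 0 = 0.
Proof.
have [vcont leaf node root] := vc; move=> nrT.
have sgnT : sgn R true = 1 by []. have sgnF : sgn R false = -1 by [].
have child j : n != r -> directed e r n j -> j != a -> c_ j * ux j 0 = - v n 1.
  move=> nr nj ja; have := incoming (directed_edge nj) ja; rewrite nj /profile sgnT.
  by rewrite (vcont n j) ?(inner_multiple e_tree nr nj) ?inE //; lra.
have alphaC : multiple_node e n -> alpha n = #|out_edges e r n|%:R - 1.
  by move=> nm; rewrite alphaE // /edges_at -addn1 natrD; lra.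
case: ifPn => [an|nan]; last first.
  have na : directed e r n a by case: (directed_total e_tree r ena) => // h; rewrite h in nan.
  have [nr|nr] := eqVneq n r.
    case: nrT => [|bT]; first by rewrite nr eqxx.
    have ra : directed e r r a by move: na; rewrite nr.
    by rewrite /profile sgnF mulN1r mulNr (root bT a ra) subrr.
  have nm := inner_multiple e_tree nr na.
  have pn := directed_parent e_tree nr.
  have pa : parent e r n != a.
    by apply: contraNneq (directed_asym e_tree pn) => ->.
  have enp : e n (parent e r n) by case: e_tree => es _ _ _; rewrite es (directed_edge pn).
  have := incoming enp pa; rewrite (negbTE (directed_asym e_tree pn)) /profile !sgnF => par.
  have aI : a \in out_edges e r n by rewrite in_out_edges.
  have I0 : (0 < #|out_edges e r n|)%N by apply/card_gt0P; exists a.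
  have siblings : \sum_(j in out_edges e r n | j != a) c_ j * ux j 0 =
      - ((#|out_edges e r n|%:R - 1) * v n 1).
    rewrite (eq_bigr (fun=> - v n 1)); last first.
      by move=> j /andP[nj ja]; apply: child => //; rewrite -in_out_edges.
    rewrite sumr_const.
    have -> : #|[pred j | (j \in out_edges e r n) && (j != a)]| = #|out_edges e r n|.-1.
      by rewrite (cardD1 a (out_edges e r n)) aI; apply: eq_card => j; rewrite !inE andbC.
    by rewrite -[LHS]mulr_natl -subn1 natrB // mulrN.
  have := node n nm; rewrite (bigD1 a aI) siblings alphaC // (vcont n a) //.
  by rewrite /=; set k := #|_|%:R; lra.
have nr := directed_neq_root e_tree an.
have children j : directed e r n j -> c_ j * ux j 0 = - v n 1.
  move=> nj; apply: child => //.
  by apply: contraTneq an => <-; exact: (directed_asym e_tree nj).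
rewrite /profile sgnT.
have [ns|nns] := boolP (simple_node e n); first by rewrite mul1r leaf // addrN.
have [j nj] : exists j, directed e r n j.
  apply/existsP; apply: contraNT nns; rewrite negb_exists => /forallP h.
  exact: (childless_simple e_tree nr).
have nm := inner_multiple e_tree nr nj.
have := node n nm; rewrite alphaC // (eq_bigr (fun=> - v n 1)); last first.
  by move=> i ni; apply: children; rewrite -in_out_edges.
rewrite sumr_const -[X in X - _ = _]mulr_natl; set k := #|_|%:R; lra.
Qed.

End NodeTransmission.

Section DomainSolution.
Context (U W : state R V) (hU : H U) (hW : H W) (AUW : A U W).

Let solution_profile t : 0 <= t -> exists v ux,
  [/\ vertex_conditions v ux, root_holds e r c b (S t U).1 v ux,
      forall i, i != r -> H1_deriv ((S t U).1 i) (ux i) /\ {in `[0, 1], (S t W).1 i =1 v i} &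
      forall s i, i != r -> exists Px, [/\ H1_deriv (profile s i v ux) Px,
        ae_eq mu I01 (riemann s i (S t U)) (profile s i v ux) &
        ae_eq mu I01 (riemann s i (S t W)) (fun x => sgn R s * c_ i * Px x)]].
Proof. by move=> t0; apply: domain_profile; apply: (wave_domain_invariant S_semigroup). Qed.

Let x0 : 0 <= (0 : R) <= 1. Proof. by rewrite lexx ler01. Qed.
Let x1 : 0 <= (1 : R) <= 1. Proof. by rewrite lexx ler01. Qed.

Lemma edge_speed n a : directed e r a n -> c_ n = c [set n; a]%SET.
Proof. by move=> an; rewrite (speedE e_tree c an) finset.setUC. Qed.

(** What leaves [n] for [a] is nothing as soon as nothing arrives from elsewhere;
    then the edge is void after the travel time. The strict inequality leaves
    room for a starting time [tau' > tau] at which the hypothesis holds. *)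
Lemma wave_spread n a tau : e n a -> n != r \/ b = Transparent -> 0 <= tau ->
  (forall j, e n j -> j != a -> forall t, tau < t -> vanish n j (S t U)) ->
  forall t, tau + (c [set n; a]%SET)^-1 < t -> vanish a n (S t U).
Proof.
move=> ena nrT tau0 inc t tt.
pose tau' := (tau + (t - (c [set n; a]%SET)^-1)) / 2.
have tau_lt : tau < tau' by rewrite /tau'; lra.
have tau'0 : 0 <= tau' by lra.
have tt' : tau' + (c [set n; a]%SET)^-1 < t by rewrite /tau'; lra.
have trace s : tau' <= s -> exists v ux, [/\
    if directed e r a n then profile true n v ux 1 = 0 else profile false a v ux 0 = 0 &
    forall s' i, i != r -> exists Px, [/\ H1_deriv (profile s' i v ux) Px,
        ae_eq mu I01 (riemann s' i (S s U)) (profile s' i v ux) &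
        ae_eq mu I01 (riemann s' i (S s W)) (fun x => sgn R s' * c_ i * Px x)]].
  move=> ts; have s0 : 0 <= s by lra.
  have [v [ux [vc _ _ prof]]] := solution_profile s0.
  exists v, ux; split=> //; apply: (node_transmission vc ena) => // j enj ja.
  have tls : tau < s by lra.
  have := inc j enj ja s tls; rewrite /vanish; case: ifPn => nj.
    have [Px [dP E0 _]] := prof true j (directed_neq_root e_tree nj).
    by move=> E1; apply: (profile_vanish dP E0 E1).
  have jn : directed e r j n by case: (directed_total e_tree r enj) => // h; rewrite h in nj.
  have [Px [dP E0 _]] := prof false n (directed_neq_root e_tree jn).
  by move=> E1; apply: (profile_vanish dP E0 E1).
rewrite /vanish; case: ifPn => an.
- have nr := directed_neq_root e_tree an; have cn := edge_speed an.
  apply: (riemann_extinction S_semigroup nr (speed_gt0 e_tree c_gt0 nr) tau'0 hU hW AUW);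
    last by rewrite cn.
  move=> s ts; have [v [ux [tr prof]]] := trace s ts; rewrite an in tr.
  by have [Px [dP E0 E1]] := prof true n nr; exists (profile true n v ux), Px.
- have na : directed e r n a by case: (directed_total e_tree r ena) => // h; rewrite h in an.
  have ar := directed_neq_root e_tree na; have ca := speedE e_tree c na.
  apply: (riemann_extinction S_semigroup ar (speed_gt0 e_tree c_gt0 ar) tau'0 hU hW AUW);
    last by rewrite ca.
  move=> s ts; have [v [ux [tr prof]]] := trace s ts; rewrite (negbTE an) in tr.
  by have [Px [dP E0 E1]] := prof false a ar; exists (profile false a v ux), Px.
Qed.

(** Waves that run towards the root [r'] die out edge after edge, starting from
    the other external nodes. Only a node [i != r'] is ever passed, so [r] has
    to be transparent unless it is [r'] itself. *)
Lemma drain r' : r' = r \/ b = Transparent ->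
  forall i, i != r' -> forall n, directed e r' n i ->
  forall t, T r' i < t -> vanish n i (S t U).
Proof.
move=> rT; apply: (leaves_to_root_ind e_tree c_gt0) => i ir IH n ni t Tt.
have ein : e i n by case: e_tree => es _ _ _; rewrite es (directed_edge ni).
have cE : c [set i; n]%SET = speed e c r' i by rewrite (speedE e_tree c ni) finset.setUC.
apply: (@wave_spread i n (T r' i - (speed e c r' i)^-1)) => //.
- by case: rT => [<-|]; [left|right].
- by rewrite subr_ge0 (edge_time_ge e_tree).
- move=> j eij jn s ts; have ij : directed e r' i j.
    case: (directed_total e_tree r' eij) => // ji.
    by rewrite (directed_unique e_tree ji ni) eqxx in jn.
  by apply: (IH j ij i ij); have := child_time_le e_tree c ir ij; lra.
- by rewrite cE subrK.
Qed.

Lemma downward_vanish n i t : directed e r n i -> T r i < t ->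
  ae_eq mu I01 (riemann true i (S t U)) (cst 0).
Proof.
move=> ni Tt; have := @drain r (or_introl erefl) i (directed_neq_root e_tree ni) n ni t Tt.
by rewrite /vanish ni.
Qed.

(** When the waves towards the root are gone, the root reflects nothing any more
    and the waves away from it die out in turn, from the root to the leaves.
    The time is chosen so that [child_time_le] carries it from an edge to the
    following ones. *)
Lemma reflected_drain : b <> Transparent -> forall i, i != r ->
  forall t, 2 * root_time e c r - T r i + (c_ i)^-1 < t ->
  ae_eq mu I01 (riemann false i (S t U)) (cst 0).
Proof.
move=> bT; apply: (root_to_leaves_ind e_tree c_gt0) => [i ri t|n i nr ni IH t].
  have TE := root_timeE e_tree c_gt0 r_simple ri; have ir := directed_neq_root e_tree ri.
  have T0 := edge_time_gt0 e_tree c_gt0 ir.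
  rewrite TE => tt.
  have ic := speed_inv_gt0 e_tree c_gt0 ir.
  pose tau := (T r i + (t - (c_ i)^-1)) / 2.
  have tau_lt : T r i < tau by rewrite /tau; lra.
  have tau0 : 0 <= tau by lra.
  apply: (riemann_extinction S_semigroup ir (speed_gt0 e_tree c_gt0 ir) tau0 hU hW AUW);
    last by rewrite /tau; lra.
  move=> s ts; have s0 : 0 <= s by lra.
  have [v [ux [vc root _ prof]]] := solution_profile s0.
  have [Px [dP E0 E1]] := prof false i ir; exists (profile false i v ux), Px; split=> //.
  have [Qx [dQ F0 _]] := prof true i ir.
  have sT : T r i < s by lra.
  have := profile_vanish dQ F0 (downward_vanish ri sT) x0.
  have := root i; rewrite in_out_edges => /(_ ri).
  rewrite /profile /sgn mul1r mulN1r; case: (b) bT => // _.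
    by move=> [_ ->]; lra.
  by move=> ->; rewrite !mulr0.
move=> tt; have ir := directed_neq_root e_tree ni.
have tr := edge_time_le_root_time e_tree c_gt0 nr.
have ic := speed_inv_gt0 e_tree c_gt0 nr.
have ch := child_time_le e_tree c nr ni.
have T0 := edge_time_gt0 e_tree c_gt0 nr.
have := @wave_spread n i (2 * root_time e c r - T r n + (c_ n)^-1) (directed_edge ni)
  (or_introl nr).
rewrite /vanish (negbTE (directed_asym e_tree ni)); apply.
- lra.
- move=> j enj ji s ts; rewrite /vanish; case: ifPn => [nj|_]; last exact: IH.
  by apply: (downward_vanish nj); have := child_time_le e_tree c nr nj; lra.
- rewrite -(speedE e_tree c ni); lra.
Qed.

Definition extinct_after T0 : Prop := forall t, T0 < t -> forall s i, i != r ->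
  ae_eq mu I01 (riemann s i (S t U)) (cst 0).

Lemma reflecting_extinct : b <> Transparent -> extinct_after (2 * root_time e c r).
Proof.
move=> bT t tt s i ir; have tr := edge_time_le_root_time e_tree c_gt0 ir.
have T0 := edge_time_gt0 e_tree c_gt0 ir.
case: s; first by apply: (downward_vanish (directed_parent e_tree ir)); lra.
by apply: reflected_drain => //; have := edge_time_ge e_tree c ir; lra.
Qed.

(** Each wave runs towards some external node [r']; by [drain] it has died out
    after the time of [r']. *)
Lemma transparent_extinct : b = Transparent -> extinct_after (tree_time e c).
Proof.
move=> bT t tt s i ir; have pi := directed_parent e_tree ir.
have bound r' j : simple_node e r' -> j != r' -> T r' j < t.
  move=> rs jr; apply: le_lt_trans tt; apply: le_trans (root_time_le_tree_time c rs).
  exact: edge_time_le_root_time.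
case: s; first by apply: (downward_vanish pi); exact: bound.
have eip : e i (parent e r i) by case: e_tree => es _ _ _; rewrite es (directed_edge pi).
have [r' [rs ip]] := leaf_beyond e_tree c_gt0 eip; have pr := directed_neq_root e_tree ip.
have := @drain r' (or_intror bT) _ pr _ ip t (bound _ _ rs pr).
by rewrite /vanish (negbTE (directed_asym e_tree pi)).
Qed.

(** If both invariants vanish, so do [v] and [ux]; [u] is then constant on each
    edge, and its continuity at the nodes makes the constants equal. *)
Lemma extinct_equilibrium T0 : 0 <= T0 -> extinct_after T0 ->
  forall t, T0 < t -> exists C, forall i, i != r -> forall x, 0 <= x <= 1 ->
    (S t U).1 i x = C /\ (S t W).1 i x = 0.
Proof.
move=> T00 ext t tt; have t0 : 0 <= t by lra.
have [v [ux [vc _ pos prof]]] := solution_profile t0.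
have zero i x : i != r -> 0 <= x <= 1 -> v i x = 0 /\ ux i x = 0.
  move=> ir x01; have ci := speed_gt0 e_tree c_gt0 ir.
  have [P1 [d1 E1 _]] := prof true i ir; have [P2 [d2 E2 _]] := prof false i ir.
  have := profile_vanish d1 E1 (ext t tt true i ir) x01.
  have := profile_vanish d2 E2 (ext t tt false i ir) x01.
  rewrite /profile /sgn mul1r mulN1r => h1 h2.
  have v0 : v i x = 0 by lra.
  split=> //; have /eqP : c_ i * ux i x = 0 by lra.
  by rewrite mulf_eq0 gt_eqF //= => /eqP.
have flat i x : i != r -> 0 <= x <= 1 -> (S t U).1 i x = (S t U).1 i 0.
  move=> ir x01; have [/H1_primitive[_ pu] _] := pos i ir.
  rewrite (pu x x01) (@eq_int0 _ _ (fun=> 0)) //; last first.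
    by move=> y; rewrite in_itv /= => y01; have [_ ->] := zero i y ir y01.
  by rewrite /int0 /Rintegral integral0 addr0.
have [j rj] := root_child_exists r_simple.
have St := wave_phase S_semigroup t0 hU.
have const i : i != r -> (S t U).1 i 0 = (S t U).1 j 0.
  move: i; apply: (root_to_leaves_ind e_tree c_gt0) => [i ri|n i nr ni <-].
    by rewrite (root_child_unique r_simple ri rj).
  have [_ nodes] := phase_spaceH St.
  by rewrite (nodes n i) ?(inner_multiple e_tree nr ni) ?in_out_edges // (flat n 1).
exists ((S t U).1 j 0) => i ir x x01; split; first by rewrite flat // const.
have [_ ->] := pos i ir; last by rewrite in_itv.
by have [] := zero i x ir x01.
Qed.

Lemma extinct_constant T0 : 0 <= T0 -> extinct_after T0 ->
  exists C, forall t, T0 < t -> forall i, i != r -> forall x, 0 <= x <= 1 ->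
    (S t U).1 i x = C.
Proof.
move=> T00 ext; have [j rj] := root_child_exists r_simple.
have jr := directed_neq_root e_tree rj.
have T1 : T0 < T0 + 1 by rewrite ltrDl.
have eqt s t : T0 < s -> s <= t -> (S t U).1 j 0 = (S s U).1 j 0.
  move=> Ts st; have s0 : 0 <= s by lra.
  have zI : 0 \in `[0 : R, 1] by rewrite in_itv /= lexx ler01.
  suff h u : s <= u -> {in `[0, 1], (S u W).1 j =1 cst 0}.
    exact: (position_stationary S_semigroup jr s0 hU hW AUW h st zI).
  move=> su x; rewrite in_itv /= => x01; have Tu : T0 < u by lra.
  by have [C /(_ j jr x x01)[]] := extinct_equilibrium T00 ext Tu.
exists ((S (T0 + 1) U).1 j 0) => t tt i ir x x01.
have [C HC] := extinct_equilibrium T00 ext tt.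
have [-> _] := HC i ir x x01; have [<- _] := HC j jr 0 x0.
have [le|/ltW le] := leP t (T0 + 1); first by rewrite [RHS](eqt t).
by rewrite (eqt (T0 + 1)).
Qed.

End DomainSolution.
End Network.

(** * Arbitrary data *)

Lemma sqr_dist_le (R : realType) (x y z p q d : R) :
  (x - y) ^+ 2 <= 6 * p -> (x - z) ^+ 2 <= 6 * q -> p <= d -> q <= d ->
  (y - z) ^+ 2 <= 24 * d.
Proof. by move=> xy xz pd qd; have := sqr_ge0 ((x - y) + (x - z)); lra. Qed.

Lemma sqr_dist_le_quarter (R : realType) (x y z eps : R) :
  (x - z) ^+ 2 <= 24 * (eps / 96) -> (y - z) ^+ 2 <= 24 * (eps / 96) ->
  (x - y) ^+ 2 <= eps.
Proof. by move=> xz yz; have := sqr_ge0 ((x - z) + (y - z)); lra. Qed.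

Section AllData.
Context (R : realType) (V : finType) (e : rel V) (r : V).
Context (c : {set V} -> R) (alpha : V -> R) (b : root_condition).
Implicit Types (U W Z : state R V) (i j n a : V) (t : R).

Local Notation mu := (@lebesgue_measure R).
Local Notation I01 := (`[0 : R, 1 : R]%classic : set R).
Local Notation int01 f := (Rintegral mu I01 f).
Local Notation c_ i := (speed e c r i).
Local Notation H := (phase_space e r b).
Local Notation A := (wave_operator e r c alpha b).
Local Notation nrm := (normH r).

(** [edge_dense] gives [v] and [ux] that vanish at the ends of all edges, which
    makes the conditions at the nodes and at the root trivial, and it leaves the
    values of [u] at the nodes unchanged. *)
Lemma domain_dense U : H U -> forall eps, 0 < eps -> exists U' W',
  [/\ H U', H W', A U' W' & nrm (U - U') ^+ 2 < eps].
Proof.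
move=> hU eps eps0; have [reg nodes] := phase_spaceH hU.
pose d := eps / (#|V|%:R + 1).
have N0 : 0 < (#|V|%:R + 1 : R) by rewrite ltr_wpDl.
have d0 : 0 < d by rewrite divr_gt0.
have /choice[F HF] : forall i, exists uu : (R -> R) * (R -> R) * (R -> R) * (R -> R),
  let: (u', g', g'', v') := uu in
  [/\ (u' 0 = U.1 i 0 /\ u' 1 = U.1 i 1), (g' 0 = 0 /\ g' 1 = 0),
      (v' 0 = 0 /\ v' 1 = 0) &
      i != r -> [/\ H1_deriv u' g', H1_deriv g' g'', H1 v' &
      int01 (fun x => ((U.1 i x : R) - u' x) ^+ 2) +
      int01 (fun x => (weak_deriv (U.1 i) x - g' x) ^+ 2) +
      int01 (fun x => ((U.2 i x : R) - v' x) ^+ 2) < d]].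
  move=> i; have [ir|ir] := eqVneq i r.
    by exists (U.1 i : R -> R, cst 0, cst 0, cst 0).
  have [hu hv] := reg i ir; have := edge_dense hu hv d0.
  by move=> [[[[u' g'] g''] v'] [[? ? ?] ? ? ? ?]]; exists (u', g', g'', v').
pose u' i : R -> R := (F i).1.1.1; pose g' i : R -> R := (F i).1.1.2.
pose g'' i : R -> R := (F i).1.2; pose v' i : R -> R := (F i).2.
have FE i : [/\ (u' i 0 = U.1 i 0 /\ u' i 1 = U.1 i 1), (g' i 0 = 0 /\ g' i 1 = 0),
      (v' i 0 = 0 /\ v' i 1 = 0) &
      i != r -> [/\ H1_deriv (u' i) (g' i), H1_deriv (g' i) (g'' i), H1 (v' i) &
      int01 (fun x => ((U.1 i x : R) - u' i x) ^+ 2) +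
      int01 (fun x => (weak_deriv (U.1 i) x - g' i x) ^+ 2) +
      int01 (fun x => ((U.2 i x : R) - v' i x) ^+ 2) < d]].
  by have := HF i; rewrite /u' /g' /g'' /v'; case: (F i) => [[[? ?] ?] ?].
pose U' : state R V := (u', v').
pose W' : state R V := (v', fun i x => c_ i ^+ 2 * g'' i x).
have u'0 i : u' i 0 = U.1 i 0 by have [[]] := FE i.
have u'1 i : u' i 1 = U.1 i 1 by have [[]] := FE i.
have g'0 i : g' i 0 = 0 by have [_ []] := FE i.
have g'1 i : g' i 1 = 0 by have [_ []] := FE i.
have v'0 i : v' i 0 = 0 by have [_ _ []] := FE i.
have v'1 i : v' i 1 = 0 by have [_ _ []] := FE i.
have u'nodes : continuous_at_nodes e r u'.
  by move=> n i nm ni; rewrite u'0 u'1; exact: nodes.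
have v'nodes : continuous_at_nodes e r v' by move=> n i _ _; rewrite v'0 v'1.
have hU'H : spaceH e r U'.
  split=> // i ir; have [_ _ _ /(_ ir)[h1 h2 h3 _]] := FE i.
  by split; [exists (g' i)|exact: H1_L2].
have hW'H : spaceH e r W'.
  split=> // i ir; have [_ _ _ /(_ ir)[h1 h2 h3 _]] := FE i.
  by split=> //; apply: L2Z; case: h2.
have hU' : H U'.
  move: hU; rewrite /phase_space; case: (b) => // -[_ U0]; split=> // i ri.
  by rewrite /= u'0 U0.
have hW' : H W'.
  by rewrite /phase_space; case: (b) => //; split=> // i _; rewrite /= v'0.
exists U', W'; split=> //.
- exists v', g', g''; split=> //.
  + by move=> i ir; have [_ _ _ /(_ ir)[h1 h2 h3 _]] := FE i; split=> //; apply: aeW.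
  + split=> [n _ _|n _]; first by rewrite g'1 v'1 mulr0 oppr0.
    rewrite big1 => [|i _]; first by rewrite g'1 v'1 !mulr0 subrr oppr0.
    by rewrite g'0 mulr0.
  + move=> i ri; case bE: (b); rewrite ?g'0 ?v'0 ?mulr0 //; split=> //=.
    by move: hU; rewrite bE => -[_ U0]; rewrite u'0 U0.
  + by move=> i ir; split=> // ; apply: aeW.
have hD := phaseB (@phase_lin _ _ _ _ _) hU hU'.
rewrite sqr_normH; apply: (@le_lt_trans _ _ (\sum_(i | i != r) d)).
  rewrite /sqnorm; apply: ler_sum => i ir; apply: ltW.
  have [_ _ _ /(_ ir)[h1 h2 h3 h4]] := FE i; apply: le_lt_trans h4.
  have UE : U - U' = (-1) *: U' + U by rewrite scaleN1r addrC.
  have [ru ru'] := (phase_regular hU ir, phase_regular hU' ir).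
  rewrite /edge_norm UE.
  have -> : int01 (fun x => weak_deriv (((-1) *: U' + U).1 i) x ^+ 2) =
      int01 (fun x => (weak_deriv (U.1 i) x - g' i x) ^+ 2).
    apply: ae_int01_sqr.
    - by apply: L2_weak_deriv; have := regular_lin (-1) ru' ru; case.
    - by apply: L2B; [apply: L2_weak_deriv; case: ru|apply: H1_L2; exists (g'' i)].
    have := weak_deriv_lin (-1) ru' ru; have := weak_derivE h1.
    apply: filterS2 => x E1 E2 Ix; rewrite E2 // mulN1r addrC.
    by congr (_ - _); exact: E1.
  rewrite state_lin1 state_lin2.
  rewrite le_eqVlt; apply/orP; left; apply/eqP; congr (_ + _ + _); apply: eq_int01 => x _.
    by rewrite mulN1r addrC.
  by rewrite mulN1r addrC.
rewrite sumr_const -[X in X < _]mulr_natr /d mulrAC ltr_pdivrMr // ltr_pM2l //.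
apply: (@le_lt_trans _ _ #|V|%:R); last by rewrite ltrDl.
by rewrite ler_nat max_card.
Qed.

Context (S : R -> state R V -> state R V).
Hypothesis S_semigroup : network_semigroup e r c alpha b S.

Lemma position_close X Y i (x : R) : H X -> H Y -> i != r -> 0 <= x <= 1 ->
  (X.1 i x - Y.1 i x : R) ^+ 2 <= 6 * nrm (X - Y) ^+ 2.
Proof.
move=> hX hY ir x01; have XY : X - Y = (-1) *: Y + X by rewrite scaleN1r addrC.
have hD : H ((-1) *: Y + X) by exact: phase_lin.
have [h1 _] := phase_regular hD ir; have := H1_sup_le (weak_derivP h1) x01.
rewrite {1}state_lin1 mulN1r addrC => /le_trans; apply.
rewrite XY sqr_normH ler_wpM2l //; apply: le_trans (edge_norm_le _ ir).
by rewrite /edge_norm lerDl; apply: int01_ge0 => y _; exact: sqr_ge0.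
Qed.

Lemma wave_difference_le t : 0 <= t -> exists2 M, 0 <= M & forall U W, H U -> H W ->
  nrm (S t U - S t W) ^+ 2 <= M * nrm (U - W) ^+ 2.
Proof.
move=> t0; have [M HM] := wave_bounded S_semigroup t0.
exists (2 * M ^+ 2); first by rewrite mulr_ge0 // sqr_ge0.
move=> U W hU hW; have [hSU hSW] := (wave_phase S_semigroup t0 hU, wave_phase S_semigroup t0 hW).
have sub (X Y : state R V) : X - Y = (-1) *: Y + X by rewrite scaleN1r addrC.
have hD : H ((-1) *: W + U) by exact: phase_lin.
have hSD := wave_phase S_semigroup t0 hD.
have hD' : H ((-1) *: S t W + S t U) by exact: phase_lin.
have n0 : nrm (S t ((-1) *: W + U) - ((-1) *: S t W + S t U)) ^+ 2 = 0.
  case: S_semigroup => -[_ lin _ _ _] _; rewrite lin //; exact: expr0n.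
have := normH_lin (-1) (phaseB (@phase_lin _ _ _ _ _) hSD hD') hSD.
have cancelB (X Y : state R V) : (-1) *: (X - Y) + X = Y by rewrite scaleN1r opprB subrK.
rewrite n0 mulr0 add0r cancelB -(sub (S t U) (S t W)) => /le_trans; apply.
by rewrite -mulrA ler_wpM2l // (sub U W); exact: HM.
Qed.

(** Data in the domain close to [U0] give solutions close to that of [U0] at two
    given times, hence nearly equal values for the latter. Times are first moved
    beyond [T0], by continuity, since the hypothesis excludes [T0]. *)
Lemma constant_by_density T0 U0 : 0 <= T0 -> H U0 ->
  (forall U W, H U -> H W -> A U W -> exists C, forall t, T0 < t ->
     forall i, i != r -> forall x, 0 <= x <= 1 -> (S t U).1 i x = C) ->
  forall t t' i i' (x x' : R), T0 <= t -> T0 <= t' -> i != r -> i' != r ->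
    0 <= x <= 1 -> 0 <= x' <= 1 -> (S t U0).1 i x = (S t' U0).1 i' x'.
Proof.
move=> T00 hU0 dom t t' i i' x x' tt tt' ir ir' x01 x01'.
have t0 := le_trans T00 tt; have t0' := le_trans T00 tt'.
suff small eps : 0 < eps -> ((S t U0).1 i x - (S t' U0).1 i' x' : R) ^+ 2 <= eps.
  apply/eqP; rewrite -subr_eq0 -sqrf_eq0 eq_le sqr_ge0 andbT.
  by apply/ler_addgt0Pr => eps /small; rewrite add0r.
(* 96 = 4 * 24 makes up for the factors lost in the two lemmas on distances. *)
move=> eps0; pose d := eps / 96.
have d0 : 0 < d by rewrite divr_gt0.
have later s : T0 <= s -> exists2 s', T0 < s' & nrm (S s' U0 - S s U0) ^+ 2 < d.
  move=> ss; have s0 := le_trans T00 ss.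
  have [eta eta0 Heta] := wave_cont S_semigroup s0 hU0 d0.
  exists (s + eta / 2); first by lra.
  by apply: Heta; [lra|rewrite addrAC subrr add0r ger0_norm; lra].
have [s Ts sd] := later t tt; have [s' Ts' sd'] := later t' tt'.
have s0 := le_trans T00 (ltW Ts); have s0' := le_trans T00 (ltW Ts').
have [M M0 HM] := wave_difference_le s0; have [M' M0' HM'] := wave_difference_le s0'.
have K0 : 0 < M + M' + 1 by rewrite ltr_wpDl ?addr_ge0.
have [U [W [hU hW AUW UU]]] := domain_dense hU0 (divr_gt0 d0 K0).
have [C HC] := dom U W hU hW AUW.
rewrite ltr_pdivlMr // mulrC in UU.
have q0 : 0 <= nrm (U0 - U) ^+ 2 by exact: sqr_ge0.
have step u v k y N : 0 <= u -> 0 <= v -> T0 < v -> k != r -> 0 <= y <= 1 ->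
    N <= M + M' + 1 ->
    (forall X Y, H X -> H Y -> nrm (S v X - S v Y) ^+ 2 <= N * nrm (X - Y) ^+ 2) ->
    nrm (S v U0 - S u U0) ^+ 2 < d -> ((S u U0).1 k y - C : R) ^+ 2 <= 24 * d.
  move=> u0 v0 Tv kr y01 NM HN vu.
  have [hv hu] := (wave_phase S_semigroup v0 hU0, wave_phase S_semigroup u0 hU0).
  have c1 := position_close hv hu kr y01.
  have c2 := position_close hv (wave_phase S_semigroup v0 hU) kr y01.
  rewrite (HC v Tv k kr y y01) in c2.
  have c3 := le_trans (HN U0 U hU0 hU) (le_trans (ler_wpM2r q0 NM) (ltW UU)).
  exact: sqr_dist_le c1 c2 (ltW vu) c3.
have NM : M <= M + M' + 1 by rewrite -addrA lerDl addr_ge0.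
have NM' : M' <= M + M' + 1 by rewrite [M + M']addrC -addrA lerDl addr_ge0.
have k1 := step t s i x M t0 s0 Ts ir x01 NM HM sd.
have k2 := step t' s' i' x' M' t0' s0' Ts' ir' x01' NM' HM' sd'.
exact: sqr_dist_le_quarter k1 k2.
Qed.

End AllData.

(** * Extinction *)

Section Conclusion.
Context (R : realType) (V : finType) (e : rel V) (r : V).
Context (c : {set V} -> R) (alpha : V -> R) (b : root_condition).
Context (S : R -> state R V -> state R V) (U0 : state R V).
Hypothesis S_semigroup : network_semigroup e r c alpha b S.
Hypotheses (e_tree : is_tree e) (r_simple : simple_node e r).
Hypothesis c_gt0 : forall x y, e x y -> 0 < c [set x; y]%SET.
Hypothesis alphaE : forall n, multiple_node e n -> alpha n = (edges_at e r n)%:R - 2.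
Hypothesis U0_H : phase_space e r b U0.

Definition extinction_time : R :=
  if b is Transparent then tree_time e c else 2 * root_time e c r.

Lemma extinction_time_ge0 : 0 <= extinction_time.
Proof.
by rewrite /extinction_time; case: b; rewrite ?mulr_ge0 // ?bigmax_ge_id.
Qed.

Lemma eventually_constant t t' i i' (x x' : R) :
  extinction_time <= t -> extinction_time <= t' -> i != r -> i' != r ->
  0 <= x <= 1 -> 0 <= x' <= 1 -> (S t U0).1 i x = (S t' U0).1 i' x'.
Proof.
move=> tt tt' ir ir' x01 x01'.
have dom U W : phase_space e r b U -> phase_space e r b W ->
    wave_operator e r c alpha b U W -> exists C, forall t, extinction_time < t ->
    forall i, i != r -> forall x, 0 <= x <= 1 -> (S t U).1 i x = C.
  move=> hU hW AUW.
  apply: (extinct_constant S_semigroup e_tree r_simple c_gt0 hU hW AUW extinction_time_ge0).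
  have refl := reflecting_extinct S_semigroup e_tree r_simple c_gt0 alphaE hU hW AUW.
  have trans := transparent_extinct S_semigroup e_tree r_simple c_gt0 alphaE hU hW AUW.
  by move: refl trans; rewrite /extinction_time; case: (b) => [refl _|refl _|_ trans];
    [exact: refl|exact: refl|exact: trans].
exact: (constant_by_density S_semigroup extinction_time_ge0 U0_H dom tt tt' ir ir' x01 x01').
Qed.

End Conclusion.

Theorem theorem3 (R : realType) (V : finType) (e : rel V) (r : V)
    (c : {set V} -> R) (alpha : V -> R) (U0 : state R V)
    (e_tree : is_tree e) (r_simple : simple_node e r)
    (c_gt0 : forall x y, e x y -> 0 < c [set x; y]%SET)
    (alphaE : forall n, multiple_node e n -> alpha n = (edges_at e r n)%:R - 2)
    (U0_H : spaceH e r U0) :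
  [/\ forall S : R -> state R V -> state R V,
        network_semigroup e r c alpha Dirichlet S -> spaceH0 e r U0 ->
        forall t, 2 * root_time e c r <= t ->
        forall i, i != r -> forall x, x \in `[0, 1] -> (S t U0).1 i x = 0,
      forall S : R -> state R V -> state R V,
        network_semigroup e r c alpha Neumann S ->
        exists C : R, forall t, 2 * root_time e c r <= t ->
        forall i, i != r -> forall x, x \in `[0, 1] -> (S t U0).1 i x = C &
      forall S : R -> state R V -> state R V,
        network_semigroup e r c alpha Transparent S ->
        exists C : R, forall t, tree_time e c <= t ->
        forall i, i != r -> forall x, x \in `[0, 1] -> (S t U0).1 i x = C].
Proof.
have [j rj] := root_child_exists r_simple; have jr := directed_neq_root e_tree rj.
have z01 : 0 <= (0 : R) <= 1 by rewrite lexx ler01.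
have T0 b := extinction_time_ge0 e r c b.
split=> [S sg U0_H0 t tt i ir x xI|S sg|S sg].
- have x01 : 0 <= x <= 1 by rewrite in_itv in xI.
  rewrite (eventually_constant sg e_tree r_simple c_gt0 alphaE U0_H0 tt tt ir jr x01 z01).
  have [_ -> //] := wave_phase sg (le_trans (T0 Dirichlet) tt) U0_H0.
  by rewrite inE.
- exists ((S (extinction_time e r c Neumann) U0).1 j 0) => t tt i ir x xI.
  have x01 : 0 <= x <= 1 by rewrite in_itv in xI.
  exact: (eventually_constant sg e_tree r_simple c_gt0 alphaE U0_H tt (lexx _) ir jr x01 z01).
- exists ((S (extinction_time e r c Transparent) U0).1 j 0) => t tt i ir x xI.
  have x01 : 0 <= x <= 1 by rewrite in_itv in xI.
  exact: (eventually_constant sg e_tree r_simple c_gt0 alphaE U0_H tt (lexx _) ir jr x01 z01).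
Qed.
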